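(* Let $\frac12<\theta<1$ and suppose that $u$ is a weak solution of the incompressible Euler equations on $\mathbb{T}^3\times(0,\infty)$ such that $u\in L^\infty_t(W^{\theta,3}_x)$. Let $H=H(t)$ be the helicity of $u$. Then there exists a constant $C>0$ such that, for all times $t,s$, $$|H(t)-H(s)|\le C|t-s|^{\frac{2\theta-1}{1-\theta}}.$$
   Context: $\mathbb{T}^3=\mathbb{R}^3/\mathbb{Z}^3$ is the three-dimensional flat torus. The incompressible Euler equations for a velocity $u:\mathbb{T}^3\times(0,\infty)\to\mathbb{R}^3$ and a pressure $p:\mathbb{T}^3\times(0,\infty)\to\mathbb{R}$ are $$\partial_t u+\operatorname{div}(u\otimes u)+\nabla p=0,\qquad \operatorname{div}u=0.$$ A weak solution is a vector field $u$ satisfying these equations in the sense of distributions on $\mathbb{T}^3\times(0,\infty)$ for some distribution $p$. For $0<\theta<1$ and $1\le m<\infty$, the (spatial) Sobolev norm is $$\|f\|_{W^{\theta,m}}=\|f\|_{L^m}+\Big(\int_{\mathbb{T}^3}\int_{\mathbb{T}^3}\frac{|f(x)-f(y)|^m}{|x-y|^{\theta m+3}}\,dx\,dy\Big)^{1/m}.$$ For a spatial Banach space $X$, $f\in L^\infty_t(X_x)$ means $\operatorname{ess\,sup}_{t>0}\|f(t)\|_X<\infty$. The helicity is $H(t)=\int_{\mathbb{T}^3}u(x,t)\cdot\operatorname{curl}u(x,t)\,dx$. When $u(t)$ is only in $W^{\frac12,2}$ (which is implied by $u(t)\in W^{\theta,3}$ with $\theta>\frac12$), $H(t)$ is the action of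 the functional $\operatorname{curl}u\in W^{-\frac12,2}$ on $u\in W^{\frac12,2}$, represented as $$H(t)=\int_{\mathbb{T}^3}(-\Delta)^{\frac14}u\cdot(-\Delta)^{-\frac14}\operatorname{curl}u\,dx,$$ where the fractional powers of $-\Delta$ are Fourier multipliers (note $\operatorname{curl}u$ has zero mean). The constant $C$ may depend on $u$ (and on $\theta$), but not on $t,s$. The helicity $H(t)$ is defined for almost every $t$; statements for all times refer to its representative that is continuous in time (equivalently, the inequality holds for almost every $t,s$). *)

(* Defs.v *)
From mathcomp Require Import all_boot all_order all_algebra.
From mathcomp Require Import all_classical all_reals all_analysis.
From mathcomp Require Import ess_sup_inf complex.

Set Implicit Arguments.
Unset Strict Implicit.
Unset Printing Implicit Defensive.

Import Order.TTheory GRing.Theory Num.Theory.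
Import numFieldNormedType.Exports.

Local Open Scope classical_set_scope.
Local Open Scope ring_scope.

(* R^3, at once as a normed module (for derivatives) and as a measurable space
   (for Lebesgue measure). *)
Notation vec R := (R * R * R)%type.

Section Torus.
Context {R : realType}.
Implicit Types (x y v w k : vec R) (f : vec R -> vec R) (g phi : vec R -> R).

Definition vcoord x (i : 'I_3) : R := [:: x.1.1; x.1.2; x.2]`_i.

Definition unit_vec (i : 'I_3) : vec R :=
  ((i == 0)%:R, (i == 1)%:R, (i == 2%:R)%:R).

Definition dot x y : R := \sum_i vcoord x i * vcoord y i.

(* The Euclidean norm; the library's norm on products is the sup norm. *)
Definition enorm x : R := Num.sqrt (dot x x).

Definition lattice : set (vec R) :=
  [set k | forall i, exists n : int, vcoord k i = n%:~R].

(* A function on the torus R^3/Z^3 is a Z^3-periodic function on R^3. *)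
Definition torus_periodic (T : Type) (h : vec R -> T) : Prop :=
  forall x k, lattice k -> h (x + k) = h x.

Definition cell : set (vec R) := (`[0, 1[ `*` `[0, 1[) `*` `[0, 1[.

Lemma measurable_cell :
  measurable (cell : set (measurableTypeR R * measurableTypeR R *
                          measurableTypeR R)%type).
Proof. by do 2?apply: measurableX; exact: measurable_itv. Qed.

(* Integration over the torus is integration over a fundamental cell. *)
Definition torus_measure :
    {measure set (measurableTypeR R * measurableTypeR R *
                  measurableTypeR R)%type -> \bar R} :=
  mrestr (lebesgue_measure \x lebesgue_measure \x lebesgue_measure)%E
    measurable_cell.

Definition torus_dist x y : R := inf [set enorm (x - y + k) | k in lattice].

Definition gagliardo (theta m : R) f : \bar R :=
  (\int[torus_measure]_x \int[torus_measure]_y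
     (enorm (f x - f y) `^ m / torus_dist x y `^ (theta * m + 3))%:E)%E.

Definition sobolev_norm (theta m : R) f : \bar R :=
  ('N[torus_measure]_(m%:E)[(fun x => (enorm (f x))%:E)]
   + gagliardo theta m f `^ (1 / m))%E.

(* Distributions on the torus, as functionals on smooth periodic functions. *)
Definition distr_of_fun g phi : R := \int[torus_measure]_x (g x * phi x).

Definition distr_partial (i : 'I_3) (T : (vec R -> R) -> R) phi : R :=
  - T ('D_(unit_vec i) phi).

(* Indices are added modulo 3:
   (curl f)_i = partial_(i+1) f_(i+2) - partial_(i+2) f_(i+1). *)
Definition curl_distr f (i : 'I_3) phi : R :=
  distr_partial (i + 1) (distr_of_fun (fun x => vcoord (f x) (i + 2%:R))) phi
  - distr_partial (i + 2%:R) (distr_of_fun (fun x => vcoord (f x) (i + 1))) phi.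

(* T tested against exp(-2 pi i k.x), with real and imaginary parts separated
   since T acts on real functions. *)
Definition fourier_coef (T : (vec R -> R) -> R) k : R[i] :=
  Complex (T (fun x => cos (2 * pi * dot k x)))
          (- T (fun x => sin (2 * pi * dot k x))).

Definition torus_L2 g : Prop :=
  [/\ torus_periodic g,
      measurable_fun
        [set: (measurableTypeR R * measurableTypeR R * measurableTypeR R)%type]
        (g : _ -> measurableTypeR R) &
      (\int[torus_measure]_x ((g x) ^+ 2)%:E < +oo)%E].

(* (-Delta)^s T as an L^2 function (unique up to null sets), when there is one;
   otherwise the junk value 0.  As 0 `^ s = 0 for s != 0, the zero mode is
   annihilated for negative s too. *)
Definition frac_laplacian (s : R) (T : (vec R -> R) -> R) : vec R -> R :=
  xget (fun=> 0) [set g | torus_L2 g /\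
    forall k, lattice k ->
      fourier_coef (distr_of_fun g) k =
      (((2 * pi) ^+ 2 * dot k k) `^ s)%:C%C * fourier_coef T k].

Definition helicity f : R :=
  \int[torus_measure]_x \sum_i
    frac_laplacian (1 / 4) (distr_of_fun (fun y => vcoord (f y) i)) x *
    frac_laplacian (- (1 / 4)) (curl_distr f i) x.

End Torus.

Section Smooth.
Context {R : realType} {V : normedModType R}.

Definition iter_derive (s : seq V) (f : V -> R) : V -> R :=
  foldr (fun v g => 'D_v g) f s.

(* C^infinity: all iterated directional derivatives exist and are continuous. *)
Definition smooth (f : V -> R) : Prop :=
  forall s : seq V, continuous (iter_derive s f) /\
    forall v x, derivable (iter_derive s f) x v.

End Smooth.

Section Euler.
Context {R : realType}.
Implicit Types (phi : vec R * R -> R) (u : R -> vec R -> vec R).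

Definition time_measure : {measure set (measurableTypeR R) -> \bar R} :=
  mrestr lebesgue_measure (measurable_itv `]0%R, +oo[).

Definition spacetime : set (vec R * R) := [set z | 0 < z.2].

Definition spacetime_measure :
    {measure set (measurableTypeR R * measurableTypeR R * measurableTypeR R
                  * measurableTypeR R)%type -> \bar R} :=
  (torus_measure \x lebesgue_measure)%E.

Definition test_function_on (a b : R) phi : Prop :=
  [/\ smooth phi, forall t, torus_periodic (fun x => phi (x, t)) &
      forall x t, ~~ (a <= t <= b) -> phi (x, t) = 0].

Definition test_function phi : Prop :=
  exists a b : R, 0 < a /\ test_function_on a b phi.

(* Distributions on the torus times (0, oo): continuity is the usual estimate,
   on each compact time interval, by a C^N norm of the test function. *)
Definition is_distribution (p : (vec R * R -> R) -> R) : Prop :=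
  (forall (c : R) phi psi, test_function phi -> test_function psi ->
     p (fun z => c * phi z + psi z) = c * p phi + p psi) /\
  (forall a b : R, 0 < a -> exists (N : nat) (C : R),
     forall phi (M : R), test_function_on a b phi ->
       (forall s z, (size s <= N)%N -> all (fun v => `|v| <= 1) s ->
          `|iter_derive s phi z| <= M) ->
       `|p phi| <= C * M).

Definition dx (i : 'I_3) phi : vec R * R -> R := 'D_(unit_vec i, 0 : R) phi.
Definition dt phi : vec R * R -> R := 'D_(0 : vec R, 1 : R) phi.

(* u is square integrable locally in time, so that u (x) u is a distribution. *)
Definition euler_weak_solution u : Prop :=
  [/\ forall t, 0 < t -> torus_periodic (u t),
      measurable_fun
        (spacetime : set (measurableTypeR R * measurableTypeR R *
                          measurableTypeR R * measurableTypeR R)%type)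
        ((fun z => u z.2 z.1) : _ -> (measurableTypeR R * measurableTypeR R *
                                      measurableTypeR R)%type),
      forall a b : R, 0 < a ->
        (\int[spacetime_measure]_(z in [set z | (a <= z.2 <= b)%R])
           ((enorm (u z.2 z.1)) ^+ 2)%:E < +oo)%E,
      forall phi, test_function phi ->
        \int[spacetime_measure]_(z in spacetime)
          (\sum_j vcoord (u z.2 z.1) j * dx j phi z) = 0 &
      exists2 p, is_distribution p &
        forall i phi, test_function phi ->
          \int[spacetime_measure]_(z in spacetime)
            (vcoord (u z.2 z.1) i * dt phi z
             + \sum_j vcoord (u z.2 z.1) i * vcoord (u z.2 z.1) j * dx j phi z)
          + p (dx i phi) = 0].

Definition Linfty_sobolev (theta m : R) u : Prop :=
  (ess_sup time_measure (fun t => sobolev_norm theta m (u t)) < +oo)%E.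

End Euler.

(* Main.v *)
Require Import Defs.
From HB Require Import structures.
From mathcomp Require Import all_boot all_order all_algebra.
From mathcomp Require Import all_classical all_reals all_analysis.
From mathcomp Require Import measurable_realfun ess_sup_inf complex ring lra zify.

Set Implicit Arguments.
Unset Strict Implicit.
Unset Printing Implicit Defensive.

Import Order.TTheory GRing.Theory Num.Theory.
Import numFieldNormedType.Exports.

Local Open Scope classical_set_scope.
Local Open Scope ring_scope.

(** The theorem is true because the helicity behaves like a quantity of order
    2 theta with one derivative to pay. Mollify the field at scale 1 / N. Then

    - the helicity of the mollified field differs from H by a multiple of
      N ^ (1 - 2 theta), because the helicity pairs the field with its curl:
      two increments of size N ^ (- theta) and one derivative;

    - in time, the helicity of the mollified field changes at most at the rate
      N ^ (2 - 3 theta). The quadratic term of a smooth solenoidal field does not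
      change the helicity (it is a gradient plus curl w x w, both orthogonal to
      curl w), so that only the commutator of mollification and multiplication
      contributes: three increments and two derivatives.

    Balancing N ^ (1 - 2 theta) with N ^ (2 - 3 theta) |t - s| gives
    N ^ (1 - theta) = 1 / |t - s| and the exponent of the theorem.

    The mollifier is a power of cosines, a positive trigonometric polynomial.
    Mollified fields are then finite lists of waves, on which derivatives,
    integration by parts and Fourier multipliers are exact finite computations.
    The fractional seminorm enters only through the third moment of the
    increments against the mollifier ([gagliardo_rough]), and powers of the
    kernel control its own derivatives ([ddK_le]).

    In space, [hel_diff] compares two consecutive dyadic scales. The same
    estimates show that the quarter powers of the Laplacian of the mollified
    fields converge in L^2 ([riesz_fischer]); since the trigonometric system is
    complete ([orth_ae0]), the limits are the functions that define the
    helicity, which is therefore the limit of the mollified helicities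
    ([hel_approx]).

    In time, a curl is tested in the weak formulation, so that the pressure
    disappears ([curl_weak_derivative]). At almost every pair of times the
    moments of the solution against all the waves satisfy an integral identity
    ([good_identity]): the exceptional set comes from countably many waves and
    their Lebesgue points. The mollified helicity is a quadratic function of
    these moments. The test field of one time is used at another time, which
    produces an error quadratic in the length of the time interval, and
    subdivision of the interval removes it ([hel_time]).

    The bound obtained on a set of times of full measure ([holder_good]) extends
    to all positive times by uniform continuity ([holder_extension]). *)

(** * Real-valued integrals *)

Section Integrals.
Context d (T : measurableType d) (R : realType).
Variable mu : {measure set T -> \bar R}.
Implicit Types (f g h : T -> R).

Definition intg f := mu.-integrable setT (EFin \o f).

Lemma intg_measurable f : intg f -> measurable_fun setT f.
Proof. by move=> /measurable_int/measurable_EFinP. Qed.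

Lemma intg_le f g : measurable_fun setT f -> intg g ->
  (forall x, `|f x| <= g x) -> intg f.
Proof.
move=> mf ig fg; apply: (le_integrable measurableT _ _ ig).
  exact/measurable_EFinP.
by move=> x _ /=; rewrite lee_fin (le_trans (fg x))// ler_norm.
Qed.

Lemma intg_eq f g : f =1 g -> intg f -> intg g.
Proof. by move=> /funext ->. Qed.

Lemma intgD f g : intg f -> intg g -> intg (fun x => f x + g x).
Proof.
move=> hf hg; have := integrableD measurableT hf hg.
by apply: eq_integrable => // x _ /=; rewrite EFinD.
Qed.

Lemma intgN f : intg f -> intg (fun x => - f x).
Proof.
by move=> hf; have := integrableN hf; apply: eq_integrable.
Qed.

Lemma intgB f g : intg f -> intg g -> intg (fun x => f x - g x).
Proof. by move=> hf hg; apply: intgD => //; apply: intgN. Qed.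

Lemma intgZ (c : R) f : intg f -> intg (fun x => c * f x).
Proof.
move=> hf; have := integrableZl measurableT c hf.
by apply: eq_integrable => // x _ /=; rewrite EFinM.
Qed.

Lemma intgZr (c : R) f : intg f -> intg (fun x => f x * c).
Proof. by move=> /(intgZ c); apply: intg_eq => x; rewrite mulrC. Qed.

Lemma intg0 : intg (fun=> 0).
Proof. exact: integrable0. Qed.

Lemma intg_sum (I : Type) (s : seq I) (F : I -> T -> R) :
  (forall i, intg (F i)) -> intg (fun x => \sum_(i <- s) F i x).
Proof.
move=> h; elim: s => [|i s IH].
  by apply: intg_eq intg0 => x; rewrite big_nil.
by apply: intg_eq (intgD (h i) IH) => x; rewrite big_cons.
Qed.

Lemma intg_norm f : intg f -> intg (fun x => `|f x|).
Proof.
move=> hf; apply: (intg_le _ (g := fun x => `|f x|)); last by move=> x; rewrite normr_id.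
  by apply: measurableT_comp => //; exact: intg_measurable.
exact: integrable_norm.
Qed.

Lemma intg_bndl h f (M : R) : measurable_fun setT h -> (forall x, `|h x| <= M) ->
  intg f -> intg (fun x => h x * f x).
Proof.
move=> mh hM hf; apply: (intg_le _ (intgZ M (intg_norm hf))).
  by apply: measurable_funM => //; exact: intg_measurable.
by move=> x; rewrite normrM ler_wpM2r.
Qed.

Lemma intg_bndr h f (M : R) : measurable_fun setT h -> (forall x, `|h x| <= M) ->
  intg f -> intg (fun x => f x * h x).
Proof. by move=> mh hM /(intg_bndl mh hM); apply: intg_eq => x; rewrite mulrC. Qed.

Lemma RintZ (c : R) f : intg f -> \int[mu]_x (c * f x) = c * \int[mu]_x f x.
Proof. by move=> hf; rewrite RintegralZl. Qed.

Lemma RintZr (c : R) f : intg f -> \int[mu]_x (f x * c) = \int[mu]_x f x * c.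
Proof. by move=> hf; rewrite RintegralZr. Qed.

Lemma RintN f : intg f -> \int[mu]_x (- f x) = - \int[mu]_x f x.
Proof.
move=> hf; rewrite -mulN1r -RintZ//.
by apply: eq_Rintegral => x _; rewrite mulN1r.
Qed.

Lemma Rint_0 : \int[mu]_x (0 : R) = 0.
Proof. by rewrite /Rintegral integral0. Qed.

Lemma RintD f g : intg f -> intg g ->
  \int[mu]_x (f x + g x) = \int[mu]_x f x + \int[mu]_x g x.
Proof. by move=> hf hg; rewrite RintegralD. Qed.

Lemma RintB f g : intg f -> intg g ->
  \int[mu]_x (f x - g x) = \int[mu]_x f x - \int[mu]_x g x.
Proof. by move=> hf hg; rewrite RintegralB. Qed.

Lemma Rint_sum (I : Type) (s : seq I) (F : I -> T -> R) :
  (forall i, intg (F i)) ->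
  \int[mu]_x (\sum_(i <- s) F i x) = \sum_(i <- s) \int[mu]_x F i x.
Proof.
move=> h; elim: s => [|i s IH].
  by rewrite big_nil -[RHS]Rint_0; apply: eq_Rintegral => x _; rewrite big_nil.
rewrite big_cons -IH -RintD//; last exact: intg_sum.
by apply: eq_Rintegral => x _; rewrite big_cons.
Qed.

Lemma Rint_ext f g : f =1 g -> \int[mu]_x f x = \int[mu]_x g x.
Proof. by move=> fg; apply: eq_Rintegral => x _. Qed.

Lemma Rint_le f g : intg f -> intg g -> (forall x, f x <= g x) ->
  \int[mu]_x f x <= \int[mu]_x g x.
Proof. by move=> hf hg fg; apply: le_Rintegral. Qed.

Lemma Rint_norm_le f g : intg f -> intg g -> (forall x, `|f x| <= g x) ->
  `|\int[mu]_x f x| <= \int[mu]_x g x.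
Proof.
move=> hf hg fg; apply: (le_trans (le_normr_Rintegral measurableT hf)).
by apply: Rint_le => //; apply: intg_norm.
Qed.

Lemma Rint_ge0 f : (forall x, 0 <= f x) -> 0 <= \int[mu]_x f x.
Proof. by move=> h; apply: Rintegral_ge0. Qed.

Lemma EFin_Rint f : intg f -> ((\int[mu]_x f x)%:E = \int[mu]_x (f x)%:E)%E.
Proof. by move=> hf; rewrite fineK//; apply: integrable_fin_num. Qed.

Lemma intg_ge0 f (A : R) : measurable_fun setT f -> (forall x, 0 <= f x) ->
  (\int[mu]_x (f x)%:E <= A%:E)%E -> intg f /\ \int[mu]_x f x <= A.
Proof.
move=> mf f0 hA.
have hf : intg f.
  apply/integrableP; split; first exact/measurable_EFinP.
  under eq_integral do rewrite /= ger0_norm//.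
  by apply: (le_lt_trans hA); rewrite ltry.
by split=> //; rewrite -lee_fin EFin_Rint.
Qed.

(** Bochner-style integrability from a Tonelli bound. *)
Lemma intg_lty f : measurable_fun setT f -> (forall x, 0 <= f x) ->
  (\int[mu]_x (f x)%:E < +oo)%E -> intg f.
Proof.
move=> mf f0 hA; apply/integrableP; split; first exact/measurable_EFinP.
by under eq_integral do rewrite /= ger0_norm//.
Qed.

Lemma Rint_ae_eq f g : measurable_fun setT f -> measurable_fun setT g ->
  (\forall x \ae mu, f x = g x) -> \int[mu]_x f x = \int[mu]_x g x.
Proof.
move=> mf mg fg; congr fine; apply: ae_eq_integral => //.
- exact/measurable_EFinP.
- exact/measurable_EFinP.
- by move: fg; apply: filterS => x -> _.
Qed.

End Integrals.

Section FiniteMeasure.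
Context d (T : measurableType d) (R : realType).
Variable mu : {finite_measure set T -> \bar R}.

Lemma intg_cst (c : R) : intg mu (fun=> c).
Proof. by apply: finite_measure_integrable_cst. Qed.

Lemma intg_bounded (f : T -> R) (M : R) : measurable_fun setT f ->
  (forall x, `|f x| <= M) -> intg mu f.
Proof. by move=> mf hM; apply: (intg_le mf (intg_cst M)). Qed.

End FiniteMeasure.

Section RealFubini.
Context d1 d2 (T1 : measurableType d1) (T2 : measurableType d2) (R : realType).
Variable m1 : {sigma_finite_measure set T1 -> \bar R}.
Variable m2 : {sigma_finite_measure set T2 -> \bar R}.
Implicit Types F : T1 * T2 -> R.

Lemma intg_fine d (T : measurableType d) (mu : {measure set T -> \bar R})
    (g : T -> \bar R) :
  mu.-integrable setT g ->
  intg mu (fine \o g) /\ \int[mu]_x (fine (g x)) = fine (\int[mu]_x g x)%E.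
Proof.
move=> hg; have mg := measurable_int mu hg.
have mfg : measurable_fun setT (EFin \o (fine \o g)).
  by apply/measurable_EFinP; apply: measurableT_comp.
split.
  apply: (le_integrable measurableT mfg _ hg) => x _ /=.
  by case: (g x) => //=; rewrite normr0 leey.
congr fine; apply: ae_eq_integral => //.
have := integrable_ae measurableT hg; apply: filterS => x /= h _.
by rewrite fineK// h.
Qed.

Lemma Rfubini1 F : intg (m1 \x m2)%E F ->
  intg m1 (fun x => \int[m2]_y F (x, y)) /\
  \int[m1]_x \int[m2]_y F (x, y) = \int[(m1 \x m2)%E]_z F z.
Proof.
move=> hF; have [h1 h2] := intg_fine (integrable_fubini_F hF).
split; first exact: h1.
by rewrite [LHS]h2; congr fine; exact: integral12_prod_meas1.
Qed.

Lemma Rfubini2 F : intg (m1 \x m2)%E F ->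
  intg m2 (fun y => \int[m1]_x F (x, y)) /\
  \int[m2]_y \int[m1]_x F (x, y) = \int[(m1 \x m2)%E]_z F z.
Proof.
move=> hF; have mF := measurable_int _ hF.
have iG : m2.-integrable setT (fubini_G m1 (EFin \o F)).
  apply/integrableP; split; first exact: (measurable_fubini_G hF).
  apply: (le_lt_trans _ ((integrable21ltyP m1 m2 mF).1 hF)).
  have mA : measurable_fun setT (abse \o (EFin \o F)) by exact: measurableT_comp.
  apply: ge0_le_integral => //.
  - by apply: measurableT_comp => //; exact: (measurable_fubini_G hF).
  - by apply: (measurable_fun_fubini_tonelli_G (abse \o (EFin \o F))) => //=.
  - move=> y _; apply: le_abse_integral => //.
    by apply: measurableT_comp mF _.
have [h1 h2] := intg_fine iG.
split; first exact: h1.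
by rewrite [LHS]h2; congr fine; exact: integral21_prod_meas1.
Qed.

Lemma Rfubini F : intg (m1 \x m2)%E F ->
  \int[m1]_x \int[m2]_y F (x, y) = \int[m2]_y \int[m1]_x F (x, y).
Proof. by move=> hF; rewrite (Rfubini1 hF).2 (Rfubini2 hF).2. Qed.

(** Tensor products are the source of integrability on the product space. *)
Lemma intg_tensor (f : T1 -> R) (g : T2 -> R) : intg m1 f -> intg m2 g ->
  intg (m1 \x m2)%E (fun z => f z.1 * g z.2).
Proof.
move=> hf hg.
have mf := intg_measurable hf; have mg := intg_measurable hg.
have mF : measurable_fun setT (fun z : T1 * T2 => f z.1 * g z.2).
  by apply: measurable_funM; apply: measurableT_comp.
have mE : measurable_fun setT (EFin \o (fun z : T1 * T2 => f z.1 * g z.2)).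
  exact/measurable_EFinP.
rewrite /intg; apply/(integrable12ltyP m1 m2 mE).
under eq_integral => x _.
  under eq_integral => y _ do rewrite /= normrM EFinM.
  rewrite ge0_integralZl_EFin//; last first.
    by apply/measurable_EFinP; apply: measurableT_comp.
  rewrite -EFin_Rint; last exact: intg_norm.
  over.
rewrite /=.
under eq_integral do rewrite -EFinM.
rewrite -EFin_Rint ?ltry//.
by apply: intgZr; exact: intg_norm.
Qed.

End RealFubini.

(** * The torus as a probability space *)

Section TorusMeasure.
Context {R : realType}.
Local Notation V := (measurableTypeR R * measurableTypeR R * measurableTypeR R)%type.

Lemma unit_itv_measure : lebesgue_measure (`[0, 1[ : set (measurableTypeR R)) = 1%E.
Proof. by rewrite lebesgue_measure_itv/= lte_fin ltr01 sube0. Qed.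

(** A copy of the torus measure, on which the structure of a finite measure
    can be declared. *)
Definition tmu : set V -> \bar R :=
  mrestr (lebesgue_measure \x lebesgue_measure \x lebesgue_measure)%E
    measurable_cell.

HB.instance Definition _ := Measure.on tmu.

Lemma torus_measureE : @torus_measure R = tmu.
Proof. by []. Qed.

Lemma lebesgue2E (A B : set (measurableTypeR R)) : measurable A -> measurable B ->
  (lebesgue_measure \x lebesgue_measure)%E (A `*` B) =
  (lebesgue_measure A * lebesgue_measure B)%E.
Proof. by move=> mA mB; apply: product_measure1E. Qed.

Lemma lebesgue3E (A : set (measurableTypeR R * measurableTypeR R)) (B : set (measurableTypeR R)) :
  measurable A -> measurable B ->
  (lebesgue_measure \x lebesgue_measure \x lebesgue_measure)%E (A `*` B) =
  ((lebesgue_measure \x lebesgue_measure)%E A * lebesgue_measure B)%E.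
Proof. by move=> mA mB; apply: product_measure1E. Qed.

Lemma torus_measureT : tmu setT = 1%E.
Proof.
rewrite /tmu /mrestr setTI /cell lebesgue3E ?lebesgue2E//; last first.
  by apply: measurableX; exact: measurable_itv.
by rewrite !unit_itv_measure !mule1.
Qed.

Lemma torus_measure_finite : fin_num_fun tmu.
Proof. apply: lty_fin_num_fun; exact: (eq_ind_r (fun z => (z < +oo)%E) (ltry 1) torus_measureT). Qed.

HB.instance Definition _ := Measure_isFinite.Build _ _ _ tmu torus_measure_finite.

Definition circle_measure : set (measurableTypeR R) -> \bar R :=
  mrestr lebesgue_measure (measurable_itv `[0%R, 1%R[).
Local Notation nu := circle_measure.

HB.instance Definition _ := Measure.on circle_measure.

Lemma circle_measureT : nu setT = 1%E.
Proof. by rewrite /circle_measure /mrestr setTI unit_itv_measure. Qed.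

Lemma circle_measure_finite : fin_num_fun nu.
Proof. apply: lty_fin_num_fun; exact: (eq_ind_r (fun z => (z < +oo)%E) (ltry 1) circle_measureT). Qed.

HB.instance Definition _ := Measure_isFinite.Build _ _ _ nu circle_measure_finite.

(** The two-dimensional torus is introduced separately, so that the measure
    of the three-dimensional one is a product of finite measures and can be
    integrated iteratively. *)
Definition circle2_measure : set (measurableTypeR R * measurableTypeR R)%type -> \bar R :=
  (nu \x nu)%E.
Local Notation nu2 := circle2_measure.

HB.instance Definition _ := Measure.on circle2_measure.

Lemma circle2_measureE A B : measurable A -> measurable B ->
  nu2 (A `*` B) = (nu A * nu B)%E.
Proof. by move=> mA mB; apply: product_measure1E. Qed.

Lemma circle2_measureT : nu2 setT = 1%E.
Proof. by rewrite -setXTT circle2_measureE// circle_measureT mule1. Qed.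

Lemma circle2_measure_finite : fin_num_fun nu2.
Proof.
apply: lty_fin_num_fun; exact: (eq_ind_r (fun z => (z < +oo)%E) (ltry 1) circle2_measureT).
Qed.

HB.instance Definition _ := Measure_isFinite.Build _ _ _ nu2 circle2_measure_finite.

Lemma torus_measure_prod A : measurable A -> (nu2 \x nu)%E A = tmu A.
Proof.
move=> mA; have := @product_measure_unique _ _ _ _ _ nu2 nu tmu.
apply => // {mA}A B mA mB.
rewrite /= /tmu /mrestr /cell -setXI lebesgue3E//; last first.
- by apply: measurableI => //; exact: measurable_itv.
- by apply: measurableI => //; apply: measurableX; exact: measurable_itv.
congr (_ * _)%E.
pose m' : {measure set (measurableTypeR R * measurableTypeR R)%type -> \bar R} :=
  mrestr (lebesgue_measure \x lebesgue_measure)%E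
    (measurableX (measurable_itv `[0%R, 1%R[) (measurable_itv `[0%R, 1%R[)).
rewrite -[LHS]/(m' A); apply/esym.
have := @product_measure_unique _ _ _ _ _ nu nu m'; apply => // C D mC mD.
rewrite /m' /mrestr /= /mrestr -setXI lebesgue2E//.
- by apply: measurableI => //; exact: measurable_itv.
- by apply: measurableI => //; exact: measurable_itv.
Qed.

Definition circle3_measure : {measure set V -> \bar R} := (nu2 \x nu)%E.

Lemma torus_integralE (f : V -> \bar R) :
  (\int[tmu]_x f x = \int[circle3_measure]_x f x)%E.
Proof.
apply: (@eq_measure_integral _ _ R setT circle3_measure tmu f) => A mA _.
exact/esym/torus_measure_prod.
Qed.

Lemma torus_Rintegral (F : V -> R) : measurable_fun setT F ->
  (forall x, `|F x| <= 1) ->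
  \int[tmu]_x F x = \int[nu2]_y \int[nu]_s F (y, s).
Proof.
move=> mF F1.
have i1 : intg circle3_measure F.
  apply: (intg_le mF (intg_tensor (intg_cst nu2 1) (intg_cst nu 1))) => x.
  by rewrite mulr1.
have [_ h] := @Rfubini1 _ _ _ _ _ nu2 nu F i1.
apply: etrans (esym h); rewrite /Rintegral; exact: (congr1 fine (torus_integralE (EFin \o F))).
Qed.

Lemma circle2_Rintegral (G : measurableTypeR R * measurableTypeR R -> R) :
  measurable_fun setT G -> (forall x, `|G x| <= 1) ->
  \int[nu2]_y G y = \int[nu]_s \int[nu]_r G (s, r).
Proof.
move=> mG G1.
have i1 : intg nu2 G.
  apply: (intg_le mG (intg_tensor (intg_cst nu 1) (intg_cst nu 1))) => x.
  by rewrite mulr1.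
by have [_ h] := @Rfubini1 _ _ _ _ _ nu nu G i1.
Qed.

Lemma circle_integral (f : R -> R) : continuous f ->
  (\int[nu]_x (f x)%:E = \int[lebesgue_measure]_(x in `[0%R, 1%R]) (f x)%:E)%E.
Proof.
move=> cf; pose I01 : set (measurableTypeR R) := `[0%R, 1%R[%classic.
have mf : measurable_fun setT f by exact: continuous_measurable_fun.
have i01 : lebesgue_measure.-integrable `[0%R, 1%R] (EFin \o f).
  apply: continuous_compact_integrable; first exact: segment_compact.
  by apply: continuous_subspaceT.
have i02 : lebesgue_measure.-integrable `[0%R, 1%R[ (EFin \o f).
  apply: integrableS i01 => //.
  by move=> x /=; rewrite !in_itv/= => /andP[-> /ltW ->].
rewrite -integral_itv_bndo_bndc; last by case/integrableP : i02.
have e1 (D : set R) (g : R -> \bar R) : D `<=` `[0%R, 1%R[ ->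
    (\int[nu]_(x in D) g x = \int[lebesgue_measure]_(x in D) g x)%E.
  move=> DI; apply: eq_measure_integral => A mA AD.
  by rewrite /= /circle_measure /mrestr setIidl// => x /AD /DI.
rewrite -e1//.
have inu : (nu : {measure set _ -> \bar R}).-integrable setT (EFin \o f).
  apply/integrableP; split; first exact/measurable_EFinP.
  have mg : measurable_fun setT (fun x => `|(EFin \o f) x|)%E.
    by apply: measurableT_comp => //; apply/measurable_EFinP.
  rewrite (@ge0_negligible_integral _ _ _ _ _ (~` I01)) //.
  - rewrite setTD setCK e1//; by case/integrableP : i02.
  - by apply: measurableC; exact: measurable_itv.
  - by rewrite /= /circle_measure /mrestr setICl measure0.
rewrite (@negligible_integral _ _ _ _ _ (~` I01)) //.
- by rewrite setTD setCK.
- by apply: measurableC; exact: measurable_itv.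
- by rewrite /= /circle_measure /mrestr setICl measure0.
Qed.

Lemma cos_int_period (n : int) (x : R) : cos (x + 2 * pi * n%:~R) = cos x.
Proof.
have h (m : nat) (y : R) : cos (y + 2 * pi * m%:R) = cos y.
  rewrite -(periodicn (@cosD2pi R) m y); congr cos.
  ring.
case: n => n; first exact: h.
rewrite NegzE -(h n.+1 (x + _)); congr cos; rewrite mulrNz pmulrn; ring.
Qed.

Lemma circle_integral_cst (c : R) : \int[nu]_s c = c.
Proof.
rewrite Rintegral_cst// [X in _ * X](_ : _ = 1) ?mulr1//.
by have := circle_measureT; move=> /(congr1 fine).
Qed.

Lemma torus_integral_cst (c : R) : \int[tmu]_x c = c.
Proof.
rewrite Rintegral_cst// [X in _ * X](_ : _ = 1) ?mulr1//.
by have := torus_measureT; move=> /(congr1 fine).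
Qed.

Lemma is_derive_affine (w b x : R) : is_derive x 1 (fun s : R => w * s + b) w.
Proof.
have -> : (fun s : R => w * s + b) = (w *: (id : R -> R)) + cst b.
  by apply/funext => s; rewrite fctE.
by apply: is_derive_eq; rewrite addr0 /GRing.scale/= mulr1.
Qed.

Lemma is_derive_cos_affine (w b x : R) :
  is_derive x 1 (fun s => cos (w * s + b)) (- w * sin (w * x + b)).
Proof.
have h := is_derive_affine w b x.
have := @is_derive1_comp _ (@cos R) _ _ _ _ (is_derive_cos _) h.
by rewrite (_ : - w * _ = - sin (w * x + b) * w)// mulrC mulNr mulrN.
Qed.

Lemma is_derive_sin_affine (w b x : R) :
  is_derive x 1 (fun s => sin (w * s + b)) (w * cos (w * x + b)).
Proof.
have h := is_derive_affine w b x.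
have := @is_derive1_comp _ (@sin R) _ _ _ _ (is_derive_sin _) h.
by rewrite (_ : w * cos _ = cos (w * x + b) * w)// mulrC.
Qed.

Lemma circle_integral_cos (n : int) (b : R) :
  \int[nu]_s (cos (2 * pi * n%:~R * s + b)) = if n == 0 then cos b else 0.
Proof.
have [->|n0] := eqVneq.
  under eq_Rintegral do rewrite mulr0 mul0r add0r.
  exact: circle_integral_cst.
set w := 2 * pi * n%:~R.
have w0 : w != 0.
  by rewrite /w !mulf_neq0// ?intr_eq0// ?gt_eqF// pi_gt0.
have dF (x : R) : is_derive x 1 (fun s => w^-1 * sin (w * s + b)) (cos (w * x + b)).
  have := is_deriveZ w^-1 (is_derive_sin_affine w b x).
  by rewrite (_ : w^-1 *: (w * cos (w * x + b)) = cos (w * x + b))// /GRing.scale/= mulKf.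
have cf : continuous (fun s => cos (w * s + b)).
  move=> x; apply: differentiable_continuous; apply/derivable1_diffP.
  by have [] := is_derive_cos_affine w b x.
have cF : continuous (fun s => w^-1 * sin (w * s + b)).
  move=> x; apply: differentiable_continuous; apply/derivable1_diffP.
  by have [] := dF x.
rewrite /Rintegral circle_integral// (continuous_FTC2 (F := fun s => w^-1 * sin (w * s + b))) //.
- rewrite -EFinB /= mulr0 add0r mulr1 -cosBpihalf -[cos (w + b - _)](_ : cos (b - pi / 2) = _).
    by rewrite cosBpihalf subrr.
  by rewrite -(cos_int_period n); congr cos; rewrite /w; ring.
- by apply: continuous_subspaceT.
- split.
  + by move=> x _; have [] := dF x.
  + by apply: cvg_at_right_filter; apply: cF.
  + by apply: cvg_at_left_filter; apply: cF.
- by move=> x _; rewrite derive1E; have [_ ->] := dF x.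
Qed.


(** Frequencies are integer triples, so that every trigonometric expression
    built from them is automatically periodic. *)
Definition freq := (int * int * int)%type.

Definition kv (k : freq) : vec R := (k.1.1%:~R, k.1.2%:~R, k.2%:~R).

Lemma dotE (x y : vec R) : dot x y = x.1.1 * y.1.1 + x.1.2 * y.1.2 + x.2 * y.2.
Proof.
by rewrite /dot !big_ord_recl big_ord0 addr0 /vcoord /= addrA.
Qed.

(** A real wave; the phase b = - (pi / 2) turns the cosine into a sine. *)
Definition chr (k : freq) (b : R) (x : vec R) : R := cos (2 * pi * dot (kv k) x + b).

Lemma measurable_coord1 : measurable_fun setT (fun x : V => x.1.1).
Proof. exact: measurableT_comp. Qed.

Lemma measurable_coord2 : measurable_fun setT (fun x : V => x.1.2).
Proof. exact: measurableT_comp. Qed.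

Lemma measurable_coord3 : measurable_fun setT (fun x : V => x.2).
Proof. exact: measurable_snd. Qed.

Lemma measurable_vcoord (i : 'I_3) : measurable_fun setT (fun x : V => vcoord x i).
Proof.
case: i => [[|[|[|//]]] hi].
- by apply: eq_measurable_fun measurable_coord1 => x _.
- by apply: eq_measurable_fun measurable_coord2 => x _.
- by apply: eq_measurable_fun measurable_coord3 => x _.
Qed.

Lemma measurable_cos d (T : measurableType d) (f : T -> R) :
  measurable_fun setT f -> measurable_fun setT (fun x => cos (f x)).
Proof.
move=> mf; apply: (measurableT_comp _ mf).
by apply: continuous_measurable_fun; exact: continuous_cos.
Qed.

Lemma measurable_chr (k : freq) (b : R) : measurable_fun setT (chr k b : V -> R).
Proof.
apply: measurable_cos; apply: measurable_funD => //.
apply: measurable_funM => //.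
rewrite (_ : dot (kv k) = fun x => (kv k).1.1 * x.1.1 + (kv k).1.2 * x.1.2 + (kv k).2 * x.2); last first.
  by apply/funext => x; exact: dotE.
apply: measurable_funD; first apply: measurable_funD.
- by apply: measurable_funM => //; exact: measurable_coord1.
- by apply: measurable_funM => //; exact: measurable_coord2.
- by apply: measurable_funM => //; exact: measurable_coord3.
Qed.

Lemma chr_le1 k b x : `|chr k b x| <= 1.
Proof. exact: cos_max. Qed.

Lemma intg_chr k b : intg tmu (chr k b).
Proof.
by apply: (intg_bounded _ (M := 1)); [exact: measurable_chr | exact: chr_le1].
Qed.

(** Integrating in one coordinate at a time, a nonzero component of the
    frequency makes the integral vanish. *)
Lemma torus_integral_chr k b :
  \int[tmu]_x chr k b x = if k == (0, 0, 0) then cos b else 0.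
Proof.
rewrite (torus_Rintegral (measurable_chr k b) (chr_le1 k b)).
have inner (y : measurableTypeR R * measurableTypeR R) : \int[nu]_s chr k b (y, s) =
    if k.2 == 0 then cos (2 * pi * (k.1.1%:~R * y.1 + k.1.2%:~R * y.2) + b) else 0.
  rewrite -(circle_integral_cos k.2 (2 * pi * (k.1.1%:~R * y.1 + k.1.2%:~R * y.2) + b)).
  by apply: eq_Rintegral => s _; rewrite /chr dotE /=; congr cos; ring.
under eq_Rintegral do rewrite inner.
case: k {inner} => [[k1 k2] k3] /=; rewrite -pair_eqE /pair_eq /= -pair_eqE /pair_eq/=.
case: (k3 =P 0) => _; last by rewrite andbF Rint_0.
rewrite andbT.
set G := (X in \int[_]_y X y).
have mG : measurable_fun setT G.
  apply: measurable_cos; apply: measurable_funD => //.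
  apply: measurable_funM => //.
  by apply: measurable_funD; apply: measurable_funM.
rewrite (circle2_Rintegral mG) => [|x]; last exact: cos_max.
have inner y : \int[nu]_s G (y, s) =
    if k2 == 0 then cos (2 * pi * k1%:~R * y + b) else 0.
  rewrite -(circle_integral_cos k2 (2 * pi * k1%:~R * y + b)).
  by apply: eq_Rintegral => s _; rewrite /G /=; congr cos; ring.
under eq_Rintegral do rewrite inner.
case: (k2 =P 0) => _; last by rewrite andbF Rint_0.
by rewrite andbT circle_integral_cos.
Qed.

End TorusMeasure.

(** * Trigonometric polynomials *)

Section Trig.
Context {R : realType}.
Local Notation V := (measurableTypeR R * measurableTypeR R * measurableTypeR R)%type.
Local Notation mu := (@tmu R).
Implicit Types (l m : seq (R * freq * R)) (x y : vec R) (k : freq).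

(** A trigonometric polynomial is kept as a list of (amplitude, frequency,
    phase): Fourier multipliers and integration by parts act on each term. *)
Definition tp l x : R := \sum_(t <- l) t.1.1 * chr t.1.2 t.2 x.

Lemma measurable_tp l : measurable_fun setT (tp l : V -> R).
Proof.
elim: l => [|t l IH].
  by rewrite (_ : tp [::] = fun=> 0)//; apply/funext => x; rewrite /tp big_nil.
rewrite (_ : tp (t :: l) = fun x => t.1.1 * chr t.1.2 t.2 x + tp l x); last first.
  by apply/funext => x; rewrite /tp big_cons.
apply: measurable_funD => //; apply: measurable_funM => //.
exact: measurable_chr.
Qed.

Definition tpbound l : R := \sum_(t <- l) `|t.1.1|.

Lemma tp_le l x : `|tp l x| <= tpbound l.
Proof.
apply: (le_trans (ler_norm_sum _ _ _)); apply: ler_sum => t _.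
by rewrite normrM ler_piMr// chr_le1.
Qed.

Lemma tpbound_ge0 l : 0 <= tpbound l.
Proof. exact: sumr_ge0. Qed.

Lemma intg_tp l : intg mu (tp l).
Proof. exact: (intg_bounded _ (measurable_tp l) (tp_le l)). Qed.

Lemma intg_tpM l (g : V -> R) : intg mu g -> intg mu (fun x => tp l x * g x).
Proof. exact: intg_bndl (measurable_tp l) (tp_le l). Qed.

Lemma tp_cat l m x : tp (l ++ m) x = tp l x + tp m x.
Proof. by rewrite /tp big_cat. Qed.

Lemma tp_cons t l x : tp (t :: l) x = t.1.1 * chr t.1.2 t.2 x + tp l x.
Proof. by rewrite /tp big_cons. Qed.

Lemma tp_nil x : tp [::] x = 0.
Proof. by rewrite /tp big_nil. Qed.

Definition scaleT (c : R) l := [seq (c * t.1.1, t.1.2, t.2) | t <- l].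

Lemma tp_scale c l x : tp (scaleT c l) x = c * tp l x.
Proof.
by rewrite /tp big_map mulr_sumr; apply: eq_bigr => t _; rewrite mulrA.
Qed.

Definition mulT l m := flatten
  [seq [seq (t.1.1 * s.1.1 / 2, t.1.2 + s.1.2, t.2 + s.2) | s <- m] ++
       [seq (t.1.1 * s.1.1 / 2, t.1.2 - s.1.2, t.2 - s.2) | s <- m] | t <- l].

Lemma dot_kvD k k' x : dot (kv (k + k')) x = dot (kv k) x + dot (kv k') x.
Proof. by rewrite !dotE /kv /= !intrD; ring. Qed.

Lemma dot_kvN k x : dot (kv (- k)) x = - dot (kv k) x.
Proof. by rewrite !dotE /kv /= !mulrNz; ring. Qed.

Lemma dot_kvB k k' x : dot (kv (k - k')) x = dot (kv k) x - dot (kv k') x.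
Proof. by rewrite dot_kvD dot_kvN. Qed.

Lemma dotDr x y z : dot x (y + z) = dot x y + dot x z.
Proof. by rewrite !dotE /=; ring. Qed.

Lemma dotNr x y : dot x (- y) = - dot x y.
Proof. by rewrite !dotE /=; ring. Qed.

Lemma cosM (a b : R) : cos a * cos b = (cos (a + b) + cos (a - b)) / 2.
Proof. by rewrite cosD cosB; field. Qed.

Lemma chrM k b k' b' x :
  chr k b x * chr k' b' x = (chr (k + k') (b + b') x + chr (k - k') (b - b') x) / 2.
Proof.
by rewrite /chr cosM dot_kvD dot_kvB; congr ((cos _ + cos _) / 2); ring.
Qed.

Lemma tp_mulT1 t m x :
  tp ([seq (t.1.1 * s.1.1 / 2, t.1.2 + s.1.2, t.2 + s.2) | s <- m] ++
      [seq (t.1.1 * s.1.1 / 2, t.1.2 - s.1.2, t.2 - s.2) | s <- m]) x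
  = t.1.1 * chr t.1.2 t.2 x * tp m x.
Proof.
rewrite tp_cat /tp !big_map -big_split /= mulr_sumr; apply: eq_bigr => s _.
by rewrite -mulrDr [RHS]mulrACA chrM; ring.
Qed.

Lemma tp_mul l m x : tp (mulT l m) x = tp l x * tp m x.
Proof.
elim: l => [|t l IH]; first by rewrite tp_nil mul0r.
by rewrite [LHS]tp_cat tp_mulT1 tp_cons mulrDl; congr (_ + _).
Qed.

Definition fcoord k (i : 'I_3) : int := [:: k.1.1; k.1.2; k.2]`_i.

Lemma vcoord_kv k i : vcoord (kv k : vec R) i = (fcoord k i)%:~R.
Proof. by case: i => [[|[|[|//]]] hi]. Qed.

Lemma fcoordD k k' i : fcoord (k + k') i = fcoord k i + fcoord k' i.
Proof. by case: i => [[|[|[|//]]] hi]. Qed.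

Lemma fcoordN k i : fcoord (- k) i = - fcoord k i.
Proof. by case: i => [[|[|[|//]]] hi]. Qed.

Definition wave k i : R := 2 * pi * (fcoord k i)%:~R.

Lemma waveD k k' i : wave (k + k') i = wave k i + wave k' i.
Proof. by rewrite /wave fcoordD intrD mulrDr. Qed.

Lemma waveN k i : wave (- k) i = - wave k i.
Proof. by rewrite /wave fcoordN mulrNz mulrN. Qed.

Lemma waveB k k' i : wave (k - k') i = wave k i - wave k' i.
Proof. by rewrite waveD waveN. Qed.

Lemma wave0 i : wave 0 i = 0.
Proof. by rewrite /wave; case: i => [[|[|[|//]]] hi]; rewrite /fcoord /= mulr0. Qed.

(** Differentiation shifts the phase by a quarter turn, -sin a = cos (a + pi/2). *)
Definition dT (i : 'I_3) l :=
  [seq (t.1.1 * wave t.1.2 i, t.1.2, t.2 + pi / 2) | t <- l].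

Lemma chr_quarter k b x : chr k (b + pi / 2) x = - sin (2 * pi * dot (kv k) x + b).
Proof. by rewrite /chr addrA cosDpihalf. Qed.

Lemma tp_dT i l x : tp (dT i l) x =
  \sum_(t <- l) t.1.1 * wave t.1.2 i * - sin (2 * pi * dot (kv t.1.2) x + t.2).
Proof. by rewrite /tp big_map; apply: eq_bigr => t _; rewrite chr_quarter. Qed.

Lemma dT_cat i l m : dT i (l ++ m) = dT i l ++ dT i m.
Proof. exact: map_cat. Qed.

Lemma dT_scale i c l : dT i (scaleT c l) = scaleT c (dT i l).
Proof. by rewrite /dT /scaleT -!map_comp; apply: eq_map => t /=; rewrite mulrA. Qed.

Lemma dTC i j l : dT i (dT j l) = dT j (dT i l).
Proof.
by rewrite /dT -!map_comp; apply: eq_map => t /=; rewrite mulrAC.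
Qed.

Lemma tp_dT_cons i t l x : tp (dT i (t :: l)) x =
  t.1.1 * wave t.1.2 i * - sin (2 * pi * dot (kv t.1.2) x + t.2) + tp (dT i l) x.
Proof. by rewrite !tp_dT big_cons. Qed.

Lemma tp_dT_mul i l m x :
  tp (dT i (mulT l m)) x = tp (dT i l) x * tp m x + tp l x * tp (dT i m) x.
Proof.
elim: l => [|t l IH]; first by rewrite !tp_nil !mul0r addr0.
rewrite [mulT _ _]/(_ ++ mulT l m) dT_cat tp_cat IH tp_dT_cons tp_cons.
have e (a b c d e f : R) : (a + b) * c + (d + e) * f = (a * c + d * f) + (b * c + e * f).
  by ring.
rewrite e; congr (_ + _); rewrite {IH e} /chr.
set A := 2 * pi * dot (kv t.1.2) x + t.2.
rewrite !tp_dT /tp big_cat /= !big_map -big_split !mulr_sumr -big_split.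
apply: eq_bigr => s _; rewrite /= waveD waveB dot_kvD dot_kvB.
set B := 2 * pi * dot (kv s.1.2) x + s.2.
have -> : 2 * pi * (dot (kv t.1.2) x + dot (kv s.1.2) x) + (t.2 + s.2) = A + B.
  by rewrite /A /B; ring.
have -> : 2 * pi * (dot (kv t.1.2) x - dot (kv s.1.2) x) + (t.2 - s.2) = A - B.
  by rewrite /A /B; ring.
by rewrite -[chr s.1.2 s.2 x]/(cos B) sinD sinB; field.
Qed.

Lemma Rint_tp l : \int[mu]_x tp l x = \sum_(t <- l | t.1.2 == 0) t.1.1 * cos t.2.
Proof.
rewrite Rint_sum; last by move=> t; apply: intgZ; exact: intg_chr.
rewrite [RHS]big_mkcond; apply: eq_bigr => t _.
rewrite RintZ; last exact: intg_chr.
by rewrite torus_integral_chr; case: ifP => // _; rewrite mulr0.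
Qed.

Lemma Rint_dT i l : \int[mu]_x tp (dT i l) x = 0.
Proof.
rewrite Rint_tp big_map big1// => t /eqP /= ->.
by rewrite wave0 mulr0 mul0r.
Qed.

Lemma intg_tp2 l m : intg mu (fun x => tp l x * tp m x).
Proof. exact/intg_tpM/intg_tp. Qed.

(** The derivative of the product has zero mean. *)
Lemma tp_by_parts i l m :
  \int[mu]_x (tp (dT i l) x * tp m x) = - \int[mu]_x (tp l x * tp (dT i m) x).
Proof.
apply/eqP; rewrite -addr_eq0 -RintD; try exact: intg_tp2.
rewrite -(Rint_dT i (mulT l m)); apply/eqP.
by apply: eq_Rintegral => x _; rewrite tp_dT_mul.
Qed.

(** ** Fourier multipliers *)

Definition multT (s : freq -> R) l := [seq (s t.1.2 * t.1.1, t.1.2, t.2) | t <- l].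

Lemma multT_cat s l m : multT s (l ++ m) = multT s l ++ multT s m.
Proof. exact: map_cat. Qed.

Lemma multT_dT s i l : multT s (dT i l) = dT i (multT s l).
Proof. by rewrite /multT /dT -!map_comp; apply: eq_map => t /=; rewrite mulrA. Qed.

Lemma multT_comp s s' l : multT s (multT s' l) = multT (fun k => s k * s' k) l.
Proof. by rewrite /multT -!map_comp; apply: eq_map => t /=; rewrite mulrA. Qed.

Lemma multT_scale s c l : multT s (scaleT c l) = scaleT c (multT s l).
Proof. by rewrite /multT /scaleT -!map_comp; apply: eq_map => t /=; rewrite mulrCA. Qed.

Lemma pairing_sum l m :
  \int[mu]_x (tp l x * tp m x) =
  \sum_(t <- l) \sum_(s <- m) t.1.1 * s.1.1 / 2 *
    ((if t.1.2 + s.1.2 == 0 then cos (t.2 + s.2) else 0) +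
     (if t.1.2 - s.1.2 == 0 then cos (t.2 - s.2) else 0)).
Proof.
rewrite (Rint_ext _ (g := fun x : V => \sum_(t <- l) t.1.1 * chr t.1.2 t.2 x * tp m x)); last first.
  by move=> x; rewrite mulr_suml.
rewrite Rint_sum => [|t]; last first.
  apply: (@intg_eq _ _ _ mu (fun x : V => t.1.1 * (tp m x * chr t.1.2 t.2 x)) _ _) => [x|].
    by ring.
  by apply: intgZ; apply: intg_tpM; exact: intg_chr.
apply: eq_bigr => t _.
rewrite (Rint_ext _ (g := fun x : V => \sum_(s <- m) t.1.1 * s.1.1 / 2 *
    (chr (t.1.2 + s.1.2) (t.2 + s.2) x + chr (t.1.2 - s.1.2) (t.2 - s.2) x))); last first.
  move=> x; rewrite mulr_sumr; apply: eq_bigr => s _.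
  by rewrite mulrACA chrM; ring.
rewrite Rint_sum => [|s]; last by apply: intgZ; apply: intgD; exact: intg_chr.
apply: eq_bigr => s _; rewrite RintZ; last by apply: intgD; exact: intg_chr.
by rewrite RintD ?torus_integral_chr//; exact: intg_chr.
Qed.

(** In [pairing_sum] two waves interact only if their frequencies agree up
    to sign, and there the two multipliers have the same value. *)
Lemma pairing_multT (s : freq -> R) l m : (forall k, s (- k) = s k) ->
  \int[mu]_x (tp (multT s l) x * tp m x) = \int[mu]_x (tp l x * tp (multT s m) x).
Proof.
move=> se; rewrite !pairing_sum big_map; apply: eq_bigr => t _.
rewrite big_map; apply: eq_bigr => r _ /=.
case: (eqVneq (t.1.2 + r.1.2) 0) => [e|_].
  have -> : t.1.2 = - r.1.2 by apply/eqP; rewrite -addr_eq0 e.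
  by rewrite se; ring.
case: (eqVneq (t.1.2 - r.1.2) 0) => [/eqP|_].
  by rewrite subr_eq0 => /eqP ->; ring.
by rewrite !addr0 !mulr0.
Qed.

(** ** Convolution with a trigonometric kernel *)

(** The addition formula splits each wave of the kernel at x - y into two
    products, so a convolution is again a list, whose amplitudes are Fourier
    coefficients of g. *)
Definition convT l (g : V -> R) := flatten
  [seq [:: (t.1.1 * \int[mu]_y (chr t.1.2 0 y * g y), t.1.2, t.2);
           (t.1.1 * \int[mu]_y (chr t.1.2 (- (pi / 2)) y * g y), t.1.2, t.2 - pi / 2)] | t <- l].

(** The kernel seen from x, as a function of y. *)
Definition reflT x l := [seq (t.1.1, - t.1.2, t.2 + 2 * pi * dot (kv t.1.2) x) | t <- l].

Lemma tp_refl x l y : tp (reflT x l) y = tp l (x - y).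
Proof.
rewrite /tp big_map; apply: eq_bigr => t _ /=; congr (_ * cos _).
by rewrite dot_kvN dotDr dotNr; ring.
Qed.

Lemma dT_refl i x l : dT i (reflT x l) = scaleT (-1) (reflT x (dT i l)).
Proof.
rewrite /dT /scaleT /reflT -!map_comp; apply: eq_map => t /=.
by rewrite waveN; congr (_, _, _); ring.
Qed.

Lemma chr_sub k b x y : chr k b (x - y) =
  chr k b x * chr k 0 y + chr k (b - pi / 2) x * chr k (- (pi / 2)) y.
Proof.
rewrite /chr addr0 addrA !cosBpihalf dotDr dotNr.
rewrite -cosB; congr cos; ring.
Qed.

Lemma tp_conv l g x : intg mu g ->
  tp (convT l g) x = \int[mu]_y (tp l (x - y) * g y).
Proof.
move=> hg.
have hc k b : intg mu (fun y => chr k b y * g y).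
  by apply: (intg_bndl (M := 1)) => //; [exact: measurable_chr|exact: chr_le1].
transitivity (\int[mu]_y (\sum_(t <- l) (t.1.1 * chr t.1.2 t.2 x * (chr t.1.2 0 y * g y) +
   t.1.1 * chr t.1.2 (t.2 - pi / 2) x * (chr t.1.2 (- (pi / 2)) y * g y)))); last first.
  apply: eq_Rintegral => y _; rewrite mulr_suml; apply: eq_bigr => t _.
  by rewrite chr_sub; ring.
rewrite Rint_sum => [|t]; last by apply: intgD; apply: intgZ.
rewrite /convT /tp big_flatten /= big_map; apply: eq_bigr => t _.
rewrite !big_cons big_nil /= addr0 RintD; try exact: intgZ.
by rewrite !RintZ//; ring.
Qed.

(** Immediate for lists: amplitudes and phases are computed independently. *)
Lemma dT_conv i l g : dT i (convT l g) = convT (dT i l) g.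
Proof.
rewrite /convT /dT -map_comp map_flatten -map_comp; congr flatten.
apply: eq_map => t /=.
congr [:: (_, _, _); (_, _, _)]; ring.
Qed.

Lemma Rint_refl l x : \int[mu]_y tp l (x - y) = \int[mu]_y tp l y.
Proof.
rewrite -(Rint_ext _ (f := fun y : V => tp (reflT x l) y)); last by move=> y; rewrite tp_refl.
rewrite !Rint_tp /reflT big_map /= big_mkcond [RHS]big_mkcond; apply: eq_bigr => t _ /=.
rewrite oppr_eq0; case: eqP => // ->.
by rewrite (_ : dot (kv 0) x = 0) ?mulr0 ?addr0// dotE /kv /= !mulr0z; ring.
Qed.

End Trig.

(** * Derivatives of trigonometric polynomials *)

Section TrigDerive.
Context {R : realType}.
Implicit Types (l m : seq (R * freq * R)) (k : freq).

(** A directional derivative is a derivative along a line, where the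
    calculus of one real variable applies. *)
Lemma is_derive_line (W : normedModType R) (f : W -> R) (a v : W) (d : R) :
  is_derive (0 : R) 1 (fun s : R => f (s *: v + a)) d -> is_derive a v f d.
Proof.
move=> [h1 h2].
have e : (fun h : R => h^-1 *: (((fun s : R => f (s *: v + a)) \o shift 0) (h *: 1) -
      f (0 *: v + a))) = (fun h => h^-1 *: ((f \o shift a) (h *: v) - f a)).
  by apply/funext => h; rewrite /= addr0 scale0r add0r /GRing.scale /= mulr1.
by split; rewrite /derivable /derive -e.
Qed.

Lemma dot_line (x v y : vec R) (s : R) : dot x (s *: v + y) = s * dot x v + dot x y.
Proof. by rewrite !dotE /= /GRing.scale /=; ring. Qed.

Lemma is_derive_chr k b (x v : vec R) :
  is_derive x v (chr k b) (2 * pi * dot (kv k) v * - sin (2 * pi * dot (kv k) x + b)).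
Proof.
apply: is_derive_line.
set w := 2 * pi * dot (kv k) v; set c := 2 * pi * dot (kv k) x + b.
rewrite (_ : (fun s : R => _) = fun s => cos (w * s + c)); last first.
  by apply/funext => s; rewrite /chr dot_line; congr cos; rewrite /w /c; ring.
have := is_derive_cos_affine w c 0.
by rewrite mulr0 add0r mulNr mulrN.
Qed.

Lemma is_derive_tp l (x v : vec R) :
  is_derive x v (tp l) (\sum_(t <- l) t.1.1 * (2 * pi * dot (kv t.1.2) v *
    - sin (2 * pi * dot (kv t.1.2) x + t.2))).
Proof.
elim: l => [|t l IH].
  rewrite big_nil (_ : tp [::] = cst 0); first exact: is_derive_cst.
  by apply/funext => y; rewrite tp_nil.
rewrite big_cons (_ : tp (t :: l) = t.1.1 \*: chr t.1.2 t.2 + tp l); last first.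
  by apply/funext => y; rewrite tp_cons.
apply: is_deriveD; apply: is_deriveZ.
exact: is_derive_chr.
Qed.

Lemma dot_unit_vec (x : vec R) i : dot x (unit_vec i) = vcoord x i.
Proof.
rewrite dotE /unit_vec /vcoord /= -!(inj_eq val_inj).
by case: i => [[|[|[|//]]] hi] /=; rewrite ?mulr1 ?mulr0 ?addr0 ?add0r.
Qed.

Lemma is_derive_dT i l (x : vec R) : is_derive x (unit_vec i) (tp l) (tp (dT i l) x).
Proof.
rewrite (_ : tp (dT i l) x = \sum_(t <- l) t.1.1 * (2 * pi * dot (kv t.1.2) (unit_vec i) *
    - sin (2 * pi * dot (kv t.1.2) x + t.2))); first exact: is_derive_tp.
rewrite tp_dT; apply: eq_bigr => t _.
by rewrite dot_unit_vec vcoord_kv /wave !mulrA.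
Qed.

(** Differentiating a list only depends on the function that it represents. *)
Lemma dT_ext i l m : tp l =1 tp m -> tp (dT i l) =1 tp (dT i m).
Proof.
move=> /funext e x; have [_ <-] := is_derive_dT i l x.
by rewrite e; have [_ <-] := is_derive_dT i m x.
Qed.

Lemma tp_periodic l : torus_periodic (tp l).
Proof.
move=> x k lk; rewrite /tp; apply: eq_bigr => t _; congr (_ * _).
have [n1 h1] := lk ord0; have [n2 h2] := lk (lift ord0 ord0).
have [n3 h3] := lk (lift ord0 (lift ord0 ord0)).
rewrite /chr dotDr.
have -> : dot (kv t.1.2) k = (t.1.2.1.1 * n1 + t.1.2.1.2 * n2 + t.1.2.2 * n3)%:~R.
  by rewrite dotE !intrD !intrM -h1 -h2 -h3.
rewrite -(cos_int_period (t.1.2.1.1 * n1 + t.1.2.1.2 * n2 + t.1.2.2 * n3) (2 * pi * dot (kv t.1.2) x + t.2)).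
by congr cos; ring.
Qed.

End TrigDerive.

(** * A positive kernel: powers of the cosine *)

Section Kernel.
Context {R : realType}.
Local Notation V := (measurableTypeR R * measurableTypeR R * measurableTypeR R)%type.
Local Notation mu := (@tmu R).
Implicit Types (l m : seq (R * freq * R)) (x y : vec R) (k : freq) (i j : 'I_3).

Definition efreq i : freq :=
  ((i == 0 :> nat)%:Z, (i == 1 :> nat)%:Z, (i == 2 :> nat)%:Z).

Definition qT i : seq (R * freq * R) := [:: (1 / 2, 0, 0); (1 / 2, efreq i, 0)].
Definition sT i : seq (R * freq * R) := [:: (1, efreq i, - (pi / 2))].

(** The squared cosine of half the angle: equal to 1 at the integers and
    smaller elsewhere, so its powers concentrate at the lattice. *)
Definition q i x : R := cos (pi * vcoord x i) ^+ 2.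

Lemma dot_efreq i x : dot (kv (efreq i)) x = vcoord x i.
Proof.
rewrite dotE /kv /efreq /vcoord.
case: i => [[|[|[|//]]] hi] /=; by rewrite ?mul1r ?mul0r ?addr0 ?add0r.
Qed.

Lemma fcoord0 i : fcoord 0 i = 0.
Proof. by case: i => [[|[|[|//]]] hi]. Qed.

Lemma fcoord_efreq i j : fcoord (efreq i) j = if i == j then 1 else 0.
Proof. by case: i => [[|[|[|//]]] hi]; case: j => [[|[|[|//]]] hj]. Qed.

Lemma cos_double (a : R) : cos (2 * a) = 2 * cos a ^+ 2 - 1.
Proof. by rewrite mulr_natl cos_mulr2n mulr_natl. Qed.

Lemma dot_kv0 x : dot (kv 0) x = 0.
Proof. by rewrite dotE /kv /= !mul0r !addr0. Qed.

Lemma tp_qT i x : tp (qT i) x = q i x.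
Proof.
rewrite /tp !big_cons big_nil /= /chr dot_efreq dot_kv0 mulr0 !addr0 cos0.
by rewrite -mulrA cos_double /q; field.
Qed.

Lemma q_ge0 i x : 0 <= q i x. Proof. exact: sqr_ge0. Qed.

Lemma q_le1 i x : q i x <= 1.
Proof. by rewrite /q -(cos2Dsin2 (pi * vcoord x i)) lerDl sqr_ge0. Qed.

Lemma tp_sT i x : tp (sT i) x = sin (2 * pi * vcoord x i).
Proof. by rewrite tp_cons tp_nil addr0 /= /chr dot_efreq mul1r cosBpihalf. Qed.

Lemma tp_sT2 i x : tp (sT i) x ^+ 2 = 4 * q i x * (1 - q i x).
Proof.
rewrite tp_sT sin2cos2 -mulrA cos_double /q; ring.
Qed.

Lemma tp_dT_qT i x : tp (dT i (qT i)) x = - pi * tp (sT i) x.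
Proof.
rewrite tp_sT tp_dT !big_cons big_nil /= wave0 /wave fcoord_efreq eqxx dot_efreq !addr0.
by field.
Qed.

Lemma tp_dT_sT i x : tp (dT i (sT i)) x = 2 * pi * (2 * q i x - 1).
Proof.
rewrite tp_dT !big_cons big_nil /= /wave fcoord_efreq eqxx dot_efreq sinBpihalf addr0 mulr1z.
rewrite -(mulrA 2 pi (vcoord x i)) cos_double /q; ring.
Qed.

Definition oneT : seq (R * freq * R) := [:: (1, 0, 0)].

Lemma tp_oneT x : tp oneT x = 1.
Proof.
by rewrite tp_cons tp_nil addr0 /= /chr dotE /kv /= !mulr0z !mul0r !addr0 mulr0 cos0 mulr1.
Qed.

Definition powT l n := iter n (mulT l) oneT.

Lemma tp_pow l n x : tp (powT l n) x = tp l x ^+ n.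
Proof. by elim: n => [|n IH]; rewrite ?tp_oneT//= tp_mul IH exprS. Qed.

Lemma tp_dT_pow i l n x :
  tp (dT i (powT l n)) x = n%:R * tp l x ^+ n.-1 * tp (dT i l) x.
Proof.
elim: n => [|n IH].
  by rewrite tp_dT big_cons big_nil /= wave0 !mul0r mulr0 mul0r addr0.
rewrite [powT _ _]/(mulT l (powT l n)) tp_dT_mul IH tp_pow /=.
case: n {IH} => [|n]; first by rewrite expr0; ring.
by rewrite [_.-1]/= exprS -[n.+2%:R]natr1; ring.
Qed.

(** No frequency has a component along i, hence the function does not depend
    on this coordinate. *)
Definition freeT i l := all (fun t : R * freq * R => fcoord t.1.2 i == 0) l.

Lemma free_mul i l m : freeT i l -> freeT i m -> freeT i (mulT l m).
Proof.
move=> /allP hl /allP hm; apply/allP => t /flatten_mapP [a al].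
rewrite mem_cat => /orP[] /mapP [c cm ->] /=.
  by rewrite fcoordD (eqP (hl _ al)) (eqP (hm _ cm)).
by rewrite fcoordD fcoordN (eqP (hl _ al)) (eqP (hm _ cm)).
Qed.

Lemma free_pow i l n : freeT i l -> freeT i (powT l n).
Proof. move=> hl; elim: n => [|n IH]; last exact: free_mul.
by rewrite /freeT /= fcoord0. Qed.

Lemma free_dT i j l : freeT i l -> freeT i (dT j l).
Proof. by rewrite /freeT all_map. Qed.

Lemma free_q i j : i != j -> freeT i (qT j).
Proof.
by move=> ij; rewrite /freeT /= fcoord0 fcoord_efreq (eq_sym j) (negbTE ij).
Qed.

Lemma tp_dT_free i l x : freeT i l -> tp (dT i l) x = 0.
Proof.
move=> /allP h; rewrite tp_dT big_seq big1// => t /h /eqP e.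
by rewrite /wave e mulr0 mulr0 mul0r.
Qed.

(** The Wallis recurrence, from the vanishing integral of the derivative of
    sin (2 pi s) cos (pi s) ^ (2 n). *)
Lemma wallis_step i n l : freeT i l ->
  \int[mu]_x (q i x ^+ n.+1 * tp l x) =
  (2 * n + 1)%:R / (2 * n + 2)%:R * \int[mu]_x (q i x ^+ n * tp l x).
Proof.
move=> fl.
have hq (p : nat) : intg mu (fun x : V => q i x ^+ p * tp l x).
  apply: (intg_eq _ (intg_tp2 (powT (qT i) p) l)) => x.
  by rewrite tp_pow tp_qT.
have := Rint_dT i (mulT (sT i) (mulT (powT (qT i) n) l)).
rewrite (Rint_ext _ (g := fun x : V => 2 * pi * (2 * n + 2)%:R * (q i x ^+ n.+1 * tp l x) -
   2 * pi * (2 * n + 1)%:R * (q i x ^+ n * tp l x))); last first.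
  move=> x; rewrite tp_dT_mul tp_dT_mul tp_mul (tp_dT_free x fl) tp_dT_pow tp_pow tp_qT.
  rewrite tp_dT_sT tp_dT_qT.
  have e := tp_sT2 i x; case: n => [|n].
    by rewrite !expr0 expr1 muln0 !add0n; ring.
  have -> : (n.+1).-1 = n by [].
  rewrite mulr0 addr0.
  have -> : tp (sT i) x * (n.+1%:R * q i x ^+ n * (- pi * tp (sT i) x) * tp l x) =
    - pi * n.+1%:R * q i x ^+ n * tp l x * (tp (sT i) x ^+ 2) by ring.
  by rewrite e !exprS !natrD !natrM; ring.
rewrite RintB; [|exact: intgZ..].
rewrite !RintZ//; move/eqP; rewrite subr_eq0 => /eqP e.
have p0 : 2 * pi * (2 * n + 2)%:R != 0 :> R.
  by rewrite !mulf_neq0// ?gt_eqF// ?pi_gt0// ltr0n; lia.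
apply: (mulfI p0); rewrite e.
have d0 : (2 * n + 2)%:R != 0 :> R by rewrite gt_eqF// ltr0n; lia.
by field.
Qed.

(** The mean of the n-th power of [q], that is 'C(2n, n) / 4 ^ n. *)
Fixpoint wallis n : R :=
  if n is n'.+1 then (2 * n' + 1)%:R / (2 * n' + 2)%:R * wallis n' else 1.

Lemma wallis_gt0 n : 0 < wallis n.
Proof.
elim: n => [|n IH] //=; rewrite mulr_gt0// divr_gt0// ltr0n; lia.
Qed.

Lemma Rint_wallis i n l : freeT i l ->
  \int[mu]_x (q i x ^+ n * tp l x) = wallis n * \int[mu]_x tp l x.
Proof.
move=> fl; elim: n => [|n IH].
  by rewrite mul1r; apply: Rint_ext => x; rewrite expr0 mul1r.
by rewrite wallis_step// IH mulrA.
Qed.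

(** The square of the central binomial ratio telescopes against 2 n + 1;
    together with [wallis_ge] this gives its order, the inverse square root
    of n. *)
Lemma wallis_le n : wallis n ^+ 2 * (2 * n + 1)%:R <= 1.
Proof.
elim: n => [|n IH]; first by rewrite expr1n mul1r.
rewrite /= exprMn; apply: le_trans IH.
rewrite mulrAC [leRHS]mulrC ler_pM2r ?exprn_gt0 ?wallis_gt0//.
rewrite expr_div_n mulrAC ler_pdivrMr; last by rewrite exprn_gt0// ltr0n; lia.
by rewrite -!natrX -!natrM ler_nat; lia.
Qed.

Lemma wallis_ge n : 1 <= wallis n.+1 ^+ 2 * (4 * n.+1)%:R.
Proof.
elim: n => [|n IH].
  have -> : wallis 1 = 1 / 2 by rewrite /wallis mulr1.
  by rewrite muln1; lra.
apply: (le_trans IH); rewrite [in leRHS]/= -/(wallis n.+1) [in leRHS]exprMn.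
rewrite [leRHS](_ : _ = wallis n.+1 ^+ 2 * (((2 * n.+1 + 1)%:R / (2 * n.+1 + 2)%:R) ^+ 2 * (4 * n.+2)%:R)).
  rewrite ler_pM2l ?exprn_gt0 ?wallis_gt0// expr_div_n mulrAC.
  rewrite ler_pdivlMr; last by rewrite exprn_gt0// ltr0n; lia.
  by rewrite -!natrX -!natrM ler_nat; nia.
by rewrite [in LHS]mulrC; ring.
Qed.

Definition o0 : 'I_3 := @Ordinal 3 0 isT.
Definition o1 : 'I_3 := @Ordinal 3 1 isT.
Definition o2 : 'I_3 := @Ordinal 3 2 isT.

(** Partial derivatives, of order e i in the coordinate i, of the product of
    the n-th powers of the cosine factors. *)
Definition GT n i a := iter a (dT i) (powT (qT i) n).
Definition PT n (e : 'I_3 -> nat) :=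
  mulT (GT n o0 (e o0)) (mulT (GT n o1 (e o1)) (GT n o2 (e o2))).

Lemma tp_PT n e x : tp (PT n e) x =
  tp (GT n o0 (e o0)) x * (tp (GT n o1 (e o1)) x * tp (GT n o2 (e o2)) x).
Proof. by rewrite !tp_mul. Qed.

Lemma free_GT n i j a : i != j -> freeT i (GT n j a).
Proof.
move=> ij; elim: a => [|a IH]; last exact: free_dT.
exact/free_pow/free_q.
Qed.

Lemma tp_dT_PT n e i x :
  tp (dT i (PT n e)) x = tp (PT n (fun j => e j + (i == j))%N) x.
Proof.
rewrite /PT !tp_dT_mul !tp_mul.
case: i => [[|[|[|//]]] hi]; rewrite /= ?addn0 ?addn1.
- rewrite (tp_dT_free x (free_GT n (e o1) (j := o1) _)) ?(tp_dT_free x (free_GT n (e o2) (j := o2) _))//.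
  rewrite !(mul0r, mulr0, addr0) [GT n o0 _.+1]/(dT o0 (GT n o0 (e o0))).
  by rewrite (_ : Ordinal hi = o0)//; exact: val_inj.
- rewrite (tp_dT_free x (free_GT n (e o0) (j := o0) _)) ?(tp_dT_free x (free_GT n (e o2) (j := o2) _))//.
  rewrite !(mul0r, mulr0, addr0, add0r) [GT n o1 _.+1]/(dT o1 (GT n o1 (e o1))).
  by rewrite (_ : Ordinal hi = o1)//; exact: val_inj.
- rewrite (tp_dT_free x (free_GT n (e o0) (j := o0) _)) ?(tp_dT_free x (free_GT n (e o1) (j := o1) _))//.
  rewrite !(mul0r, mulr0, addr0, add0r) [GT n o2 _.+1]/(dT o2 (GT n o2 (e o2))).
  by rewrite (_ : Ordinal hi = o2)//; exact: val_inj.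
Qed.

Lemma tp_GT0 n i x : tp (GT n i 0) x = q i x ^+ n.
Proof. by rewrite tp_pow tp_qT. Qed.

Lemma tp_GT1 n i x : tp (GT n i 1) x = - (pi * n%:R) * q i x ^+ n.-1 * tp (sT i) x.
Proof. by rewrite [GT _ _ _]/(dT i (powT (qT i) n)) tp_dT_pow tp_qT tp_dT_qT; ring. Qed.

Lemma tp_GT2 n i x : tp (GT n i 2) x =
  pi ^+ 2 * n%:R * (n.-1%:R * q i x ^+ n.-2 * (4 * q i x * (1 - q i x)) -
    2 * q i x ^+ n.-1 * (2 * q i x - 1)).
Proof.
rewrite [GT _ _ _]/(dT i (GT n i 1)).
rewrite (dT_ext _ (m := scaleT (- (pi * n%:R)) (mulT (powT (qT i) n.-1) (sT i)))); last first.
  by move=> y; rewrite tp_GT1 tp_scale tp_mul tp_pow tp_qT mulrA.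
rewrite dT_scale tp_scale tp_dT_mul tp_dT_pow tp_pow tp_qT tp_dT_qT tp_dT_sT -tp_sT2.
by ring.
Qed.

Lemma pow_mul_le1 (p : R) n : 0 <= p <= 1 -> n.+1%:R * p ^+ n * (1 - p) <= 1.
Proof.
move=> /andP[p0 p1].
suff : n.+1%:R * p ^+ n * (1 - p) <= 1 - p ^+ n.+1.
  by move=> /le_trans; apply; rewrite gerBl exprn_ge0.
elim: n => [|n IH]; first by rewrite expr0 expr1; lra.
have pn : 0 <= p ^+ n by rewrite exprn_ge0.
have pn1 : p ^+ n <= 1 by rewrite exprn_ile1.
have n0 : 0 <= n.+1%:R :> R by [].
rewrite -natr1 !exprS; rewrite !exprS in IH.
have := ler_wpM2l p0 IH.
set a : R := n.+1%:R in IH n0 *; set b := p ^+ n in pn pn1 IH *.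
have h2 : p * b * (1 - p) <= 1 - p.
  by rewrite ler_piMl ?subr_ge0// mulr_ile1.
by move=> h; lra.
Qed.

Lemma pi_lt4 : pi < 4 :> R.
Proof. have := @pihalf_lt2 R; lra. Qed.

(** Differentiating the 2 N^2-th power costs a factor N, and half of the power
    is kept to absorb the resulting factors. *)
Lemma GT_le N i a x : (0 < N)%N -> (a <= 2)%N ->
  `|tp (GT (2 * N ^ 2) i a) x| <= 320 * N%:R ^+ a * q i x ^+ (N ^ 2).
Proof.
move=> N0; set m := (N ^ 2)%N.
have m0 : (0 < m)%N by rewrite expn_gt0 N0.
have q0 := q_ge0 i x; have q1 := q_le1 i x; have s2 := tp_sT2 i x.
have pp : 0 < (pi : R) by exact: pi_gt0.
have p4 := pi_lt4.
have qm0 : 0 <= q i x ^+ m by rewrite exprn_ge0.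
have qm1 : q i x ^+ m <= 1 by rewrite exprn_ile1.
have N2 : m%:R = N%:R ^+ 2 :> R by rewrite natrX.
case: a => [|[|[|//]]] _.
- rewrite tp_GT0 expr0 mulr1 mul2n -addnn exprD ger0_norm ?mulr_ge0//.
  by apply: ler_wpM2r => //; apply: le_trans qm1 _; lra.
- rewrite tp_GT1 expr1.
  have e : (2 * m).-1 = (m + m.-1)%N by lia.
  have h := @pow_mul_le1 (q i x) m.-1 _; rewrite prednK// in h.
  have {}h := h (introT andP (conj q0 q1)).
  have r1 : q i x ^+ m.-1 <= 1 by rewrite exprn_ile1.
  have r0 : 0 <= q i x ^+ m.-1 by rewrite exprn_ge0.
  rewrite e exprD natrM.
  move: (q i x) (tp (sT i) x) q0 q1 s2 qm0 qm1 h r1 r0 => u z q0 q1 s2 qm0 qm1 h r1 r0.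
  set A := u ^+ m in qm0 qm1 *; set B := u ^+ m.-1 in h r1 r0 *.
  have M0 : 0 <= m%:R :> R by [].
  move: (m%:R) N2 h M0 => M N2 h M0.
  have RHS0 : 0 <= 320 * N%:R * A.
    exact: mulr_ge0 (mulr_ge0 (ler0n _ _) (ler0n _ _)) qm0.
  rewrite -(@ler_pXn2r _ 2)// ?nnegrE// real_normK ?num_real//.
  have -> : (- (pi * (2 * M)) * (A * B) * z) ^+ 2 =
    pi ^+ 2 * 4 * M ^+ 2 * A ^+ 2 * B ^+ 2 * z ^+ 2 by ring.
  have -> : (320 * N%:R * A) ^+ 2 = 320 ^+ 2 * N%:R ^+ 2 * A ^+ 2 :> R by ring.
  rewrite s2 -N2.
  have p2 : pi ^+ 2 <= 16 :> R by nra.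
  have -> : pi ^+ 2 * 4 * M ^+ 2 * A ^+ 2 * B ^+ 2 * (4 * u * (1 - u)) =
    (16 * pi ^+ 2 * B * u) * (M * A ^+ 2) * (M * B * (1 - u)) by ring.
  have MA : 0 <= M * A ^+ 2 by rewrite mulr_ge0// sqr_ge0.
  have t1 : 16 * pi ^+ 2 * B * u <= 320 ^+ 2.
    have bu : B * u <= 1 by rewrite mulr_ile1.
    have bu0 : 0 <= B * u by rewrite mulr_ge0.
    have : pi ^+ 2 * (B * u) <= 16 * 1 by apply: ler_pM => //; exact: sqr_ge0.
    lra.
  have t0 : 0 <= 16 * pi ^+ 2 * B * u.
    by do 3 (apply: mulr_ge0 => //); exact: sqr_ge0.
  have z0 : 0 <= M * B * (1 - u) by rewrite !mulr_ge0// subr_ge0.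
  apply: le_trans (_ : 320 ^+ 2 * (M * A ^+ 2) * 1 <= _); last by rewrite mulr1 mulrA.
  apply: ler_pM => //; first exact: mulr_ge0.
  exact: ler_wpM2r.
- rewrite tp_GT2 -N2.
  have e1 : (2 * m).-1 = (m + m.-1)%N by lia.
  have e2 : q i x ^+ (2 * m).-2 * q i x = q i x ^+ m * q i x ^+ m.-1.
    by rewrite -exprSr -exprD; congr (_ ^+ _); lia.
  have h := @pow_mul_le1 (q i x) m.-1 _; rewrite prednK// in h.
  have {}h := h (introT andP (conj q0 q1)).
  have r1 : q i x ^+ m.-1 <= 1 by rewrite exprn_ile1.
  have r0 : 0 <= q i x ^+ m.-1 by rewrite exprn_ge0.
  have -> : (2 * m).-1%:R * q i x ^+ (2 * m).-2 * (4 * q i x * (1 - q i x)) =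
     (2 * m).-1%:R * 4 * (q i x ^+ (2 * m).-2 * q i x) * (1 - q i x) by ring.
  rewrite e2 (_ : q i x ^+ (2 * m).-1 = q i x ^+ m * q i x ^+ m.-1) ?e1 ?exprD//.
  have k1 : (m + m.-1)%:R <= 2 * m%:R :> R by rewrite -natrM ler_nat; lia.
  have k0 : 0 <= (m + m.-1)%:R :> R by [].
  rewrite natrM.
  move: (q i x) {s2 e2} q0 q1 qm0 qm1 h r1 r0 => u q0 q1 qm0 qm1 h r1 r0.
  set A := u ^+ m in qm0 qm1 *; set B := u ^+ m.-1 in h r1 r0 *.
  set M : R := m%:R in h k1 *; set k : R := (m + m.-1)%:R in k1 k0 *.
  have M0 : 0 <= M by [].
  have p2 : pi ^+ 2 <= 16 :> R by nra.
  have p0 : 0 <= pi ^+ 2 :> R by exact: sqr_ge0.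
  have b1 : 0 <= k * (B * (1 - u)) <= 2.
    have z0 : 0 <= B * (1 - u) by rewrite mulr_ge0// subr_ge0.
    apply/andP; split; first exact: mulr_ge0.
    apply: (le_trans (ler_wpM2r z0 k1)).
    by rewrite -mulrA ler_piMr// mulrA.
  have b2 : `|2 * B * (2 * u - 1)| <= 2.
    rewrite normrM ger0_norm ?mulr_ge0//.
    have : `|2 * u - 1| <= 1 by rewrite ler_norml; apply/andP; split; lra.
    move=> b3; have : B * `|2 * u - 1| <= 1 by rewrite mulr_ile1.
    by lra.
  have -> : pi ^+ 2 * (2 * M) * (k * 4 * (A * B) * (1 - u) - 2 * (A * B) * (2 * u - 1)) =
    2 * pi ^+ 2 * (4 * (k * (B * (1 - u))) - 2 * B * (2 * u - 1)) * (M * A) by ring.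
  have MA : 0 <= M * A by rewrite mulr_ge0.
  rewrite normrM (ger0_norm MA) -[leRHS]mulrA; apply: ler_wpM2r => //.
  rewrite normrM ger0_norm; last by apply: mulr_ge0.
  have hh : `|4 * (k * (B * (1 - u))) - 2 * B * (2 * u - 1)| <= 10.
    move: b1 => /andP[b1 b1']; move: b2; rewrite !ler_norml => /andP[c1 c2].
    by apply/andP; split; lra.
  apply: le_trans (_ : 32 * 10 <= _); last by lra.
  by apply: ler_pM => //; [exact: mulr_ge0 | lra].
Qed.

(** The normalized product of the powers of [q] in the three coordinates: a
    positive trigonometric kernel of mean one. At the power N ^ 2 its width
    is 1 / N. *)
Definition KT n := scaleT ((wallis n) ^- 3) (PT n (fun=> 0%N)).
Definition K n x := tp (KT n) x.

Lemma KE n x : K n x = (wallis n) ^- 3 * (q o0 x ^+ n * (q o1 x ^+ n * q o2 x ^+ n)).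
Proof. by rewrite /K tp_scale tp_PT !tp_GT0. Qed.

Lemma K_ge0 n x : 0 <= K n x.
Proof.
rewrite KE mulr_ge0// ?invr_ge0 ?exprn_ge0 ?(ltW (wallis_gt0 n))//.
by rewrite !mulr_ge0// exprn_ge0// q_ge0.
Qed.

Lemma q_even i x : q i (- x) = q i x.
Proof.
rewrite /q; have -> : vcoord (- x) i = - vcoord x i.
  by case: i => [[|[|[|//]]] hi].
by rewrite mulrN cosN.
Qed.

Lemma K_even n x y : K n (x - y) = K n (y - x).
Proof. by rewrite -(opprB y x) !KE !q_even. Qed.

Lemma Rint_K n : \int[mu]_x K n x = 1.
Proof.
have h : \int[mu]_x tp (KT n) x = (wallis n) ^- 3 * \int[mu]_x tp (PT n (fun=> 0%N)) x.
  rewrite -RintZ; last exact: intg_tp.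
  by apply: Rint_ext => x; rewrite -tp_scale.
rewrite /K h.
rewrite (Rint_ext _ (g := fun x : V => q o0 x ^+ n *
    tp (mulT (powT (qT o1) n) (powT (qT o2) n)) x)); last first.
  by move=> x; rewrite tp_PT tp_mul !tp_GT0.
rewrite Rint_wallis; last by apply: free_mul; apply/free_pow/free_q.
rewrite (Rint_ext _ (g := fun x : V => q o1 x ^+ n * tp (powT (qT o2) n) x)); last first.
  by move=> x; rewrite tp_mul !tp_pow !tp_qT.
rewrite Rint_wallis; last by apply/free_pow/free_q.
rewrite (Rint_ext _ (g := fun x : V => q o2 x ^+ n * tp oneT x)); last first.
  by move=> x; rewrite tp_pow tp_qT tp_oneT mulr1.
rewrite Rint_wallis; last by [].
rewrite Rint_tp !big_cons big_nil /= cos0 addr0.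
have w0 : wallis n != 0 by rewrite gt_eqF// wallis_gt0.
by field.
Qed.

Lemma wallis_ratio N : (0 < N)%N -> wallis (N ^ 2) / wallis (2 * N ^ 2) <= 2.
Proof.
move=> N0; set m := (N ^ 2)%N; have m0 : (0 < m)%N by rewrite expn_gt0 N0.
have w1 := wallis_gt0 m; have w2 := wallis_gt0 (2 * m).
rewrite ler_pdivrMr// -(@ler_pXn2r _ 2)// ?nnegrE ?mulr_ge0 ?(ltW w1) ?(ltW w2)//.
have h1 := wallis_le m.
have h2 := wallis_ge (2 * m).-1; rewrite prednK in h2; last by lia.
rewrite exprMn; set a := wallis m ^+ 2 in h1 *; set b := wallis _ ^+ 2 in h2 *.
have a0 : 0 <= a by exact: sqr_ge0.
have M0 : 0 < m%:R :> R by rewrite ltr0n.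
rewrite natrD (natrM _ 2 m) in h1; rewrite (natrM _ 4 (2 * m)) (natrM _ 2 m) in h2.
move: (m%:R) M0 h1 h2 => M M0 h1 h2.
have M2 : 0 < 2 * M by lra.
rewrite -(ler_pM2r M2).
nra.
Qed.

(** Each coordinate contributes 320, by [GT_le], and a factor 2 from the
    normalization, by [wallis_ratio]. *)
Definition CK : R := locked (8 * 320 ^+ 3).

Lemma CKE : CK = 8 * 320 ^+ 3.
Proof. by rewrite /CK -lock. Qed.

Lemma PT_le N (e : 'I_3 -> nat) x : (0 < N)%N -> (forall i, e i <= 2)%N ->
  (wallis (2 * N ^ 2)) ^- 3 * `|tp (PT (2 * N ^ 2) e) x| <=
    CK * N%:R ^+ (e o0 + e o1 + e o2) * K (N ^ 2) x.
Proof.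
move=> N0 e2; rewrite tp_PT !normrM.
have N0' : 0 <= N%:R :> R by [].
have b i := GT_le i x N0 (e2 i).
set w2 := wallis _; have w20 : 0 < w2 by exact: wallis_gt0.
have w1 := wallis_gt0 (N ^ 2); have r := wallis_ratio N0.
rewrite KE; set w := wallis (N ^ 2) in w1 r *.
rewrite -/w2 in r.
set Q := q o0 x ^+ _ * _.
have Q0 : 0 <= Q by rewrite !mulr_ge0// exprn_ge0// q_ge0.
have h : `|tp (GT (2 * N ^ 2) o0 (e o0)) x| *
   (`|tp (GT (2 * N ^ 2) o1 (e o1)) x| * `|tp (GT (2 * N ^ 2) o2 (e o2)) x|) <=
   320 ^+ 3 * N%:R ^+ (e o0 + e o1 + e o2) * Q.
  apply: (@le_trans _ _ ((320 * N%:R ^+ e o0 * q o0 x ^+ (N ^ 2)) *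
    ((320 * N%:R ^+ e o1 * q o1 x ^+ (N ^ 2)) * (320 * N%:R ^+ e o2 * q o2 x ^+ (N ^ 2))))).
    by rewrite ler_pM ?mulr_ge0 ?b//; apply: ler_pM; rewrite ?b.
  by rewrite /Q !exprD le_eqVlt; apply/orP; left; apply/eqP; ring.
apply: (le_trans (ler_wpM2l _ h)); first by rewrite invr_ge0 exprn_ge0// ltW.
have -> : w2 ^- 3 * (320 ^+ 3 * N%:R ^+ (e o0 + e o1 + e o2) * Q) =
   (w / w2) ^+ 3 * (320 ^+ 3 * N%:R ^+ (e o0 + e o1 + e o2) * (w ^- 3 * Q)).
  by field; rewrite !gt_eqF.
rewrite (_ : CK * _ * _ = 8 * (320 ^+ 3 * N%:R ^+ (e o0 + e o1 + e o2) * (w ^- 3 * Q))).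
  apply: ler_wpM2r; last first.
    have -> : (8 : R) = 2 ^+ 3 by ring.
    by rewrite lerXn2r ?nnegrE// divr_ge0// ltW.
  have a1 : 0 <= w ^- 3 by rewrite invr_ge0 exprn_ge0// ltW.
  have a2 : 0 <= N%:R ^+ (e o0 + e o1 + e o2) :> R by rewrite exprn_ge0.
  exact: mulr_ge0 (mulr_ge0 (exprn_ge0 3 (ler0n _ 320)) a2) (mulr_ge0 a1 Q0).
by rewrite CKE; ring.
Qed.

Lemma normr_KT N (l : seq (R * freq * R)) e x :
  tp l x = tp (PT (2 * N ^ 2) e) x ->
  `|tp (scaleT ((wallis (2 * N ^ 2)) ^- 3) l) x| =
   (wallis (2 * N ^ 2)) ^- 3 * `|tp (PT (2 * N ^ 2) e) x|.
Proof.
move=> h; rewrite tp_scale h normrM gtr0_norm//.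
by rewrite invr_gt0 exprn_gt0// wallis_gt0.
Qed.

Lemma K_le N x : (0 < N)%N -> K (2 * N ^ 2) x <= CK * K (N ^ 2) x.
Proof.
move=> N0; have := PT_le x N0 (e := fun=> 0%N) (fun=> isT).
by rewrite -(normr_KT (erefl (tp (PT (2 * N ^ 2) (fun=> 0%N)) x))) expr0 mulr1 => /(le_trans (ler_norm _)).
Qed.

Lemma dK_le N i x : (0 < N)%N ->
  `|tp (dT i (KT (2 * N ^ 2))) x| <= CK * N%:R * K (N ^ 2) x.
Proof.
move=> N0; rewrite /KT dT_scale (normr_KT (tp_dT_PT _ _ _ _)).
apply: (le_trans (PT_le x N0 _)); first by move=> j; case: eqP.
by rewrite -[X in _ <= _ * X * _]expr1; case: i => [[|[|[|//]]] hi].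
Qed.

(** Second derivatives, like [dK_le] and [K_le], stay below the same kernel
    with half of the power, at the cost of a factor N for each derivative.
    Averages against derivatives of the kernel are thus dominated by
    averages against a positive kernel. *)
Lemma ddK_le N i j x : (0 < N)%N ->
  `|tp (dT i (dT j (KT (2 * N ^ 2)))) x| <= CK * N%:R ^+ 2 * K (N ^ 2) x.
Proof.
move=> N0; rewrite /KT !dT_scale.
rewrite (normr_KT (e := fun c : 'I_3 => (0 + (j == c) + (i == c))%N)); last first.
  by rewrite (dT_ext _ (m := PT (2 * N ^ 2) (fun c => (0 + (j == c))%N))) ?tp_dT_PT//;
    exact: tp_dT_PT.
apply: (le_trans (PT_le x N0 _)); first by move=> k; case: eqP; case: eqP.
by case: i => [[|[|[|//]]] hi]; case: j => [[|[|[|//]]] hj].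
Qed.

End Kernel.

(** * Decay of the kernel on the torus *)

Section Decay.
Context {R : realType}.
Local Notation V := (measurableTypeR R * measurableTypeR R * measurableTypeR R)%type.
Local Notation mu := (@tmu R).
Implicit Types (x y z : vec R) (i j : 'I_3).

Lemma cos_pi4_sqr : cos (pi / 4) ^+ 2 = 1 / 2 :> R.
Proof.
have := @cos_double R (pi / 4).
have -> : 2 * (pi / 4) = pi / 2 :> R by field.
rewrite cos_pihalf => /eqP; rewrite eq_sym subr_eq0 => /eqP; lra.
Qed.

Lemma sin_ge_half (t : R) : 0 <= t <= pi / 2 -> t / 2 <= sin t.
Proof.
move=> /andP[t0 t1]; have pp := @pi_gt0 R.
move: t0; rewrite le_eqVlt => /predU1P[<-|t0]; first by rewrite sin0; lra.
set s := t / 2; have s0 : 0 < s by rewrite /s; lra.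
have s1 : s <= pi / 4 by rewrite /s; lra.
have c0 : 0 < cos (pi / 4) :> R by apply: cos_gt0_pihalf; apply/andP; split; lra.
have ce (r : R) : 0 <= r <= pi / 4 -> cos (pi / 4) <= cos r.
  move=> /andP[r0 r1]; rewrite leNgt; apply/negP.
  rewrite ltr_cos ?in_itv/=; first by move=> h; lra.
    by apply/andP; split; lra.
  by apply/andP; split; lra.
have hs : cos (pi / 4) * s <= sin s.
  have [] := @MVT R sin cos 0 s s0 (fun r _ => is_derive_sin r).
    by apply: continuous_subspaceT; exact: continuous_sin.
  move=> r; rewrite in_itv /= => /andP[r0 r1]; rewrite sin0 !subr0 => ->.
  by rewrite ler_pM2r// ce//; apply/andP; split; lra.
have -> : t = s *+ 2 by rewrite /s -mulr_natr; field.
rewrite sin_mulr2n -mulr_natr.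
have h2 : cos (pi / 4) <= cos s by rewrite ce//; apply/andP; split; lra.
have e := cos_pi4_sqr.
have : cos (pi / 4) * (cos (pi / 4) * s) <= cos s * sin s.
  by apply: ler_pM => //; rewrite ?mulr_ge0// ltW.
by rewrite mulrA -expr2 e -[_ *+ 2]mulr_natr; lra.
Qed.

Lemma sqr_le_sin_pi (s : R) : `|s| <= 1 / 2 -> s ^+ 2 <= 1 - cos (pi * s) ^+ 2.
Proof.
move=> hs; have pp := @pi_gt0 R; have p2 := @pi_ge2 R.
have e : cos (pi * s) = cos (pi * `|s|).
  by rewrite -(cos_norm (pi * s)) normrM gtr0_norm.
rewrite e -sin2cos2 -[s ^+ 2]real_normK ?num_real//.
have s0 : 0 <= `|s| by [].
move: (`|s|) hs s0 => r hs r0.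
have h := @sin_ge_half (pi * r) _.
have h1 : pi * r <= pi / 2 by rewrite ler_pM2l//; lra.
have h0 : 0 <= pi * r by rewrite mulr_ge0// ltW.
have {}h := h (introT andP (conj h0 h1)).
rewrite lerXn2r ?nnegrE//; first by apply: le_trans h; nra.
by apply: le_trans h; nra.
Qed.

Lemma round_int (s : R) : exists n : int, `|s + n%:~R| <= 1 / 2.
Proof.
exists (- Num.floor (s + 1 / 2)).
have /andP[h1 h2] := floor_itv (s + 1 / 2).
rewrite intrD in h2; rewrite mulrNz ler_norml; apply/andP; split; lra.
Qed.

Lemma cos2_int_period (s : R) (n : int) :
  cos (pi * (s + n%:~R)) ^+ 2 = cos (pi * s) ^+ 2.
Proof.
have h (r : R) : cos (pi * r) ^+ 2 = (1 + cos (2 * pi * r)) / 2.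
  by rewrite -(mulrA 2) cos_double; field.
by rewrite !h mulrDr cos_int_period.
Qed.

Lemma enorm_ge0 x : 0 <= enorm x. Proof. exact: sqrtr_ge0. Qed.

Lemma enorm_sqr x : enorm x ^+ 2 = x.1.1 ^+ 2 + x.1.2 ^+ 2 + x.2 ^+ 2.
Proof. by rewrite sqr_sqrtr ?dotE -?expr2// !addr_ge0 ?sqr_ge0. Qed.

Lemma vcoord_le_enorm x i : `|vcoord x i| <= enorm x.
Proof.
rewrite -(@ler_pXn2r _ 2)// ?nnegrE ?enorm_ge0// real_normK ?num_real// enorm_sqr.
have h1 := sqr_ge0 x.1.1; have h2 := sqr_ge0 x.1.2; have h3 := sqr_ge0 x.2.
by case: i => [[|[|[|//]]] hi]; rewrite /vcoord /=; lra.
Qed.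

Lemma torus_dist_lbound x y :
  has_lbound [set enorm (x - y + k) | k in lattice].
Proof. by exists 0 => _ [k _ <-]; exact: enorm_ge0. Qed.

Lemma lattice0 : @lattice R 0.
Proof. by move=> i; exists 0; case: i => [[|[|[|//]]] hi]. Qed.

Lemma torus_dist_ge0 x y : 0 <= torus_dist x y.
Proof.
apply: lb_le_inf; first by exists (enorm (x - y + 0)), 0 => //; exact: lattice0.
by move=> _ [k _ <-]; exact: enorm_ge0.
Qed.

(** Round each coordinate of x - y to the nearest integer; the remaining
    distance is controlled by the sine, hence by 1 - [q]. *)
Lemma torus_dist_le x y :
  torus_dist x y ^+ 2 <= (1 - q o0 (x - y)) + (1 - q o1 (x - y)) + (1 - q o2 (x - y)).
Proof.
pose z := x - y.
have [n1 h1] := round_int z.1.1; have [n2 h2] := round_int z.1.2.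
have [n3 h3] := round_int z.2.
pose k : vec R := (n1%:~R, n2%:~R, n3%:~R).
have lk : lattice k by move=> i; case: i => [[|[|[|//]]] hi]; [exists n1|exists n2|exists n3].
have d1 : torus_dist x y <= enorm (x - y + k).
  by apply: ge_inf; [exact: torus_dist_lbound|exists k].
apply: (@le_trans _ _ (enorm (x - y + k) ^+ 2)).
  by rewrite lerXn2r ?nnegrE ?torus_dist_ge0 ?enorm_ge0.
rewrite enorm_sqr -/z /q /vcoord /=.
have e1 := sqr_le_sin_pi h1; rewrite cos2_int_period in e1.
have e2 := sqr_le_sin_pi h2; rewrite cos2_int_period in e2.
have e3 := sqr_le_sin_pi h3; rewrite cos2_int_period in e3.
by rewrite !lerD.
Qed.

Lemma far_from_int (s : R) : (forall n : int, s != n%:~R) ->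
  exists2 d : R, 0 < d & forall n : int, d <= `|s + n%:~R|.
Proof.
move=> hs; set f := Num.floor s.
have /andP[f1 f2] := floor_itv s; rewrite -/f in f1 f2.
have f3 : f%:~R < s by rewrite lt_def f1 (hs f).
exists (Num.min (s - f%:~R) (f%:~R + 1 - s)).
  by rewrite lt_min; apply/andP; split; rewrite intrD in f2; lra.
move=> n; rewrite ge_min; rewrite intrD in f2.
have [h|h] := leP 0 (f + n).
  have h' : 0 <= f%:~R + n%:~R :> R by rewrite -intrD ler0z.
  by apply/orP; left; apply: le_trans (ler_norm _); lra.
have h' : f%:~R + n%:~R <= -1 :> R.
  by rewrite -intrD -[leRHS](mulrNz 1 1) ler_int; lia.
by apply/orP; right; rewrite -normrN; apply: le_trans (ler_norm _); lra.
Qed.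

(** In a coordinate that is not an integer the distance to the integers is
    bounded below. *)
Lemma torus_dist_eq0 x y : torus_dist x y = 0 -> lattice (x - y).
Proof.
move=> d0 i; apply: contrapT => hn.
have [d dp hd] : exists2 d : R, 0 < d & forall n : int, d <= `|vcoord (x - y) i + n%:~R|.
  apply: far_from_int => n; apply/eqP => e; apply: hn; by exists n.
suff : d <= torus_dist x y by rewrite d0 leNgt dp.
apply: lb_le_inf; first by exists (enorm (x - y + 0)), 0 => //; exact: lattice0.
move=> _ [k lk <-]; have [n hk] := lk i.
apply: le_trans (vcoord_le_enorm _ i).
have -> : vcoord (x - y + k) i = vcoord (x - y) i + n%:~R.
  by rewrite -hk; case: i {hn hd hk} => [[|[|[|//]]] hi].
exact: hd.
Qed.

Lemma pow_mul3_le (p : R) m : 0 <= p <= 1 -> (0 < m)%N ->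
  p ^+ m * (1 - p) ^+ 3 * m%:R ^+ 3 <= 27.
Proof.
move=> /andP[p0 p1] m0; set k := (m %/ 3)%N.
have h := @pow_mul_le1 R p k (introT andP (conj p0 p1)).
have k0 : 0 <= k.+1%:R * p ^+ k * (1 - p) by rewrite !mulr_ge0 ?exprn_ge0 ?subr_ge0.
have h3 : (k.+1%:R * p ^+ k * (1 - p)) ^+ 3 <= 1 by rewrite exprn_ile1.
have e : p ^+ m <= (p ^+ k) ^+ 3.
  rewrite -exprM; apply: ler_wiXn2l => //; rewrite /k; lia.
have m3 : m%:R <= 3 * k.+1%:R :> R by rewrite -natrM ler_nat /k; lia.
have q0 : 0 <= (1 - p) ^+ 3 by rewrite exprn_ge0// subr_ge0.
have m3' : m%:R ^+ 3 <= 27 * k.+1%:R ^+ 3 :> R.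
  have -> : 27 * k.+1%:R ^+ 3 = (3 * k.+1%:R) ^+ 3 :> R by ring.
  by rewrite lerXn2r ?nnegrE ?mulr_ge0.
apply: (@le_trans _ _ ((p ^+ k) ^+ 3 * (1 - p) ^+ 3 * (27 * k.+1%:R ^+ 3))).
  apply: ler_pM => //; last exact: ler_wpM2r.
    by rewrite mulr_ge0// exprn_ge0.
have -> : (p ^+ k) ^+ 3 * (1 - p) ^+ 3 * (27 * k.+1%:R ^+ 3) =
   27 * (k.+1%:R * p ^+ k * (1 - p)) ^+ 3 by ring.
lra.
Qed.

Lemma wallis_inv_le N : (0 < N)%N -> @wallis R (N ^ 2) ^- 3 <= 8 * N%:R ^+ 3.
Proof.
move=> N0; set m := (N ^ 2)%N; have m0 : (0 < m)%N by rewrite expn_gt0 N0.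
have w0 := @wallis_gt0 R m.
have N0' : 0 < N%:R :> R by rewrite ltr0n.
have h := @wallis_ge R m.-1; rewrite prednK// in h.
have h1 : (wallis m)^-1 <= 2 * N%:R :> R.
  rewrite -[leLHS]div1r ler_pdivrMr//.
  rewrite -(@ler_pXn2r _ 2)// ?nnegrE ?mulr_ge0 ?(ltW w0) ?(ltW N0')//.
  rewrite expr1n !exprMn; move: h; rewrite natrM /m natrX; lra.
have -> : 8 * N%:R ^+ 3 = (2 * N%:R) ^+ 3 :> R by ring.
by rewrite -exprVn lerXn2r// nnegrE ?invr_ge0 ?(ltW w0)// mulr_ge0// ltW.
Qed.

Lemma K_sup N x : (0 < N)%N -> K (N ^ 2) x <= 8 * N%:R ^+ 3 :> R.
Proof.
move=> N0; rewrite KE; apply: le_trans (wallis_inv_le N0).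
rewrite ler_piMr ?invr_ge0 ?exprn_ge0 ?(ltW (wallis_gt0 _))//.
have h i : 0 <= q i x ^+ (N ^ 2) <= 1 by rewrite exprn_ge0 ?q_ge0// exprn_ile1 ?q_ge0 ?q_le1.
move: (h o0) (h o1) (h o2) => /andP[? ?] /andP[? ?] /andP[? ?].
by rewrite !mulr_ile1// mulr_ge0.
Qed.

(** Polynomial decay of order six: a power p ^ m (1 - p) ^ 3 is at most 27 /
    m ^ 3, in each coordinate. *)
Lemma K_far N x y : (0 < N)%N ->
  K (N ^ 2) (x - y) * (N%:R * torus_dist x y) ^+ 6 <= 5832 * N%:R ^+ 3.
Proof.
move=> N0; have N0' : 0 < N%:R :> R by rewrite ltr0n.
set m := (N ^ 2)%N; have m0 : (0 < m)%N by rewrite expn_gt0 N0.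
have d2 := torus_dist_le x y.
rewrite KE -/m; set w := wallis m ^- 3.
have w0 : 0 <= w by rewrite invr_ge0 exprn_ge0// ltW// wallis_gt0.
have wN := wallis_inv_le N0; rewrite -/m -/w in wN.
have t i : q i (x - y) ^+ m * (1 - q i (x - y)) ^+ 3 * m%:R ^+ 3 <= 27.
  by apply: pow_mul3_le => //; rewrite q_ge0 q_le1.
have qq i : 0 <= q i (x - y) <= 1 by rewrite q_ge0 q_le1.
move: (qq o0) (qq o1) (qq o2) (t o0) (t o1) (t o2) => {t qq}.
move: (q o0 _) (q o1 _) (q o2 _) d2 => a b c d2 /andP[a0 a1] /andP[b0 b1] /andP[c0 c1] ta tb tc.
have M : m%:R = N%:R ^+ 2 :> R by rewrite natrX.
rewrite M in ta tb tc.
have dd : torus_dist x y ^+ 6 <= 9 * ((1 - a) ^+ 3 + (1 - b) ^+ 3 + (1 - c) ^+ 3).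
  have -> : torus_dist x y ^+ 6 = (torus_dist x y ^+ 2) ^+ 3 by rewrite -exprM.
  apply: (@le_trans _ _ ((1 - a + (1 - b) + (1 - c)) ^+ 3)).
    apply: lerXn2r => //; rewrite nnegrE; first exact: sqr_ge0.
    by apply: addr_ge0; [apply: addr_ge0|]; rewrite subr_ge0.
  have : 0 <= 1 - a by rewrite subr_ge0.
  have : 0 <= 1 - b by rewrite subr_ge0.
  have : 0 <= 1 - c by rewrite subr_ge0.
  move: (1 - a) (1 - b) (1 - c) => A B C C0 B0 A0.
  have e : 9 * (A ^+ 3 + B ^+ 3 + C ^+ 3) - (A + B + C) ^+ 3 =
    3 * ((A + B) * (A - B) ^+ 2 + (B + C) * (B - C) ^+ 2 + (A + C) * (A - C) ^+ 2)
    + (A + B + C) * ((A - B) ^+ 2 + (B - C) ^+ 2 + (A - C) ^+ 2) by ring.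
  have s1 (u v : R) : 0 <= u -> 0 <= v -> 0 <= (u + v) * (u - v) ^+ 2.
    by move=> u0 v0; rewrite mulr_ge0 ?sqr_ge0// addr_ge0.
  rewrite -subr_ge0 e; apply: addr_ge0.
    by apply: mulr_ge0 => //; apply: addr_ge0; [apply: addr_ge0|]; exact: s1.
  apply: mulr_ge0; first by rewrite !addr_ge0.
  by rewrite !addr_ge0 ?sqr_ge0.
set P := a ^+ m * (b ^+ m * c ^+ m).
have am : 0 <= a ^+ m <= 1 by rewrite exprn_ge0 ?exprn_ile1.
have bm : 0 <= b ^+ m <= 1 by rewrite exprn_ge0 ?exprn_ile1.
have cm : 0 <= c ^+ m <= 1 by rewrite exprn_ge0 ?exprn_ile1.
move: am bm cm => /andP[am0 am1] /andP[bm0 bm1] /andP[cm0 cm1].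
have N6 : 0 <= N%:R ^+ 6 :> R by rewrite exprn_ge0.
have P0 : 0 <= P by rewrite !mulr_ge0.
have Pa : P * (1 - a) ^+ 3 * N%:R ^+ 6 <= 27.
  apply: le_trans ta; rewrite -exprM ler_wpM2r// ler_wpM2r ?exprn_ge0 ?subr_ge0//.
  by rewrite /P ler_piMr// mulr_ile1.
have Pb : P * (1 - b) ^+ 3 * N%:R ^+ 6 <= 27.
  apply: le_trans tb; rewrite -exprM ler_wpM2r// ler_wpM2r ?exprn_ge0 ?subr_ge0//.
  by rewrite /P mulrCA ler_piMr// mulr_ile1.
have Pc : P * (1 - c) ^+ 3 * N%:R ^+ 6 <= 27.
  apply: le_trans tc; rewrite -exprM ler_wpM2r// ler_wpM2r ?exprn_ge0 ?subr_ge0//.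
  by rewrite /P mulrA ler_piMl// mulr_ile1.
rewrite exprMn.
have h : P * (N%:R ^+ 6 * torus_dist x y ^+ 6) <= 729.
  apply: (@le_trans _ _ (P * (N%:R ^+ 6 * (9 * ((1 - a) ^+ 3 + (1 - b) ^+ 3 + (1 - c) ^+ 3))))).
    by rewrite ler_wpM2l// ler_wpM2l.
  have -> : P * (N%:R ^+ 6 * (9 * ((1 - a) ^+ 3 + (1 - b) ^+ 3 + (1 - c) ^+ 3))) =
     9 * (P * (1 - a) ^+ 3 * N%:R ^+ 6 + P * (1 - b) ^+ 3 * N%:R ^+ 6 +
          P * (1 - c) ^+ 3 * N%:R ^+ 6) by ring.
  lra.
rewrite -mulrA; apply: (le_trans (ler_wpM2l w0 h)).
have := ler_wpM2r (ler0n _ 729) wN; lra.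
Qed.

(** The sum of the bounds 8 of [K_sup], near the diagonal, and 5832 = 8 * 27
    * 27 of [K_far], away from it. *)
Definition CD : R := locked 5840.

(** The kernel is dominated by the singular weight of the fractional
    seminorm, with the scaling of a bump of width 1 / N. *)
Lemma K_decay N (theta : R) x y : (0 < N)%N -> 0 < theta < 1 ->
  K (N ^ 2) (x - y) * torus_dist x y `^ (theta * 3 + 3) <=
    CD * (N%:R `^ (theta * 3))^-1.
Proof.
move=> N0 /andP[t0 t1]; have N0' : 0 < N%:R :> R by rewrite ltr0n.
set d := torus_dist x y; have d0 : 0 <= d by exact: torus_dist_ge0.
set s := theta * 3 + 3; have s0 : 0 < s by rewrite /s; lra.
have s6 : s <= 6 by rewrite /s; lra.
set rho := N%:R * d; have r0 : 0 <= rho by rewrite mulr_ge0// ltW.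
have k0 := K_ge0 (N ^ 2) (x - y).
have kf := K_far x y N0; have ks := K_sup (x - y) N0.
have hr : rho `^ s <= 1 + rho ^+ 6.
  have [h|h] := leP rho 1.
    apply: (@le_trans _ _ 1); last by rewrite lerDl exprn_ge0.
    have -> : 1 = 1 `^ s :> R by rewrite powR1.
    by apply: ge0_ler_powR; rewrite ?nnegrE// ltW.
  rewrite -powR_mulrn//; apply: (@le_trans _ _ (rho `^ 6)).
    by apply: ler_powR => //; exact: ltW.
  by rewrite lerDr.
have e : rho `^ s = N%:R `^ (theta * 3) * N%:R ^+ 3 * d `^ s.
  rewrite /rho powRM//.
  congr (_ * _); rewrite /s powRD; last by rewrite (gt_eqF N0') implybT.
  by congr (_ * _); rewrite powR_mulrn// ltW.
have nt : 0 < N%:R `^ (theta * 3) :> R by exact: powR_gt0.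
have N3 : 0 < N%:R ^+ 3 :> R by rewrite exprn_gt0.
rewrite ler_pdivlMr// -(ler_pM2r N3).
have -> : K (N ^ 2) (x - y) * d `^ s * N%:R `^ (theta * 3) * N%:R ^+ 3 =
  K (N ^ 2) (x - y) * rho `^ s by rewrite e; ring.
apply: (le_trans (ler_wpM2l k0 hr)); rewrite mulrDr mulr1.
move: kf ks; rewrite -/d -/rho /CD -lock => kf ks; lra.
Qed.

End Decay.

(** * Spatial estimates for a rough vector field *)

Section NonMeasurable.
Context d (T : measurableType d) (R : realType).
Variable mu : {measure set T -> \bar R}.

(** A nonnegative integral is a supremum over the simple functions below the
    integrand, a family that only grows with it. The integrand of the
    seminorm is treated in this way, as a function whose singular weight is
    an infimum over lattice translations. *)
Lemma ge0_integral_mono (f g : T -> \bar R) :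
  (forall x, 0 <= f x)%E -> (forall x, f x <= g x)%E ->
  (\int[mu]_x f x <= \int[mu]_x g x)%E.
Proof.
move=> f0 fg; have g0 x : (0 <= g x)%E by apply: le_trans (fg x).
rewrite !ge0_integralTE//; apply: ge_ereal_sup => _ [h hf <-].
apply: ereal_sup_ubound; exists h => // x; exact: le_trans (hf x) (fg x).
Qed.

End NonMeasurable.

Section Young.
Context {R : realType}.

(** Lyapunov's inequality between moments, in the form of an inequality with
    a free parameter s, to be chosen as the cube root of the third moment. *)
Lemma young1 (a s : R) : 0 <= a -> 0 < s -> a <= s + a ^+ 3 / s ^+ 2.
Proof.
move=> a0 s0; rewrite -(ler_pM2r (exprn_gt0 2 s0)) mulrDl divfK ?gt_eqF ?exprn_gt0//.
have [h|h] := leP a s.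
  have := ler_wpM2r (sqr_ge0 s) h.
  have : 0 <= a ^+ 3 by rewrite exprn_ge0.
  lra.
have h2 : s ^+ 2 <= a ^+ 2 by apply: lerXn2r; rewrite ?nnegrE; lra.
have := ler_wpM2l a0 h2; have : 0 <= s * s ^+ 2 by rewrite mulr_ge0 ?sqr_ge0 ?ltW.
rewrite -exprS; lra.
Qed.

Lemma young2 (a s : R) : 0 <= a -> 0 < s -> a ^+ 2 <= s ^+ 2 + a ^+ 3 / s.
Proof.
move=> a0 s0; rewrite -(ler_pM2r s0) mulrDl divfK ?gt_eqF//.
have [h|h] := leP a s.
  have h2 : a ^+ 2 <= s ^+ 2 by apply: lerXn2r; rewrite ?nnegrE; lra.
  have := ler_wpM2r (ltW s0) h2.
  have : 0 <= a ^+ 3 by rewrite exprn_ge0.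
  lra.
have := ler_wpM2l (sqr_ge0 a) (ltW h).
have : 0 <= s ^+ 2 * s by rewrite mulr_ge0 ?sqr_ge0 ?ltW.
rewrite -[a ^+ 2 * a]exprSr; lra.
Qed.

Lemma pow_le_cube (a : R) p : 0 <= a -> (p <= 3)%N -> a ^+ p <= 1 + a ^+ 3.
Proof.
move=> a0 p3; have [h|h] := leP a 1.
  by rewrite (le_trans (exprn_ile1 p a0 h))// lerDl exprn_ge0.
by rewrite (le_trans (ler_weXn2l (ltW h) p3))// lerDr.
Qed.

Lemma cube_sum_le (a b : R) : 0 <= a -> 0 <= b -> (a + b) ^+ 3 <= 4 * (a ^+ 3 + b ^+ 3).
Proof.
move=> a0 b0; rewrite -subr_ge0.
have -> : 4 * (a ^+ 3 + b ^+ 3) - (a + b) ^+ 3 = 3 * (a + b) * (a - b) ^+ 2 by ring.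
by rewrite mulr_ge0 ?sqr_ge0// mulr_ge0// addr_ge0.
Qed.

Definition cbrt (a : R) := a `^ (3^-1).

Lemma cbrt_ge0 a : 0 <= cbrt a. Proof. exact: powR_ge0. Qed.

Lemma cbrtK a : 0 <= a -> cbrt a ^+ 3 = a.
Proof.
move=> a0; rewrite -powR_mulrn ?cbrt_ge0// /cbrt -powRrM mulVf ?powRr1//.
Qed.

End Young.

Section Rough.
Context {R : realType}.
Local Notation V := (measurableTypeR R * measurableTypeR R * measurableTypeR R)%type.
Local Notation mu := (@tmu R).
Implicit Types (x y : vec R) (i j : 'I_3) (u : 'I_3 -> V -> R) (l : seq (R * freq * R)).

(** A scalar envelope of the field. *)
Definition env u x : R := \sum_i `|u i x|.
(** The envelope of the increments. *)
Definition dl u x y : R := \sum_i `|u i x - u i y|.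
Definition alpha N u x : R := \int[mu]_y (K (N ^ 2) (x - y) * dl u x y ^+ 3).

Record tame u : Prop := Tame {
  tame_meas : forall i, measurable_fun setT (u i);
  tame_int : intg mu (fun x => env u x ^+ 3) }.

(** The fractional regularity is only used through the smallness of the third
    moment of the increments, averaged at scale 1/N. *)
Record rough (theta A : R) u : Prop := Rough {
  rough_tame : tame u;
  rough_gag : forall N, (0 < N)%N ->
    \int[mu]_x alpha N u x <= A * (N%:R `^ (theta * 3))^-1 }.

Lemma env_ge0 u x : 0 <= env u x. Proof. exact: sumr_ge0. Qed.
Lemma dl_ge0 u x y : 0 <= dl u x y. Proof. exact: sumr_ge0. Qed.

Lemma u_le_env u i x : `|u i x| <= env u x.
Proof. by rewrite /env (bigD1 i)//= lerDl sumr_ge0. Qed.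

Lemma du_le_dl u i x y : `|u i x - u i y| <= dl u x y.
Proof. by rewrite /dl (bigD1 i)//= lerDl sumr_ge0. Qed.

Lemma dl_le_env u x y : dl u x y <= env u x + env u y.
Proof. by rewrite /dl /env -big_split; apply: ler_sum => i _; exact: ler_normB. Qed.

(** Crude domination, which makes all the integrals below converge. *)
Lemma dl_pow_le u x y p : (p <= 3)%N ->
  dl u x y ^+ p <= 1 + 4 * env u x ^+ 3 + 4 * env u y ^+ 3.
Proof.
move=> p3; apply: (le_trans (pow_le_cube (dl_ge0 u x y) p3)).
rewrite -addrA lerD2l -mulrDr; apply: le_trans (cube_sum_le _ _); rewrite ?env_ge0//.
by rewrite lerXn2r ?nnegrE ?dl_ge0 ?dl_le_env// addr_ge0 ?env_ge0.
Qed.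

Lemma measurable_tp_sub l :
  measurable_fun setT (fun z : V * V => tp l (z.1 - z.2)).
Proof.
elim: l => [|t l IH].
  by rewrite (_ : (fun _ => _) = fun=> 0)//; apply/funext => z; rewrite tp_nil.
rewrite (_ : (fun _ => _) = fun z : V * V => t.1.1 * (chr t.1.2 t.2 z.1 * chr t.1.2 0 z.2 +
   chr t.1.2 (t.2 - pi / 2) z.1 * chr t.1.2 (- (pi / 2)) z.2) + tp l (z.1 - z.2)); last first.
  by apply/funext => z; rewrite tp_cons chr_sub.
have m1 k b : measurable_fun setT (fun z : V * V => chr k b z.1).
  by apply: (measurableT_comp (measurable_chr k b)); exact: measurable_fst.
have m2 k b : measurable_fun setT (fun z : V * V => chr k b z.2).
  by apply: (measurableT_comp (measurable_chr k b)); exact: measurable_snd.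
apply: measurable_funD => //; apply: measurable_funM => //.
by apply: measurable_funD; apply: measurable_funM.
Qed.

Lemma measurable_tp_subr l x : measurable_fun setT (fun y : V => tp l (x - y)).
Proof.
rewrite (_ : (fun _ => _) = tp (reflT x l)); first exact: measurable_tp.
by apply/funext => y; rewrite tp_refl.
Qed.

Lemma intg_tp_sub l x : intg mu (fun y => tp l (x - y)).
Proof.
exact: (intg_bounded _ (measurable_tp_subr l x) (fun y => tp_le l (x - y))).
Qed.

Section Tame.
Variable u : 'I_3 -> V -> R.
Hypothesis tu : tame u.

Let mu_ i := tame_meas tu i.

Lemma measurable_env : measurable_fun setT (env u).
Proof.
rewrite (_ : env u = fun x => \sum_(i <- index_enum 'I_3) `|u i x|)//.
elim: (index_enum _) => [|i s IH].
  by rewrite (_ : (fun _ => _) = fun=> 0)//; apply/funext => z; rewrite big_nil.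
rewrite (_ : (fun _ => _) = fun x => `|u i x| + \sum_(i <- s) `|u i x|).
  apply: measurable_funD => //.
  exact: (measurableT_comp (@normr_measurable R setT) (mu_ i)).
by apply/funext => z; rewrite big_cons.
Qed.

Lemma measurable_dl : measurable_fun setT (fun z : V * V => dl u z.1 z.2).
Proof.
rewrite (_ : (fun z : V * V => dl u z.1 z.2) =
  fun z => \sum_(i <- index_enum 'I_3) `|u i z.1 - u i z.2|)//.
elim: (index_enum _) => [|i s IH].
  by rewrite (_ : (fun _ => _) = fun=> 0)//; apply/funext => z; rewrite big_nil.
rewrite (_ : (fun _ => _) = fun z : V * V => `|u i z.1 - u i z.2| +
    \sum_(i <- s) `|u i z.1 - u i z.2|).
  apply: measurable_funD => //; apply: measurableT_comp => //.
  by apply: measurable_funB; apply: measurableT_comp => //; exact: mu_.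
by apply/funext => z; rewrite big_cons.
Qed.

Lemma measurable_dlr x : measurable_fun setT (fun y : V => dl u x y).
Proof.
exact: (measurableT_comp measurable_dl (measurable_pair1 x)).
Qed.

Lemma intg_env p : (p <= 3)%N -> intg mu (fun x => env u x ^+ p).
Proof.
move=> p3; apply: (intg_le _ (intgD (intg_cst mu 1) (tame_int tu))).
  by apply: measurable_funX; exact: measurable_env.
by move=> x; rewrite ger0_norm ?exprn_ge0 ?env_ge0// pow_le_cube ?env_ge0.
Qed.

Lemma intg_u i : intg mu (u i).
Proof.
apply: (intg_le (mu_ i) (intg_env (isT : 1 <= 3)%N)) => x.
by rewrite expr1 u_le_env.
Qed.

Lemma intg_uu i j : intg mu (fun x => u i x * u j x).
Proof.
apply: (intg_le _ (intg_env (isT : 2 <= 3)%N)) => [|x]; first exact: measurable_funM.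
by rewrite normrM expr2 ler_pM// u_le_env.
Qed.

Lemma intg_tp_dl l x p : (p <= 3)%N -> intg mu (fun y => tp l (x - y) * dl u x y ^+ p).
Proof.
move=> p3; apply: (intg_bndl (measurable_tp_subr l x) (fun y => tp_le l (x - y))).
have hb : intg mu (fun y => 1 + 4 * env u x ^+ 3 + 4 * env u y ^+ 3).
  by apply: intgD; [exact: (intg_cst mu) | apply: intgZ; exact: tame_int tu].
apply: (intg_le _ hb) => [|y]; first by apply: measurable_funX; exact: measurable_dlr.
by rewrite ger0_norm ?exprn_ge0 ?dl_ge0// dl_pow_le.
Qed.

Lemma intg_prod_dl l p : (p <= 3)%N ->
  intg (mu \x mu)%E (fun z : V * V => tp l (z.1 - z.2) * dl u z.1 z.2 ^+ p).
Proof.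
move=> p3; apply: (intg_bndl (measurable_tp_sub l) (fun z : V * V => tp_le l (z.1 - z.2))).
have i1 : intg (mu \x mu)%E (fun z : V * V => (1 + 4 * env u z.1 ^+ 3) * 1).
  have i0 : intg mu (fun x => 1 + 4 * env u x ^+ 3).
    by apply: intgD; [exact: (intg_cst mu) | apply: intgZ; exact: tame_int tu].
  exact: (intg_tensor i0 (intg_cst mu 1)).
have i2 : intg (mu \x mu)%E (fun z : V * V => 1 * (4 * env u z.2 ^+ 3)).
  exact: (intg_tensor (intg_cst mu 1) (intgZ 4 (tame_int tu))).
apply: (intg_le _ (intgD i1 i2)) => [|z].
  by apply: measurable_funX; exact: measurable_dl.
by rewrite mulr1 mul1r ger0_norm ?exprn_ge0 ?dl_ge0// dl_pow_le.
Qed.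

Lemma intg_alpha N : intg mu (alpha N u).
Proof. exact: (Rfubini1 (intg_prod_dl (KT (N ^ 2)) (isT : 3 <= 3)%N)).1. Qed.

Lemma alpha_ge0 N x : 0 <= alpha N u x.
Proof. by apply: Rint_ge0 => y; rewrite mulr_ge0 ?K_ge0 ?exprn_ge0 ?dl_ge0. Qed.

(** The local modulus of continuity at scale 1/N. *)
Definition osc N x := cbrt (alpha N u x).

Lemma osc_ge0 N x : 0 <= osc N x. Proof. exact: cbrt_ge0. Qed.

Lemma osc_cube N x : osc N x ^+ 3 = alpha N u x.
Proof. by rewrite cbrtK// alpha_ge0. Qed.

Lemma measurable_osc N : measurable_fun setT (osc N).
Proof.
apply: (measurableT_comp (measurable_powR _)); exact: intg_measurable (intg_alpha N).
Qed.

Lemma intg_osc N p : (p <= 3)%N -> intg mu (fun x => osc N x ^+ p).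
Proof.
move=> p3; apply: (intg_le _ (intgD (intg_cst mu 1) (intg_alpha N))).
  by apply: measurable_funX; exact: measurable_osc.
by move=> x; rewrite ger0_norm ?exprn_ge0 ?osc_ge0// -osc_cube pow_le_cube ?osc_ge0.
Qed.

Lemma Rint_K_sub n x : \int[mu]_y K n (x - y) = 1.
Proof. by rewrite Rint_refl -(Rint_K n). Qed.

(** First and second moments of the increments are controlled by the third,
    by Hoelder's inequality for the probability density K (x - .). *)
Lemma moment1 N x : \int[mu]_y (K (N ^ 2) (x - y) * dl u x y) <= 2 * osc N x.
Proof.
have h (s : R) : 0 < s ->
    \int[mu]_y (K (N ^ 2) (x - y) * dl u x y) <= s + alpha N u x / s ^+ 2.
  move=> s0.
  apply: (@le_trans _ _ (\int[mu]_y (s * K (N ^ 2) (x - y) +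
      (s ^+ 2)^-1 * (K (N ^ 2) (x - y) * dl u x y ^+ 3)))).
    apply: Rint_le.
    - by apply: intg_eq (intg_tp_dl (KT (N ^ 2)) x (isT : 1 <= 3)%N) => y; rewrite expr1.
    - by apply: intgD; apply: intgZ; [exact: intg_tp_sub | exact: intg_tp_dl].
    - move=> y; have := ler_wpM2l (K_ge0 (N ^ 2) (x - y)) (young1 (dl_ge0 u x y) s0).
      by move=> /le_trans; apply; rewrite le_eqVlt; apply/orP; left; apply/eqP; ring.
  rewrite RintD; [|apply: intgZ; exact: intg_tp_sub|apply: intgZ; exact: intg_tp_dl].
  rewrite !RintZ ?Rint_K_sub ?mulr1; [|exact: intg_tp_dl|exact: intg_tp_sub].
  by rewrite mulrC.
have := osc_ge0 N x; rewrite le_eqVlt => /predU1P[e|s0]; last first.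
  apply: (le_trans (h _ s0)); rewrite -osc_cube exprS mulfK ?gt_eqF ?exprn_gt0//; lra.
rewrite -e mulr0; apply/ler_addgt0Pl => s s0; rewrite addr0.
apply: (le_trans (h _ s0)).
by rewrite -osc_cube -e expr0n /= mul0r addr0.
Qed.

Lemma moment2 N x : \int[mu]_y (K (N ^ 2) (x - y) * dl u x y ^+ 2) <= 2 * osc N x ^+ 2.
Proof.
have h (s : R) : 0 < s ->
    \int[mu]_y (K (N ^ 2) (x - y) * dl u x y ^+ 2) <= s ^+ 2 + alpha N u x / s.
  move=> s0.
  apply: (@le_trans _ _ (\int[mu]_y (s ^+ 2 * K (N ^ 2) (x - y) +
      s^-1 * (K (N ^ 2) (x - y) * dl u x y ^+ 3)))).
    apply: Rint_le.
    - exact: (intg_tp_dl (KT (N ^ 2)) x (isT : 2 <= 3)%N).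
    - by apply: intgD; apply: intgZ; [exact: intg_tp_sub | exact: intg_tp_dl].
    - move=> y; have := ler_wpM2l (K_ge0 (N ^ 2) (x - y)) (young2 (dl_ge0 u x y) s0).
      by move=> /le_trans; apply; rewrite le_eqVlt; apply/orP; left; apply/eqP; ring.
  rewrite RintD; [|apply: intgZ; exact: intg_tp_sub|apply: intgZ; exact: intg_tp_dl].
  rewrite !RintZ ?Rint_K_sub ?mulr1; [|exact: intg_tp_dl|exact: intg_tp_sub].
  by rewrite mulrC.
have := osc_ge0 N x; rewrite le_eqVlt => /predU1P[e|s0]; last first.
  apply: (le_trans (h _ s0)); rewrite -osc_cube (exprSr _ 2) mulfK ?gt_eqF//; lra.
rewrite -e expr0n /= mulr0; apply/ler_addgt0Pl => s s0; rewrite addr0.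
have r0 : 0 < Num.sqrt s by rewrite sqrtr_gt0.
apply: (le_trans (h _ r0)).
by rewrite -osc_cube -e expr0n /= mul0r addr0 sqr_sqrtr// ltW.
Qed.

(** Since a derivative of the kernel has zero mean, only increments of the
    field enter. *)
Lemma kernel_moment l N (M : R) x i : 0 <= M ->
  (forall z, `|tp l z| <= M * K (N ^ 2) z) ->
  `|\int[mu]_y (tp l (x - y) * (u i y - u i x))| <= 2 * M * osc N x.
Proof.
move=> M0 hM.
apply: (@le_trans _ _ (\int[mu]_y (M * (K (N ^ 2) (x - y) * dl u x y)))).
  apply: Rint_norm_le.
  - apply: (intg_bndl (measurable_tp_subr l x) (fun y => tp_le l (x - y))).
    by apply: intgB; [exact: intg_u|exact: (intg_cst mu)].
  - apply: intgZ.
    by apply: intg_eq (intg_tp_dl (KT (N ^ 2)) x (isT : 1 <= 3)%N) => y; rewrite expr1.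
  - by move=> y; rewrite normrM mulrA ler_pM// distrC du_le_dl.
rewrite RintZ; last first.
  by apply: intg_eq (intg_tp_dl (KT (N ^ 2)) x (isT : 1 <= 3)%N) => y; rewrite expr1.
by rewrite (mulrC 2) -mulrA ler_wpM2l// moment1.
Qed.

Lemma kernel_moment2 l N (M : R) x i j : 0 <= M ->
  (forall z, `|tp l z| <= M * K (N ^ 2) z) ->
  `|\int[mu]_y (tp l (x - y) * ((u i y - u i x) * (u j y - u j x)))| <= 2 * M * osc N x ^+ 2.
Proof.
move=> M0 hM.
have ii : intg mu (fun y => (u i y - u i x) * (u j y - u j x)).
  apply: (intg_eq (f := fun y : V => u i y * u j y - u j x * u i y - u i x * u j y + u i x * u j x)).
    by move=> y; ring.
  apply: intgD; last exact: (intg_cst mu).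
  apply: intgB; last by apply: intgZ; exact: intg_u.
  by apply: intgB; [exact: intg_uu | apply: intgZ; exact: intg_u].
apply: (@le_trans _ _ (\int[mu]_y (M * (K (N ^ 2) (x - y) * dl u x y ^+ 2)))).
  apply: Rint_norm_le.
  - exact: (intg_bndl (measurable_tp_subr l x) (fun y => tp_le l (x - y))).
  - by apply: intgZ; exact: (intg_tp_dl (KT (N ^ 2)) x (isT : 2 <= 3)%N).
  - move=> y; rewrite normrM mulrA ler_pM// normrM expr2.
    by rewrite ler_pM// distrC du_le_dl.
rewrite RintZ; last exact: (intg_tp_dl (KT (N ^ 2)) x (isT : 2 <= 3)%N).
by rewrite (mulrC 2) -mulrA ler_wpM2l// moment2.
Qed.

(** ** The mollified field *)

Definition mT N i := convT (KT (2 * N ^ 2)) (u i).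

Lemma tp_mT N i x : tp (mT N i) x = \int[mu]_y (K (2 * N ^ 2) (x - y) * u i y).
Proof. by rewrite tp_conv//; exact: intg_u. Qed.

Lemma CK_ge0 : 0 <= CK :> R.
Proof. rewrite CKE; exact: mulr_ge0 (ler0n _ 8) (exprn_ge0 3 (ler0n _ 320)). Qed.

Lemma mT_center l x i (c : R) : \int[mu]_y tp l y = c ->
  \int[mu]_y (tp l (x - y) * u i y) - c * u i x =
  \int[mu]_y (tp l (x - y) * (u i y - u i x)).
Proof.
move=> hc.
have i1 : intg mu (fun y => tp l (x - y) * u i y).
  by apply: (intg_bndl (measurable_tp_subr l x) (fun y => tp_le l (x - y))); exact: intg_u.
rewrite -hc -(Rint_refl l x) -RintZr; last exact: intg_tp_sub.
rewrite -RintB//; last by apply: intgZr; exact: intg_tp_sub.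
by apply: Rint_ext => y; ring.
Qed.

(** The kernel has mean one, so the error is an average of increments. *)
Lemma mT_near N i x : (0 < N)%N -> `|tp (mT N i) x - u i x| <= 2 * CK * osc N x.
Proof.
move=> N0; rewrite tp_mT -[u i x]mul1r.
rewrite (mT_center (l := KT (2 * N ^ 2)) _ _ (Rint_K _)).
apply: kernel_moment => [|z]; first exact: CK_ge0.
by rewrite ger0_norm ?K_ge0// K_le.
Qed.

(** The derivative of the kernel has mean zero, so again only increments are
    averaged; the same holds for [mT_dd]. *)
Lemma mT_d N i j x : (0 < N)%N ->
  `|tp (dT j (mT N i)) x| <= 2 * CK * N%:R * osc N x.
Proof.
move=> N0; rewrite /mT dT_conv tp_conv; last exact: intg_u.
have := mT_center x i (Rint_dT j (KT (2 * N ^ 2))); rewrite mul0r subr0 => ->.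
rewrite -(mulrA 2).
apply: kernel_moment => [|z]; first by rewrite mulr_ge0// CK_ge0.
exact: dK_le.
Qed.

Lemma mT_dd N i j k x : (0 < N)%N ->
  `|tp (dT k (dT j (mT N i))) x| <= 2 * CK * N%:R ^+ 2 * osc N x.
Proof.
move=> N0; rewrite /mT !dT_conv tp_conv; last exact: intg_u.
have := mT_center x i (Rint_dT k (dT j (KT (2 * N ^ 2)))); rewrite mul0r subr0 => ->.
rewrite -(mulrA 2).
apply: kernel_moment => [|z]; first by rewrite mulr_ge0// CK_ge0.
exact: ddK_le.
Qed.

(** The commutator of mollification and multiplication is quadratic in the
    increments. *)
Definition stress N i j x : R :=
  \int[mu]_y (K (2 * N ^ 2) (x - y) * (u i y * u j y)) - tp (mT N i) x * tp (mT N j) x.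

Definition CR : R := 2 * CK + (2 * CK) ^+ 2.

(** The commutator equals the average of the products of increments minus
    the product of their averages (Constantin, E and Titi). *)
Lemma stress_le N i j x : (0 < N)%N -> `|stress N i j x| <= CR * osc N x ^+ 2.
Proof.
move=> N0; set n := (2 * N ^ 2)%N.
have iK (g : V -> R) : intg mu g -> intg mu (fun y => K n (x - y) * g y).
  exact: (intg_bndl (measurable_tp_subr (KT n) x) (fun y => tp_le (KT n) (x - y))).
have e : \int[mu]_y (K n (x - y) * ((u i y - u i x) * (u j y - u j x))) =
   \int[mu]_y (K n (x - y) * (u i y * u j y)) - u j x * tp (mT N i) x
     - u i x * tp (mT N j) x + u i x * u j x.
  rewrite (Rint_ext _ (g := fun y : V => K n (x - y) * (u i y * u j y) -
     u j x * (K n (x - y) * u i y) - u i x * (K n (x - y) * u j y) +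
     u i x * u j x * K n (x - y))); last by move=> y; ring.
  have h1 := iK _ (intg_uu i j); have h2 := iK _ (intg_u i); have h3 := iK _ (intg_u j).
  have h4 : intg mu (fun y => K n (x - y)) by exact: intg_tp_sub.
  rewrite RintD; [|do ?apply: intgB|]; [|exact: h1|by apply: intgZ|by apply: intgZ|by apply: intgZ].
  rewrite RintB; [|apply: intgB|]; [|exact: h1|by apply: intgZ|by apply: intgZ].
  rewrite RintB; [|exact: h1|by apply: intgZ].
  by rewrite !RintZ// Rint_K_sub !tp_mT mulr1.
have -> : stress N i j x = \int[mu]_y (K n (x - y) * ((u i y - u i x) * (u j y - u j x))) -
   (tp (mT N i) x - u i x) * (tp (mT N j) x - u j x) by rewrite e /stress; ring.
apply: (le_trans (ler_normB _ _)); have -> : CR * osc N x ^+ 2 = 2 * CK * osc N x ^+ 2 + (2 * CK) ^+ 2 * osc N x ^+ 2.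
  by rewrite -mulrDl.
apply: lerD.
  apply: kernel_moment2 => [|z]; first exact: CK_ge0.
  by rewrite ger0_norm ?K_ge0// K_le.
rewrite normrM -exprMn expr2; apply: ler_pM => //; exact: mT_near.
Qed.

End Tame.

(** ** Integrated bounds *)

Section RoughBounds.
Variables (theta A : R) (u : 'I_3 -> V -> R).
Hypothesis ru : rough theta A u.
Let tu := rough_tame ru.

Lemma Rint_osc3 N : (0 < N)%N ->
  \int[mu]_x (osc u N x ^+ 3) <= A * (N%:R `^ (theta * 3))^-1.
Proof.
move=> N0; rewrite [leLHS](_ : _ = \int[mu]_x alpha N u x); first exact: rough_gag ru _ N0.
by apply: Rint_ext => x; exact: osc_cube.
Qed.

(** Jensen's inequality, through [young2] with the constant s = N ^ (-
    theta). *)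
Lemma Rint_osc2 N : (0 < N)%N ->
  \int[mu]_x (osc u N x ^+ 2) <= (1 + A) * (N%:R `^ (theta * 2))^-1.
Proof.
move=> N0; have N0' : 0 < N%:R :> R by rewrite ltr0n.
set s := (N%:R `^ theta)^-1.
have s0 : 0 < s by rewrite invr_gt0 powR_gt0.
apply: (@le_trans _ _ (\int[mu]_x (s ^+ 2 + s^-1 * osc u N x ^+ 3))).
  apply: Rint_le.
  - exact: (intg_osc tu N (isT : 2 <= 3)%N).
  - apply: intgD; first exact: (intg_cst mu).
    by apply: intgZ; exact: (intg_osc tu N (isT : 3 <= 3)%N).
  - by move=> x; rewrite (mulrC s^-1); apply: young2 => //; exact: osc_ge0.
have i3 := intg_osc tu N (isT : 3 <= 3)%N.
rewrite RintD; [|exact: (intg_cst mu)|exact: intgZ].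
rewrite (RintZ s^-1 i3).
have -> : \int[mu]_x (s ^+ 2) = s ^+ 2 by exact: torus_integral_cst.
have e2 : (N%:R `^ (theta * 2))^-1 = s ^+ 2.
  by rewrite powRrM powR_mulrn ?powR_ge0// exprVn.
have e3 : (N%:R `^ (theta * 3))^-1 = s ^+ 3.
  by rewrite powRrM powR_mulrn ?powR_ge0// exprVn.
have := Rint_osc3 N0; rewrite e2 e3 => h.
rewrite mulrDl mul1r lerD2l.
have := ler_wpM2l (ltW (_ : 0 < s^-1)) h; rewrite invr_gt0 => /(_ s0) /le_trans; apply.
by rewrite mulrCA exprS mulKf// gt_eqF.
Qed.

End RoughBounds.
End Rough.

(** * The Gagliardo seminorm controls the averaged increments *)

Section GagliardoRough.
Context {R : realType}.
Local Notation V := (measurableTypeR R * measurableTypeR R * measurableTypeR R)%type.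
Local Notation mu := (@tmu R).

Definition comp (f : vec R -> vec R) (i : 'I_3) : V -> R := fun x => vcoord (f x) i.

Lemma sum3_norm (v : vec R) : \sum_i `|vcoord v i| <= 3 * enorm v.
Proof.
apply: (@le_trans _ _ (\sum_(i < 3) enorm v)).
  by apply: ler_sum => i _; exact: vcoord_le_enorm.
by rewrite sumr_const card_ord mulr_natl.
Qed.

Lemma vcoordB (v w : vec R) i : vcoord (v - w) i = vcoord v i - vcoord w i.
Proof. by case: i => [[|[|[|//]]] hi]. Qed.

Lemma env_comp_le f x : env (comp f) x <= 3 * enorm (f x).
Proof. exact: sum3_norm. Qed.

Lemma dl_comp_le f x y : dl (comp f) x y <= 3 * enorm (f x - f y).
Proof.
apply: le_trans (sum3_norm _); apply: ler_sum => i _.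
by rewrite vcoordB.
Qed.

Lemma gagliardo_pointwise f (theta : R) N x y : torus_periodic f ->
  (0 < N)%N -> 0 < theta < 1 ->
  K (N ^ 2) (x - y) * dl (comp f) x y ^+ 3 <=
  27 * CD * (N%:R `^ (theta * 3))^-1 *
    (enorm (f x - f y) `^ 3 / torus_dist x y `^ (theta * 3 + 3)).
Proof.
move=> pf N0 th.
have e0 := enorm_ge0 (f x - f y).
rewrite powR_mulrn//.
have d3 : dl (comp f) x y ^+ 3 <= 27 * enorm (f x - f y) ^+ 3.
  have -> : 27 * enorm (f x - f y) ^+ 3 = (3 * enorm (f x - f y)) ^+ 3 by ring.
  by rewrite lerXn2r ?nnegrE ?dl_ge0 ?mulr_ge0// dl_comp_le.
have k0 := K_ge0 (N ^ 2) (x - y).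
apply: (le_trans (ler_wpM2l k0 d3)).
have [z|z] := eqVneq (torus_dist x y) 0.
  have -> : f x = f y by rewrite -(subrK y x) addrC pf//; exact: torus_dist_eq0.
  rewrite subrr (_ : enorm 0 = 0); first by rewrite expr0n /= mulr0 mulr0 mul0r mulr0.
  by apply/eqP; rewrite -sqrf_eq0 enorm_sqr /= expr0n /= !addr0.
have dp : 0 < torus_dist x y `^ (theta * 3 + 3).
  by apply: powR_gt0; rewrite lt_def z torus_dist_ge0.
have h := K_decay x y N0 th.
rewrite mulrA ler_pdivlMr//.
have -> : K (N ^ 2) (x - y) * (27 * enorm (f x - f y) ^+ 3) * torus_dist x y `^ (theta * 3 + 3) =
  27 * enorm (f x - f y) ^+ 3 * (K (N ^ 2) (x - y) * torus_dist x y `^ (theta * 3 + 3)) by ring.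
have -> : 27 * CD * (N%:R `^ (theta * 3))^-1 * enorm (f x - f y) ^+ 3 =
  27 * enorm (f x - f y) ^+ 3 * (CD * (N%:R `^ (theta * 3))^-1) by ring.
by apply: ler_wpM2l => //; rewrite mulr_ge0// exprn_ge0.
Qed.

Lemma CD_gt0 : 0 < CD :> R. Proof. by rewrite /CD -lock ltr0n. Qed.

(** Integrate [gagliardo_pointwise]: the kernel is below the weight of the
    seminorm. *)
Lemma gagliardo_rough f (theta A : R) : torus_periodic f -> 0 < theta < 1 ->
  tame (comp f) -> (gagliardo theta 3 f <= A%:E)%E ->
  rough theta (27 * CD * A) (comp f).
Proof.
move=> pf th tf gA; split => // N N0.
set u := comp f.
set c := 27 * CD * (N%:R `^ (theta * 3))^-1.
have N0' : 0 < N%:R :> R by rewrite ltr0n.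
have c0 : 0 < c.
  apply: mulr_gt0; first exact: (mulr_gt0 (ltr0n R 27) CD_gt0).
  by rewrite invr_gt0 powR_gt0.
have F0 x y : 0 <= K (N ^ 2) (x - y) * dl u x y ^+ 3.
  by rewrite mulr_ge0 ?K_ge0// exprn_ge0// dl_ge0.
have i3 x := intg_tp_dl tf (KT (N ^ 2)) x (isT : 3 <= 3)%N.
have ia := intg_alpha tf N.
have h : (\int[mu]_x (c^-1 * alpha N u x)%:E <= A%:E)%E.
  apply: le_trans gA; rewrite /gagliardo torus_measureE.
  apply: ge0_integral_mono => x.
    by rewrite lee_fin mulr_ge0 ?alpha_ge0// invr_ge0 ltW.
  rewrite -RintZ//; last exact: i3.
  rewrite EFin_Rint; last by apply: intgZ; exact: i3.
  apply: ge0_integral_mono => y.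
    by rewrite lee_fin mulr_ge0// invr_ge0 ltW.
  by rewrite lee_fin mulrC ler_pdivrMr// [leRHS]mulrC; exact: gagliardo_pointwise.
move: h; rewrite -EFin_Rint; last exact: intgZ.
rewrite RintZ// lee_fin mulrC ler_pdivrMr// => /le_trans; apply.
by rewrite /c le_eqVlt; apply/orP; left; apply/eqP; ring.
Qed.

End GagliardoRough.

(** * Vector fields of trigonometric polynomials *)

Opaque KT alpha osc mT.

Section VectorTrig.
Context {R : realType}.
Local Notation V := (measurableTypeR R * measurableTypeR R * measurableTypeR R)%type.
Local Notation mu := (@tmu R).
Implicit Types (l m : seq (R * freq * R)) (x y : vec R) (i j : 'I_3).
Implicit Types (w v : 'I_3 -> seq (R * freq * R)).

Lemma sum3 (F : 'I_3 -> R) : \sum_i F i = F o0 + F o1 + F o2.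
Proof.
rewrite !big_ord_recl big_ord0 addr0 addrA; congr (F _ + F _ + F _); exact: val_inj.
Qed.

Lemma o0p1 : o0 + 1 = o1. Proof. exact: val_inj. Qed.
Lemma o1p1 : o1 + 1 = o2. Proof. exact: val_inj. Qed.
Lemma o2p1 : o2 + 1 = o0. Proof. exact: val_inj. Qed.
Lemma o0p2 : o0 + 2%:R = o2. Proof. exact: val_inj. Qed.
Lemma o1p2 : o1 + 2%:R = o0. Proof. exact: val_inj. Qed.
Lemma o2p2 : o2 + 2%:R = o1. Proof. exact: val_inj. Qed.
Definition oE := (o0p1, o1p1, o2p1, o0p2, o1p2, o2p2).

Lemma I3P i : [\/ i = o0, i = o1 | i = o2].
Proof.
case: i => [[|[|[|//]]] hi]; [apply: Or31|apply: Or32|apply: Or33]; exact: val_inj.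
Qed.

Definition curlT w i : seq (R * freq * R) :=
  dT (i + 1) (w (i + 2%:R)) ++ scaleT (-1) (dT (i + 2%:R) (w (i + 1))).

Lemma tp_curlT w i x :
  tp (curlT w i) x = tp (dT (i + 1) (w (i + 2%:R))) x - tp (dT (i + 2%:R) (w (i + 1))) x.
Proof. by rewrite tp_cat tp_scale mulN1r. Qed.

Lemma tp_dT_curlT j w i x : tp (dT j (curlT w i)) x =
  tp (dT j (dT (i + 1) (w (i + 2%:R)))) x - tp (dT j (dT (i + 2%:R) (w (i + 1)))) x.
Proof. by rewrite dT_cat tp_cat dT_scale tp_scale mulN1r. Qed.

Lemma Rint_curlM w l i :
  \int[mu]_x (tp (curlT w i) x * tp l x) =
  \int[mu]_x (tp (dT (i + 1) (w (i + 2%:R))) x * tp l x) -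
  \int[mu]_x (tp (dT (i + 2%:R) (w (i + 1))) x * tp l x).
Proof.
rewrite -RintB; [|exact: intg_tp2..].
by apply: Rint_ext => x; rewrite tp_curlT mulrBl.
Qed.

Lemma pairC l m : \int[mu]_x (tp l x * tp m x) = \int[mu]_x (tp m x * tp l x).
Proof. by apply: Rint_ext => x; rewrite mulrC. Qed.

(** Integrate each of the six terms by parts; the signs of the curl
    compensate those of the integrations. *)
Lemma curl_sym w v :
  \sum_i \int[mu]_x (tp (curlT w i) x * tp (v i) x) =
  \sum_i \int[mu]_x (tp (w i) x * tp (curlT v i) x).
Proof.
rewrite !sum3 ![\int[mu]_x (tp (w _) x * tp (curlT _ _) x)]pairC !Rint_curlM !oE.
rewrite (tp_by_parts o1 (v o2)) (tp_by_parts o2 (v o1)) (tp_by_parts o2 (v o0)).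
rewrite (tp_by_parts o0 (v o2)) (tp_by_parts o0 (v o1)) (tp_by_parts o1 (v o0)).
rewrite (pairC (v o2) (dT o1 (w o0))) (pairC (v o1) (dT o2 (w o0))).
rewrite (pairC (v o0) (dT o2 (w o1))) (pairC (v o2) (dT o0 (w o1))).
rewrite (pairC (v o1) (dT o0 (w o2))) (pairC (v o0) (dT o1 (w o2))).
ring.
Qed.

(** The cancellation behind helicity conservation: for a solenoidal field the
    convective term is the gradient of a pressure head plus the Lamb vector
    curl w x w, and both are orthogonal to curl w. *)
Lemma helicity_cancel w : (forall x, \sum_i tp (dT i (w i)) x = 0) ->
  \int[mu]_x (\sum_i \sum_j tp (dT j (curlT w i)) x * (tp (w i) x * tp (w j) x)) = 0.
Proof.
move=> div0.
(* The integrand is the divergence of F + G, where E is half the square of w: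
   F collects curl w . w w_j, and G subtracts E curl w. *)
pose F := flatten [seq flatten [seq dT j (mulT (curlT w i) (mulT (w i) (w j)))
  | j <- [:: o0; o1; o2]] | i <- [:: o0; o1; o2]].
pose E := mulT (scaleT (1 / 2) oneT) (mulT (w o0) (w o0) ++ mulT (w o1) (w o1) ++ mulT (w o2) (w o2)).
pose G := flatten [seq scaleT (-1) (dT i (mulT (curlT w i) E)) | i <- [:: o0; o1; o2]].
have iFG : \int[mu]_x tp (F ++ G) x = 0.
  have d0 l i c : \int[mu]_x tp (scaleT c (dT i l)) x = 0.
    by rewrite -dT_scale Rint_dT.
  have dd l m : \int[mu]_x tp (l ++ m) x = \int[mu]_x tp l x + \int[mu]_x tp m x.
    by rewrite -RintD; [apply: Rint_ext => x; rewrite tp_cat | exact: intg_tp..].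
  have d1 : \int[mu]_x tp [::] x = 0.
    by rewrite -[RHS](Rint_0 mu); apply: Rint_ext => x; rewrite tp_nil.
  by rewrite /F /G /= !dd !Rint_dT !d0 d1 !addr0.
rewrite -[RHS]iFG; apply: Rint_ext => x.
have hE : tp E x = (tp (w o0) x ^+ 2 + tp (w o1) x ^+ 2 + tp (w o2) x ^+ 2) / 2.
  by rewrite /E tp_mul tp_scale tp_oneT !tp_cat !tp_mul; field.
have hdE i : tp (dT i E) x = tp (w o0) x * tp (dT i (w o0)) x +
    tp (w o1) x * tp (dT i (w o1)) x + tp (w o2) x * tp (dT i (w o2)) x.
  rewrite /E tp_dT_mul dT_scale !tp_scale tp_oneT !dT_cat !tp_cat !tp_dT_mul.
  by rewrite (tp_dT_free x (i := i) (l := oneT)) ?/freeT /= ?fcoord0//; field.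
clearbody E.
have := div0 x; rewrite sum3 => dv.
rewrite /F /G /= !tp_cat !tp_nil !tp_scale !tp_dT_mul !hdE !tp_mul hE.
rewrite !sum3 !tp_curlT !tp_dT_curlT !oE.
rewrite !(dTC o2 o0) !(dTC o2 o1) !(dTC o1 o0).
have e2 : tp (dT o2 (w o2)) x = - tp (dT o0 (w o0)) x - tp (dT o1 (w o1)) x by lra.
by rewrite e2; field.
Qed.

(** ** Multipliers as quadratic forms *)

(** The symbol of minus the Laplacian. *)
Definition wsqr (k : freq) : R := \sum_i wave k i ^+ 2.

Lemma wsqr_ge0 k : 0 <= wsqr k.
Proof. by apply: sumr_ge0 => i _; exact: sqr_ge0. Qed.

Lemma wsqrN k : wsqr (- k) = wsqr k.
Proof. by apply: eq_bigr => i _; rewrite waveN sqrrN. Qed.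

Definition Qf (t : freq -> R) l := \int[mu]_x (tp l x * tp (multT t l) x).

Lemma Qf_sqr (s : freq -> R) l : (forall k, s (- k) = s k) ->
  \int[mu]_x (tp (multT s l) x * tp (multT s l) x) = Qf (fun k => s k * s k) l.
Proof.
move=> se; rewrite (pairing_multT l (multT s l) se) /Qf.
by apply: Rint_ext => x; rewrite multT_comp.
Qed.

Lemma Qf_ge0 (t : freq -> R) l : (forall k, t (- k) = t k) -> (forall k, 0 <= t k) ->
  0 <= Qf t l.
Proof.
move=> te t0.
have -> : t = fun k => Num.sqrt (t k) * Num.sqrt (t k).
  by apply/funext => k; rewrite -expr2 sqr_sqrtr.
rewrite -Qf_sqr => [|k]; last by rewrite te.
by apply: Rint_ge0 => x; rewrite -expr2 sqr_ge0.
Qed.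

Lemma tp_multTB (s t : freq -> R) l x :
  tp (multT (fun k => t k - s k) l) x = tp (multT t l) x - tp (multT s l) x.
Proof.
rewrite /tp /multT !big_map -sumrB; apply: eq_bigr => r _.
by rewrite /= -mulrBl; congr (_ * _); ring.
Qed.

(** A nonnegative multiplier has a real square root, which makes its form a
    squared norm. *)
Lemma Qf_le (s t : freq -> R) l :
  (forall k, s (- k) = s k) -> (forall k, t (- k) = t k) ->
  (forall k, s k <= t k) -> Qf s l <= Qf t l.
Proof.
move=> se te st; rewrite -subr_ge0 /Qf -RintB; [|exact: intg_tp2..].
have := @Qf_ge0 (fun k => t k - s k) l _ _.
rewrite {1}/Qf => /(_ _ _)/le_trans; apply => //.
- by move=> k; rewrite se te.
- by move=> k; rewrite subr_ge0.
- rewrite le_eqVlt; apply/orP; left; apply/eqP; apply: Rint_ext => x.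
  by rewrite tp_multTB mulrBr.
Qed.

Lemma tp_laplace l x : tp (multT wsqr l) x = - \sum_i tp (dT i (dT i l)) x.
Proof.
rewrite -sumrN.
have h i : - tp (dT i (dT i l)) x = tp (multT (fun k => wave k i ^+ 2) l) x.
  rewrite /tp /multT !big_map -sumrN; apply: eq_bigr => t _ /=.
  rewrite /chr -[X in cos (_ + X)]addrA -splitr addrA cosDpi; ring.
rewrite (eq_bigr _ (fun i _ => h i)) /tp /multT big_map.
under [in RHS]eq_bigr do rewrite big_map.
rewrite exchange_big /=; apply: eq_bigr => t _.
by rewrite -mulr_suml -mulr_suml.
Qed.

Lemma dT_mult_sqr i l x : tp (dT i (dT i l)) x = - tp (multT (fun k => wave k i ^+ 2) l) x.
Proof.
rewrite /tp /multT !big_map -sumrN; apply: eq_bigr => t _ /=.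
rewrite /chr -[X in cos (_ + X)]addrA -splitr addrA cosDpi; ring.
Qed.

Lemma Qf_grad l : Qf wsqr l = \sum_i \int[mu]_x (tp (dT i l) x * tp (dT i l) x).
Proof.
rewrite /Qf (Rint_ext _ (g := fun x : V => \sum_i - (tp l x * tp (dT i (dT i l)) x))); last first.
  by move=> x; rewrite tp_laplace mulrN mulr_sumr sumrN.
rewrite Rint_sum => [|i]; last by apply: intgN; exact: intg_tp2.
apply: eq_bigr => i _; rewrite RintN; last exact: intg_tp2.
by rewrite tp_by_parts.
Qed.

Definition wpow (s : R) (k : freq) : R := wsqr k `^ s.

Lemma wpowN s k : wpow s (- k) = wpow s k.
Proof. by rewrite /wpow wsqrN. Qed.

Lemma wpowD s t k : s + t != 0 -> wpow s k * wpow t k = wpow (s + t) k.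
Proof. by move=> h; rewrite /wpow powRD// (negbTE h). Qed.

Lemma wpow1 k : wpow 1 k = wsqr k.
Proof. by rewrite /wpow powRr1 ?wsqr_ge0. Qed.

Lemma wave_sqr_le k i : wave k i ^+ 2 <= wsqr k.
Proof. by rewrite /wsqr (bigD1 i)//= lerDl sumr_ge0// => j _; exact: sqr_ge0. Qed.

Lemma Qf_ext (s t : freq -> R) l : s =1 t -> Qf s l = Qf t l.
Proof. by move=> /funext ->. Qed.

(** The half derivative interpolates between the function and its gradient. *)
Lemma Qf_half (e : R) l : 0 < e ->
  Qf (wpow (1 / 2)) l <= (e * \int[mu]_x (tp l x * tp l x) +
    e^-1 * \sum_i \int[mu]_x (tp (dT i l) x * tp (dT i l) x)) / 2.
Proof.
move=> e0; have se k : wpow (1 / 2) (- k) = wpow (1 / 2) k by exact: wpowN.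
have := Qf_sqr l se; rewrite (@Qf_ext _ wsqr) => [|k]; last first.
  by rewrite wpowD; [rewrite (_ : 1 / 2 + 1 / 2 = 1) ?wpow1//; lra | apply/eqP; lra].
rewrite Qf_grad => <-.
have i1 := intg_tp2 l l; have i2 := intg_tp2 (multT (wpow (1 / 2)) l) (multT (wpow (1 / 2)) l).
rewrite -[X in _ <= (X + _) / 2]RintZ// -[X in _ <= (_ + X) / 2]RintZ//.
rewrite -RintD; [|exact: intgZ..].
rewrite -RintZr; last by apply: intgD; exact: intgZ.
apply: Rint_le; first exact: intg_tp2.
  by apply: intgZr; apply: intgD; exact: intgZ.
move=> x; set a := tp l x; set b := tp _ x.
rewrite -subr_ge0 -(pmulr_rge0 _ e0).
have -> : e * ((e * (a * a) + e^-1 * (b * b)) / 2 - a * b) = (e * a - b) ^+ 2 / 2.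
  by field; rewrite gt_eqF.
by rewrite mulr_ge0 ?sqr_ge0.
Qed.

Lemma norm_mult_quarter l :
  \int[mu]_x (tp (multT (wpow (1 / 4)) l) x * tp (multT (wpow (1 / 4)) l) x) =
  Qf (wpow (1 / 2)) l.
Proof.
rewrite Qf_sqr; last by move=> k; exact: wpowN.
apply: Qf_ext => k; rewrite wpowD; last by apply/eqP; lra.
by congr wpow; lra.
Qed.

(** One derivative gains the factor |k| that the negative power loses. *)
Lemma norm_mult_quarterN i l :
  \int[mu]_x (tp (multT (wpow (- (1 / 4))) (dT i l)) x *
              tp (multT (wpow (- (1 / 4))) (dT i l)) x) <= Qf (wpow (1 / 2)) l.
Proof.
have se s k : wpow s (- k) = wpow s k by exact: wpowN.
rewrite Qf_sqr//.
rewrite (@Qf_ext _ (wpow (- (1 / 2)))) => [|k]; last first.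
  rewrite wpowD; last by apply/eqP; lra.
  by congr wpow; lra.
rewrite {1}/Qf multT_dT tp_by_parts -RintN; last exact: intg_tp2.
apply: le_trans (Qf_le (s := fun k => wave k i ^+ 2 * wpow (- (1 / 2)) k) l _ _ _).
- rewrite le_eqVlt; apply/orP; left; apply/eqP; apply: Rint_ext => x.
  by rewrite dT_mult_sqr mulrN opprK multT_comp.
- by move=> k; rewrite waveN sqrrN se.
- by move=> k; rewrite se.
- move=> k; apply: (@le_trans _ _ (wsqr k * wpow (- (1 / 2)) k)).
    by rewrite ler_wpM2r ?powR_ge0// wave_sqr_le.
  rewrite -wpow1 wpowD; last by apply/eqP; lra.
  by rewrite le_eqVlt; apply/orP; left; apply/eqP; congr wpow; lra.
Qed.

Lemma wsqr_eq0_wave k i : wsqr k = 0 -> wave k i = 0 :> R.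
Proof.
move=> h; apply/eqP; rewrite -sqrf_eq0 eq_le sqr_ge0 andbT -h; exact: wave_sqr_le.
Qed.

(** The two opposite powers of the Laplacian cancel on derivatives, which have
    no zero mode. *)
Lemma quarter_cancel i l x :
  tp (multT (fun k => wpow (1 / 4) k * wpow (- (1 / 4)) k) (dT i l)) x = tp (dT i l) x.
Proof.
rewrite multT_dT /dT /multT /tp !big_map; apply: eq_bigr => t _ /=; congr (_ * _).
have [z|z] := eqVneq (wsqr t.1.2) 0; first by rewrite (wsqr_eq0_wave i z) !mulr0.
rewrite /wpow -powRD; last by rewrite z implybT.
by rewrite subrr powRr0 mul1r.
Qed.

(** ** The flux of helicity through a scale *)

Lemma four_sum (a b c d p q r : R) : d + c <= 4 * p * q * r -> b + a <= 4 * p * q * r ->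
  d + b + (c + a) <= 8 * p * q * r.
Proof. lra. Qed.

Lemma three_sum (a b c p q r : R) : a <= 16 * p * q * r -> b <= 16 * p * q * r ->
  c <= 16 * p * q * r -> a + b + c <= 48 * p * q * r.
Proof. lra. Qed.

Lemma two_scale_sum (p r c n a b : R) : p <= 2 * c * (2 * n) * b -> r <= 2 * c * n * a ->
  0 <= c * n * a -> p + r <= 4 * c * n * (b + a).
Proof. nra. Qed.

Lemma osum_lin (a b c r s : R) : a <= s * c -> b <= s * r -> s * c <= s * r ->
  2 * a + 2 * b <= 4 * s * r.
Proof. lra. Qed.

Section Helicity.
Variables (theta A : R) (u : 'I_3 -> V -> R).
Hypothesis theta01 : 0 < theta < 1.
Hypothesis ru : rough theta A u.
Let tu := rough_tame ru.

(** The rate at which the quadratic term u (x) u changes the pairing of u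
    with the field psi. *)
Definition flux (psi : 'I_3 -> seq (R * freq * R)) : R :=
  \sum_i \sum_j \int[mu]_x (u i x * u j x * tp (dT j (psi i)) x).

Lemma conv_adjoint n l (g : V -> R) : intg mu g ->
  \int[mu]_y (g y * tp (convT (KT n) (tp l)) y) =
  \int[mu]_x (tp l x * \int[mu]_y (K n (x - y) * g y)).
Proof.
move=> ig.
have iF : intg (mu \x mu)%E (fun z : V * V => K n (z.1 - z.2) * (tp l z.1 * g z.2)).
  apply: (intg_bndl (measurable_tp_sub (KT n)) (fun z : V * V => tp_le (KT n) (z.1 - z.2))).
  exact: (intg_tensor (intg_tp l) ig).
have e1 (x : V) : tp l x * \int[mu]_y (K n (x - y) * g y) =
    \int[mu]_y (K n (x - y) * (tp l x * g y)).
  rewrite -RintZ; first by apply: Rint_ext => y; ring.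
  exact: (intg_bndl (measurable_tp_subr (KT n) x) (fun y => tp_le (KT n) (x - y))).
have e2 (y : V) : g y * tp (convT (KT n) (tp l)) y = \int[mu]_x (K n (x - y) * (tp l x * g y)).
  rewrite tp_conv; last exact: intg_tp.
  rewrite mulrC -RintZr; last first.
    apply: (intg_bndl (measurable_tp_subr (KT n) y) (fun x => tp_le (KT n) (y - x))).
    exact: intg_tp.
  by apply: Rint_ext => x; rewrite -/(K n (y - x)) K_even; ring.
apply: (etrans (Rint_ext mu e2)); apply: esym; apply: (etrans (Rint_ext mu e1)).
exact: (Rfubini iF).
Qed.

Lemma conv_dT j l m x :
  tp (dT j (convT l (tp m))) x = tp (convT l (tp (dT j m))) x.
Proof.
rewrite dT_conv !tp_conv; [|exact: intg_tp..].
transitivity (- \int[mu]_y (tp (dT j (reflT x l)) y * tp m y)).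
  rewrite dT_refl -RintN; last exact: intg_tp2.
  by apply: Rint_ext => y; rewrite tp_scale tp_refl; ring.
by rewrite tp_by_parts opprK; apply: Rint_ext => y; rewrite tp_refl.
Qed.

(** Pairing u with the mollified curl of its mollification yields the
    helicity of the mollification. *)
Definition testT N i := convT (KT (2 * N ^ 2)) (tp (curlT (mT u N) i)).

Lemma intg_stress N i j : intg mu (stress u N i j).
Proof.
have h : intg mu (fun x => \int[mu]_y (K (2 * N ^ 2) (x - y) * (u i y * u j y))).
  apply: (@intg_eq _ _ _ mu (tp (convT (KT (2 * N ^ 2)) (fun y : V => u i y * u j y))) _ _ (intg_tp _)) => x.
  by rewrite tp_conv//; exact: (intg_uu tu).
by apply: intgB => //; exact: intg_tp2.
Qed.

(** By [helicity_cancel] the flux only sees the commutator [stress]. Two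
    derivatives cost N ^ 2, and three increments are available: one from the
    second derivatives of the field, by [mT_dd], and two from the
    commutator, by [stress_le]. *)
Lemma flux_le N : (0 < N)%N ->
  (forall x, \sum_i tp (dT i (mT u N i)) x = 0) ->
  `|flux (testT N)| <= 36 * CK * CR * A * (N%:R ^+ 2 * (N%:R `^ (theta * 3))^-1).
Proof.
move=> N0 div0; pose w := mT u N.
have c0 := @CK_ge0 R.
have N0' : 0 <= N%:R :> R by [].
have hs i j : intg mu (fun x => tp (dT j (curlT w i)) x * stress u N i j x).
  by apply: intg_tpM; exact: intg_stress.
have e : flux (testT N) = \int[mu]_x (\sum_i \sum_j tp (dT j (curlT w i)) x * stress u N i j x).
  rewrite -[LHS]subr0 -[X in _ - X](helicity_cancel div0) /flux.
  rewrite Rint_sum => [|i]; last by apply: intg_sum => j; apply: intg_tpM; exact: intg_tp2.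
  rewrite [RHS]Rint_sum => [|i]; last by apply: intg_sum => j; exact: hs.
  rewrite -sumrB; apply: eq_bigr => i _.
  rewrite Rint_sum => [|j]; last by apply: intg_tpM; exact: intg_tp2.
  rewrite [RHS]Rint_sum => [|j]; last exact: hs.
  rewrite -sumrB; apply: eq_bigr => j _.
  rewrite (Rint_ext _ (g := fun x : V => u i x * u j x *
      tp (convT (KT (2 * N ^ 2)) (tp (dT j (curlT w i)))) x)); last first.
    by move=> x; rewrite conv_dT.
  rewrite (conv_adjoint _ _ (intg_uu tu i j)).
  rewrite -RintB.
  - by apply: Rint_ext => x; rewrite /stress mulrBr.
  - apply: intg_tpM.
    apply: (@intg_eq _ _ _ mu (tp (convT (KT (2 * N ^ 2)) (fun y : V => u i y * u j y))) _ _ (intg_tp _)) => x.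
    by rewrite tp_conv//; exact: (intg_uu tu).
  - by apply: intg_tpM; exact: intg_tp2.
rewrite e.
have b3 := Rint_osc3 ru N0.
have i3 := intg_osc tu N (isT : 3 <= 3)%N.
apply: (@le_trans _ _ (\int[mu]_x (36 * CK * CR * N%:R ^+ 2 * osc u N x ^+ 3))); last first.
  rewrite RintZ//.
  have h0 : 0 <= 36 * CK * CR * N%:R ^+ 2 :> R.
    have r0 : 0 <= CR :> R by rewrite /CR addr_ge0 ?sqr_ge0// mulr_ge0.
    exact: mulr_ge0 (mulr_ge0 (mulr_ge0 (ler0n _ 36) c0) r0) (exprn_ge0 _ N0').
  apply: (le_trans (ler_wpM2l h0 b3)).
  by rewrite le_eqVlt; apply/orP; left; apply/eqP; ring.
apply: Rint_norm_le.
- by apply: intg_sum => i; apply: intg_sum => j; exact: hs.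
- exact: intgZ.
- move=> x.
  have t i j : `|tp (dT j (curlT w i)) x * stress u N i j x| <=
      4 * CK * CR * N%:R ^+ 2 * osc u N x ^+ 3.
    rewrite normrM tp_dT_curlT.
    have s1 := mT_dd tu (i + 2%:R) (i + 1) j x N0.
    have s2 := mT_dd tu (i + 1) (i + 2%:R) j x N0.
    have s3 := stress_le tu i j x N0.
    have s4 : `|tp (dT j (dT (i + 1) (w (i + 2%:R)))) x - tp (dT j (dT (i + 2%:R) (w (i + 1)))) x|
        <= 4 * CK * N%:R ^+ 2 * osc u N x.
      apply: (le_trans (ler_normB _ _)).
      have -> : 4 * CK * N%:R ^+ 2 * osc u N x =
        2 * CK * N%:R ^+ 2 * osc u N x + 2 * CK * N%:R ^+ 2 * osc u N x :> R by ring.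
      exact: lerD.
    apply: (le_trans (ler_pM (normr_ge0 _) (normr_ge0 _) s4 s3)).
    by rewrite le_eqVlt; apply/orP; left; apply/eqP; ring.
  apply: (le_trans (ler_norm_sum _ _ _)).
  apply: (@le_trans _ _ (\sum_(i < 3) \sum_(j < 3) (4 * CK * CR * N%:R ^+ 2 * osc u N x ^+ 3))).
    apply: ler_sum => i _; apply: (le_trans (ler_norm_sum _ _ _)).
    by apply: ler_sum => j _; exact: t.
  rewrite !sumr_const !card_ord.
  by rewrite le_eqVlt; apply/orP; left; apply/eqP; ring.
Qed.

(** ** Comparison of consecutive scales *)

Definition diffT N i := mT u (2 * N) i ++ scaleT (-1) (mT u N i).

Lemma tp_diffT N i x : tp (diffT N i) x = tp (mT u (2 * N) i) x - tp (mT u N i) x.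
Proof. by rewrite tp_cat tp_scale mulN1r. Qed.

Lemma tp_dT_diffT j N i x : tp (dT j (diffT N i)) x =
  tp (dT j (mT u (2 * N) i)) x - tp (dT j (mT u N i)) x.
Proof. by rewrite dT_cat tp_cat dT_scale tp_scale mulN1r. Qed.

Definition osum N x := osc u (2 * N) x + osc u N x.

Lemma diffT_le N i x : (0 < N)%N -> `|tp (diffT N i) x| <= 2 * CK * osum N x.
Proof.
move=> N0; have N20 : (0 < 2 * N)%N by rewrite muln_gt0.
rewrite tp_diffT; have h1 := mT_near tu i x N20; have h2 := mT_near tu i x N0.
have -> : tp (mT u (2 * N) i) x - tp (mT u N i) x =
  (tp (mT u (2 * N) i) x - u i x) - (tp (mT u N i) x - u i x) by ring.
apply: (le_trans (ler_normB _ _)); apply: (le_trans (lerD h1 h2)).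
by rewrite -mulrDr.
Qed.

Lemma dT_2N_le N i j x : (0 < N)%N ->
  `|tp (dT j (mT u (2 * N) i)) x| + `|tp (dT j (mT u N i)) x| <= 4 * CK * N%:R * osum N x.
Proof.
move=> N0; have N20 : (0 < 2 * N)%N by rewrite muln_gt0.
have h1 := mT_d tu i j x N20; have h2 := mT_d tu i j x N0.
rewrite natrM in h1; rewrite /osum.
have c0 := @CK_ge0 R; have o1 := osc_ge0 u N x; have o2 := osc_ge0 u (2 * N) x.
have N0' : 0 <= N%:R :> R by [].
have := mulr_ge0 (mulr_ge0 c0 N0') o1.
exact: two_scale_sum h1 h2.
Qed.

Lemma diffT_d_le N i j x : (0 < N)%N ->
  `|tp (dT j (diffT N i)) x| <= 4 * CK * N%:R * osum N x.
Proof.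
move=> N0; rewrite tp_dT_diffT; apply: (le_trans (ler_normB _ _)); exact: dT_2N_le.
Qed.

Lemma intg_osum2 N : intg mu (fun x => osum N x ^+ 2).
Proof.
have i2 := intg_osc tu N (isT : 2 <= 3)%N; have i2' := intg_osc tu (2 * N) (isT : 2 <= 3)%N.
apply: (intg_le _ (intgD (intgZ 2 i2') (intgZ 2 i2))).
  by apply: measurable_funX; apply: measurable_funD; exact: (measurable_osc tu).
move=> x; rewrite ger0_norm ?sqr_ge0// /osum.
move: (osc u (2 * N) x) (osc u N x) => a b; have := sqr_ge0 (a - b); lra.
Qed.

Hypothesis A0 : 0 <= A.

Lemma Rint_osum2 N : (0 < N)%N ->
  \int[mu]_x (osum N x ^+ 2) <= 4 * (1 + A) * (N%:R `^ (theta * 2))^-1.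
Proof.
move=> N0; have N20 : (0 < 2 * N)%N by rewrite muln_gt0.
have i2 := intg_osc tu N (isT : 2 <= 3)%N; have i2' := intg_osc tu (2 * N) (isT : 2 <= 3)%N.
apply: (@le_trans _ _ (\int[mu]_x (2 * osc u (2 * N) x ^+ 2 + 2 * osc u N x ^+ 2))).
  apply: Rint_le; first exact: intg_osum2.
    exact: (intgD (intgZ 2 i2') (intgZ 2 i2)).
  move=> x; rewrite /osum.
  move: (osc u (2 * N) x) (osc u N x) => a b; have := sqr_ge0 (a - b); lra.
have e1 := RintD (intgZ 2 i2') (intgZ 2 i2).
have e2 := RintZ 2 i2'.
have e3 := RintZ 2 i2.
have e : \int[mu]_x (2 * osc u (2 * N) x ^+ 2 + 2 * osc u N x ^+ 2) =
  2 * (\int[mu]_x osc u (2 * N) x ^+ 2) + 2 * (\int[mu]_x osc u N x ^+ 2).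
  exact: etrans e1 (f_equal2 +%R e2 e3).
rewrite {}e {e1 e2 e3}.
have h1 := Rint_osc2 ru N20; have h2 := Rint_osc2 ru N0.
have N0' : 0 < N%:R :> R by rewrite ltr0n.
have h3 : ((2 * N)%:R `^ (theta * 2))^-1 <= (N%:R `^ (theta * 2))^-1 :> R.
  rewrite lef_pV2 ?posrE ?powR_gt0//; last by rewrite ltr0n.
  apply: ge0_ler_powR; rewrite ?nnegrE//; last by rewrite ler_nat leq_pmull.
  by case/andP: theta01 => /ltW t0 _; rewrite mulr_ge0.
have A1 : 0 <= 1 + A by rewrite addr_ge0.
have h4 := ler_wpM2l A1 h3.
exact: osum_lin h1 h2 h4.
Qed.

Lemma sqr_osum_bound (F : V -> R) (M : R) N : (0 < N)%N -> 0 <= M -> intg mu F ->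
  (forall x, `|F x| <= M * osum N x ^+ 2) ->
  `|\int[mu]_x F x| <= M * (4 * (1 + A) * (N%:R `^ (theta * 2))^-1).
Proof.
move=> N0 M0 iF hF.
apply: (@le_trans _ _ (\int[mu]_x (M * osum N x ^+ 2))).
  by apply: Rint_norm_le => //; apply: intgZ; exact: intg_osum2.
rewrite RintZ; last exact: intg_osum2.
by rewrite ler_wpM2l// Rint_osum2.
Qed.

(** The helicity of the field mollified at scale 1 / N. *)
Definition hel N := \sum_i \int[mu]_x (tp (mT u N i) x * tp (curlT (mT u N) i) x).

(** A bound of the mean square of the increments at the scales 1 / N and 1 /
    (2 N), by [Rint_osum2]. *)
Definition BN N : R := 4 * (1 + A) * (N%:R `^ (theta * 2))^-1.

Lemma norm_diffT N i : (0 < N)%N ->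
  \int[mu]_x (tp (diffT N i) x * tp (diffT N i) x) <= 4 * CK ^+ 2 * BN N.
Proof.
move=> N0; apply: (le_trans (ler_norm _)); apply: sqr_osum_bound => //.
- by rewrite mulr_ge0 ?sqr_ge0.
- exact: intg_tp2.
- move=> x; rewrite normrM.
  have h := diffT_le i x N0.
  apply: (le_trans (ler_pM (normr_ge0 _) (normr_ge0 _) h h)).
  by rewrite le_eqVlt; apply/orP; left; apply/eqP; ring.
Qed.

Lemma norm_diffT_d N i j : (0 < N)%N ->
  \int[mu]_x (tp (dT j (diffT N i)) x * tp (dT j (diffT N i)) x) <=
  16 * CK ^+ 2 * N%:R ^+ 2 * BN N.
Proof.
move=> N0; apply: (le_trans (ler_norm _)); apply: sqr_osum_bound => //.
- exact: mulr_ge0 (mulr_ge0 (ler0n _ 16) (sqr_ge0 _)) (sqr_ge0 _).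
- exact: intg_tp2.
- move=> x; rewrite normrM.
  have h := diffT_d_le i j x N0.
  apply: (le_trans (ler_pM (normr_ge0 _) (normr_ge0 _) h h)).
  by rewrite le_eqVlt; apply/orP; left; apply/eqP; ring.
Qed.

(** Interpolate with the weight e = N, the cost of one derivative at this
    scale. *)
Lemma Qf_half_diffT N i : (0 < N)%N ->
  Qf (wpow (1 / 2)) (diffT N i) <= 26 * CK ^+ 2 * N%:R * BN N.
Proof.
move=> N0; have N0' : 0 < N%:R :> R by rewrite ltr0n.
apply: (le_trans (Qf_half (diffT N i) N0')).
have h1 := norm_diffT i N0.
have h2 : \sum_j \int[mu]_x (tp (dT j (diffT N i)) x * tp (dT j (diffT N i)) x) <=
   3 * (16 * CK ^+ 2 * N%:R ^+ 2 * BN N).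
  rewrite sum3.
  have := norm_diffT_d i o0 N0; have := norm_diffT_d i o1 N0; have := norm_diffT_d i o2 N0.
  by move: (_ * BN N) => c; lra.
have n1 := ler_wpM2l (ltW N0') h1.
have n2 : N%:R^-1 * (\sum_j \int[mu]_x (tp (dT j (diffT N i)) x * tp (dT j (diffT N i)) x)) <=
  48 * CK ^+ 2 * N%:R * BN N.
  rewrite ler_pdivrMl//; apply: (le_trans h2).
  by rewrite le_eqVlt; apply/orP; left; apply/eqP; ring.
rewrite ler_pdivrMr//; apply: (le_trans (lerD n1 n2)).
by rewrite le_eqVlt; apply/orP; left; apply/eqP; ring.
Qed.

(** By symmetry of the curl the difference of the two quadratic forms is a
    pairing of the difference with the sum of the curls: one factor is an
    increment, the other N times an increment. *)
Lemma hel_diff N : (0 < N)%N -> `|hel (2 * N) - hel N| <= 48 * CK ^+ 2 * N%:R * BN N.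
Proof.
move=> N0; have N0' : 0 <= N%:R :> R by [].
pose w := mT u N; pose w' := mT u (2 * N).
have e : hel (2 * N) - hel N = \sum_i \int[mu]_x
    (tp (diffT N i) x * (tp (curlT w' i) x + tp (curlT w i) x)).
  have s := curl_sym w w'.
  rewrite /hel -/w -/w'.
  have -> : \sum_i \int[mu]_x (tp (diffT N i) x * (tp (curlT w' i) x + tp (curlT w i) x)) =
    \sum_i (\int[mu]_x (tp (w' i) x * tp (curlT w' i) x) - \int[mu]_x (tp (w i) x * tp (curlT w i) x)
     + (\int[mu]_x (tp (curlT w i) x * tp (w' i) x) - \int[mu]_x (tp (w i) x * tp (curlT w' i) x))).
    apply: eq_bigr => i _.
    rewrite -RintB; [|exact: intg_tp2..]; rewrite -RintB; [|exact: intg_tp2..].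
    rewrite -RintD; [|by apply: intgB; exact: intg_tp2..].
    by apply: Rint_ext => x; rewrite tp_diffT -/(w' i) -/(w i); ring.
  by rewrite big_split /= !sumrB s subrr addr0.
rewrite e {e}.
have b i : `|\int[mu]_x (tp (diffT N i) x * (tp (curlT w' i) x + tp (curlT w i) x))| <=
   16 * CK ^+ 2 * N%:R * BN N.
  apply: sqr_osum_bound => //.
  - exact: mulr_ge0 (mulr_ge0 (ler0n _ 16) (sqr_ge0 _)) (ler0n _ _).
  - by apply: intg_tpM; apply: intgD; exact: intg_tp.
  - move=> x; rewrite normrM.
    have h := diffT_le i x N0.
    have h' : `|tp (curlT w' i) x + tp (curlT w i) x| <= 8 * CK * N%:R * osum N x.
      rewrite !tp_curlT.
      have h1 := dT_2N_le (i + 2%:R) (i + 1) x N0.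
      have h2 := dT_2N_le (i + 1) (i + 2%:R) x N0.
      rewrite -/(w' _) -/(w _) in h1 h2.
      apply: (le_trans (ler_normD _ _)); apply: (le_trans (lerD (ler_normB _ _) (ler_normB _ _))).
      exact: four_sum h1 h2.
    apply: (le_trans (ler_pM (normr_ge0 _) (normr_ge0 _) h h')).
    by rewrite le_eqVlt; apply/orP; left; apply/eqP; ring.
rewrite sum3; apply: (le_trans (ler_normD _ _)); apply: (le_trans (lerD (ler_normD _ _) (lexx _))).
exact: three_sum (b o0) (b o1) (b o2).
Qed.

End Helicity.

End VectorTrig.

(** * Completeness of the trigonometric system *)

Section AlmostEverywhere.
Context d (T : measurableType d) (R : realType).
Variable mu : {measure set T -> \bar R}.
Implicit Types P Q : T -> Prop.

Lemma ae_sub P Q : (forall x, P x -> Q x) -> (\forall x \ae mu, P x) -> \forall x \ae mu, Q x.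
Proof. by move=> h; apply: filterS. Qed.

Lemma ae_and P Q : (\forall x \ae mu, P x) -> (\forall x \ae mu, Q x) ->
  \forall x \ae mu, P x /\ Q x.
Proof. by apply: filterS2. Qed.

End AlmostEverywhere.

Section Completeness.
Context {R : realType}.
Local Notation V := (measurableTypeR R * measurableTypeR R * measurableTypeR R)%type.
Local Notation mu := (@tmu R).
Implicit Types (x y : vec R) (i : 'I_3).

Lemma cos2_gap (d s : R) : 0 < d -> d <= `|s| <= 1 - d -> d ^+ 2 <= 1 - cos (pi * s) ^+ 2.
Proof.
move=> d0 /andP[h1 h2]; have [n hn] := round_int s.
rewrite -(cos2_int_period s n); apply: le_trans (sqr_le_sin_pi hn).
suff h : d <= `|s + n%:~R| by rewrite -[leRHS]real_normK ?num_real// lerXn2r// nnegrE// ltW.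
have [n0|n1|n1] := ltrgtP n 0.
- have hn1 : n%:~R <= (-1)%:~R :> R by rewrite ler_int; lia.
  rewrite [(-1)%:~R]mulrNz in hn1.
  have := ler_norm s; have := ler_norm (- (s + n%:~R)); rewrite normrN; lra.
- have hn1 : 1%:~R <= n%:~R :> R by rewrite ler_int; lia.
  have := ler_norm (- s); rewrite normrN; have := ler_norm (s + n%:~R); lra.
- by rewrite n1 addr0.
Qed.

(** Only the factor of one coordinate is small, the others being bounded by
    the normalization. *)
Lemma K_sep N x y i (d : R) : (0 < N)%N -> 0 < d ->
  d <= `|vcoord x i - vcoord y i| <= 1 - d ->
  K (N ^ 2) (x - y) <= 8 * 27 / d ^+ 6 * N%:R^-1.
Proof.
move=> N0 d0 hd; have q1 : d ^+ 2 <= 1 - q i (x - y).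
  by rewrite /q vcoordB; exact: cos2_gap.
have q2 := q_ge0 i (x - y).
have w0 := wallis_inv_le (R := R) N0.
have w1 : 0 < (@wallis R (N ^ 2)) ^- 3 by rewrite invr_gt0 exprn_gt0// wallis_gt0.
have Kq : K (N ^ 2) (x - y) <= 8 * N%:R ^+ 3 * q i (x - y) ^+ (N ^ 2).
  rewrite KE; have p j : 0 <= q j (x - y) ^+ (N ^ 2) <= 1.
    by rewrite exprn_ge0 ?q_ge0//= exprn_ile1 ?q_ge0 ?q_le1.
  move: (p o0) (p o1) (p o2) => /andP[a0 a1] /andP[b0 b1] /andP[c0 c1].
  have {}p : q o0 (x - y) ^+ (N ^ 2) * (q o1 (x - y) ^+ (N ^ 2) * q o2 (x - y) ^+ (N ^ 2)) <= q i (x - y) ^+ (N ^ 2).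
    case: (I3P i) => ->.
    - by rewrite ler_piMr// mulr_ile1.
    - by rewrite mulrCA ler_piMr// mulr_ile1.
    - by rewrite mulrA mulrC ler_piMr// mulr_ile1.
  apply: (le_trans (ler_wpM2l (ltW w1) p)); apply: ler_wpM2r => //.
  by rewrite exprn_ge0.
apply: (le_trans Kq).
have N1 : 0 < N%:R :> R by rewrite ltr0n.
have h := @pow_mul3_le R (q i (x - y)) (N ^ 2) _ _.
have {}h : q i (x - y) ^+ (N ^ 2) * (1 - q i (x - y)) ^+ 3 * N%:R ^+ 6 <= 27.
  apply: le_trans (h _ _); rewrite ?q2 ?q_le1 ?expn_gt0 ?N0//.
  by rewrite natrX -!exprM.
have d6 : 0 < d ^+ 6 by rewrite exprn_gt0.
have q3 : d ^+ 6 <= (1 - q i (x - y)) ^+ 3.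
  rewrite (exprM d 2 3); apply: lerXn2r => //; rewrite nnegrE ?sqr_ge0//.
  exact: le_trans (sqr_ge0 d) q1.
have qn : 0 <= q i (x - y) ^+ (N ^ 2) by rewrite exprn_ge0.
have {}h : q i (x - y) ^+ (N ^ 2) * d ^+ 6 * N%:R ^+ 6 <= 27.
  apply: le_trans h; rewrite ler_wpM2r ?exprn_ge0 ?(ltW N1)//.
  exact: ler_wpM2l.
rewrite [leRHS]mulrAC ler_pdivlMr//.
have N3 : N%:R ^- 3 <= N%:R^-1 :> R.
  by rewrite lef_pV2 ?posrE ?exprn_gt0// ler_eXnr// ler1n.
apply: le_trans (_ : 8 * 27 * N%:R ^- 3 <= _); last exact: (ler_wpM2l (mulr_ge0 (ler0n _ 8) (ler0n _ 27)) N3).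
rewrite ler_pdivlMr ?exprn_gt0//.
have -> : 8 * N%:R ^+ 3 * q i (x - y) ^+ (N ^ 2) * d ^+ 6 * N%:R ^+ 3 =
  8 * (q i (x - y) ^+ (N ^ 2) * d ^+ 6 * N%:R ^+ 6) :> R by ring.
exact: (ler_wpM2l (ler0n _ 8) h).
Qed.

(** ** Boxes *)

(** Up-sets with open boundary; with the whole line they form a pi-system
    that generates the Borel sets. *)
Definition ray (A : set R) := A = setT \/ exists a : R, A = `]a, +oo[%classic.

(** Two points of the circle on different sides of a ray are separated by a
    or by 0, the two boundary points. *)
Lemma ray_gap (A : set R) : ray A -> exists a : R, forall x : R, 0 < x < 1 -> x != a ->
  exists2 d : R, 0 < d & forall y : R, 0 <= y < 1 -> ~ (A x <-> A y) ->
    d <= `|x - y| <= 1 - d.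
Proof.
case=> [->|[a ->]]; first by exists 0 => x _ _; exists 1 => // y _ [].
exists a => x /andP[x0 x1] xa.
have xa' : 0 < `|x - a| by rewrite normr_gt0 subr_eq0.
(* The distance of x to a and to the two ends of the period. *)
pose e := Num.min `|x - a| (Num.min x (1 - x)).
have e0 : 0 < e by rewrite !lt_min xa' x0 subr_gt0.
have e1 : e <= `|x - a| by rewrite ge_min lexx.
have e2 : e <= x by rewrite !ge_min lexx !orbT.
have e3 : e <= 1 - x by rewrite !ge_min lexx !orbT.
exists e => // y /andP[y0 y1]; rewrite /= !in_itv/= !andbT => h.
move: e e0 e1 e2 e3 => e e0 e1 e2 e3.
have [ax|ax] := ltP a x; have [ay|ay] := ltP a y.
- by case: h; rewrite ax ay.
- rewrite (ger0_norm (_ : 0 <= x - y)); last lra.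
  rewrite (ger0_norm (_ : 0 <= x - a)) in e1; last lra.
  by apply/andP; split; lra.
- have {}ax : x < a by rewrite lt_neqAle xa.
  rewrite (ler0_norm (_ : x - y <= 0)); last lra.
  rewrite (ler0_norm (_ : x - a <= 0)) in e1; last lra.
  by apply/andP; split; lra.
- by case: h; rewrite !ltNge ax ay.
Qed.

Lemma measurable_ray (A : set R) : ray A -> measurable (A : set (measurableTypeR R)).
Proof. by case=> [->|[a ->]]; [exact: measurableT | exact: measurable_itv]. Qed.

Definition box (A : 'I_3 -> set R) : set V := [set x | forall i, A i (vcoord x i)].

Lemma measurable_box A : (forall i, measurable (A i : set (measurableTypeR R))) ->
  measurable (box A).
Proof.
move=> mA.
have -> : box A = \bigcap_(i in [set: 'I_3]) ((fun x : V => vcoord x i) @^-1` A i).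
  by apply/seteqP; split => x /=; [move=> h i _; exact: h | move=> h i; exact: h].
apply: fin_bigcap_measurable => [|i _]; first exact: finite_finset.
by rewrite -[X in measurable X]setTI; apply: measurable_vcoord => //; exact: mA.
Qed.

Lemma cell_vcoord x i : cell x -> 0 <= vcoord x i < 1.
Proof.
case=> [[]]; rewrite /= !in_itv/= => h1 h2 h3.
by case: (I3P i) => ->.
Qed.

Lemma tmu_cellC : mu (~` cell) = 0%E.
Proof. by rewrite /tmu /mrestr setICl measure0. Qed.

Lemma ae_cell : \forall x \ae mu, cell x.
Proof.
apply/negligibleP; last exact: tmu_cellC.
by apply: measurableC; exact: measurable_cell.
Qed.

(** The measure is carried by the cell. *)
Lemma Rint_cell_le (F : V -> R) (M : R) : intg mu F ->
  (forall x, cell x -> `|F x| <= M) -> `|\int[mu]_x F x| <= M.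
Proof.
move=> iF hF.
have M0 : 0 <= M by apply: (le_trans _ (hF 0 _)) => //; split; [split|] => /=; rewrite in_itv/= lexx ltr01.
pose F' x := F x * \1_(cell : set V) x.
have m1 : measurable_fun setT (\1_(cell : set V) : V -> R).
  by apply: measurable_indic; exact: measurable_cell.
have iF' : intg mu F'.
  apply: (@intg_bndr _ _ _ mu _ F 1 m1) => // x.
  by rewrite indicE; case: (_ \in _); rewrite ?normr1 ?normr0.
have -> : \int[mu]_x F x = \int[mu]_x F' x.
  apply: Rint_ae_eq; [exact: intg_measurable iF | exact: intg_measurable iF' |].
  apply: ae_sub ae_cell => x cx.
  by rewrite /F' indicE mem_set// mulr1.
rewrite -[M](torus_integral_cst M); apply: Rint_norm_le => //.
  exact: (@intg_cst _ _ _ mu).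
move=> x; rewrite /F' indicE; case: (pselect (cell x)) => cx.
  by rewrite mem_set// mulr1; exact: hF.
by rewrite memNset// mulr0 normr0.
Qed.

(** A hyperplane is a product with a singleton. *)
Lemma coord_negligible i (a : R) : mu.-negligible [set x : V | vcoord x i = a].
Proof.
have m1 : measurable ([set a] : set (measurableTypeR R)) by exact: measurable_set1.
have z : circle_measure ([set a] : set (measurableTypeR R)) = 0%E.
  apply/eqP; rewrite eq_le measure_ge0 andbT -(@lebesgue_measure_set1 R a).
  by apply: le_measure; rewrite ?inE//; apply: measurableI => //; exact: measurable_itv.
have mT' : measurable ([set: measurableTypeR R]) by exact: measurableT.
case: (I3P i) => ->.
- have e : [set x : V | vcoord x o0 = a] = ([set a] `*` setT) `*` setT.
    by apply/seteqP; split => [[[x y] w]|[[x y] w]] /=; [|case; case].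
  rewrite e; apply/negligibleP; first by do 2?apply: measurableX.
  apply: etrans (esym (torus_measure_prod _)) _; first by do 2?apply: measurableX.
  by rewrite product_measure1E//=; [rewrite circle2_measureE// z !mul0e | apply: measurableX].
- have e : [set x : V | vcoord x o1 = a] = (setT `*` [set a]) `*` setT.
    by apply/seteqP; split => [[[x y] w]|[[x y] w]] /=; [|case; case].
  rewrite e; apply/negligibleP; first by do 2?apply: measurableX.
  apply: etrans (esym (torus_measure_prod _)) _; first by do 2?apply: measurableX.
  by rewrite product_measure1E//=; [rewrite circle2_measureE// z mule0 !mul0e | apply: measurableX].
- have e : [set x : V | vcoord x o2 = a] = (setT `*` setT) `*` [set a].
    by apply/seteqP; split => [[[x y] w]|[[x y] w]] /=; [|case].
  rewrite e; apply/negligibleP; first by do 2?apply: measurableX.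
  apply: etrans (esym (torus_measure_prod _)) _; first by do 2?apply: measurableX.
  by rewrite product_measure1E//=; [rewrite z mule0 | apply: measurableX].
Qed.

Lemma measurable_box_indic A : (forall i, ray (A i)) ->
  measurable_fun setT (\1_(box A) : V -> R).
Proof.
by move=> rA; apply: measurable_indic; apply: measurable_box => i; exact: measurable_ray.
Qed.

Lemma intg_box A : (forall i, ray (A i)) -> intg mu (\1_(box A) : V -> R).
Proof.
move=> rA; apply: (@intg_bounded _ _ _ mu _ 1); first exact: measurable_box_indic.
by move=> x; rewrite indicE; case: (_ \in _); rewrite ?normr1 ?normr0.
Qed.

(** A point off the faces keeps a positive distance, in some coordinate,
    from all the points on the other side of the boundary, and there the
    kernel is small. The exceptional values a are the faces themselves. *)
Lemma box_conv A : (forall i, ray (A i)) -> exists a : 'I_3 -> R,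
  forall x, cell x -> (forall i, vcoord x i != 0) -> (forall i, vcoord x i != a i) ->
  exists C : R, forall n,
    `|tp (convT (KT (n.+1 ^ 2)) (\1_(box A))) x - \1_(box A) x| <= C * n.+1%:R^-1.
Proof.
move=> rA; have /choice[a ha] i := ray_gap (rA i).
exists a => x cx x0 xa.
have /choice[d hd] i : exists d : R, 0 < d /\ forall y : R, 0 <= y < 1 ->
   ~ (A i (vcoord x i) <-> A i y) -> d <= `|vcoord x i - y| <= 1 - d.
  have /andP[c0 c1] := cell_vcoord i cx.
  have [|d d0 h] := ha i (vcoord x i) _ (xa i); first by rewrite lt_neqAle eq_sym x0 c0.
  by exists d.
have [e e0 he] : exists2 e : R, 0 < e & forall i, e <= d i.
  exists (Num.min (d o0) (Num.min (d o1) (d o2))).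
    by rewrite !lt_min; have [[-> _] [[-> _] [-> _]]] := (hd o0, (hd o1, hd o2)).
  by move=> i; case: (I3P i) => ->; rewrite !ge_min lexx ?orbT.
exists (8 * 27 / e ^+ 6) => n.
rewrite tp_conv; last exact: intg_box.
have iK c : intg mu (fun y : V => K (n.+1 ^ 2) (x - y) * c).
  exact: intgZr (intg_tp_sub _ _).
have iB : intg mu (fun y : V => K (n.+1 ^ 2) (x - y) * \1_(box A) y).
  apply: (intg_bndl (measurable_tp_subr (KT _) x) (fun y => tp_le (KT _) (x - y))).
  exact: intg_box.
have -> : \1_(box A) x = \int[mu]_y (K (n.+1 ^ 2) (x - y) * \1_(box A) x) :> R.
  by rewrite RintZr ?Rint_K_sub ?mul1r//; exact: intg_tp_sub.
rewrite -RintB//; apply: Rint_cell_le; first exact: intgB.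
move=> y cy; rewrite -mulrBr normrM (ger0_norm (K_ge0 _ _)).
have b0 : 0 <= 8 * 27 / e ^+ 6 * n.+1%:R^-1 by exact: mulr_ge0 (mulr_ge0 (mulr_ge0 (ler0n _ 8) (ler0n _ 27)) (ltW (eq_ind_r is_true (exprn_gt0 6 e0) (invr_gt0 _)))) (eq_ind_r is_true (ler0n _ _) (invr_ge0 _)).
have [h|] := pselect (forall i, A i (vcoord x i) <-> A i (vcoord y i)).
  have -> : \1_(box A) y = \1_(box A) x :> R.
    rewrite !indicE; congr (nat_of_bool _)%:R; apply/idP/idP; rewrite !inE => hh i; exact/h.
  by rewrite subrr normr0 mulr0.
move/existsNP => [i hi].
have [d0 /(_ (vcoord y i) (cell_vcoord i cy) hi)/andP[l1 l2]] := hd i.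
apply: (@le_trans _ _ (K (n.+1 ^ 2) (x - y))).
  rewrite ler_piMr ?K_ge0// !indicE; do 2 case: (_ \in _);
    by rewrite /= ?subrr ?subr0 ?sub0r ?normrN ?normr0 ?normr1.
apply: (K_sep (i := i)) => //; have := he i; lra.
Qed.

(** ** A function orthogonal to all trigonometric polynomials vanishes *)

Variable h : V -> R.
Hypothesis ih : intg mu h.
Hypothesis h_orth : forall l, \int[mu]_x (tp l x * h x) = 0.

Lemma cvg_inv_nat (C : R) : C * n.+1%:R^-1 @[n --> \oo] --> 0.
Proof.
rewrite -[X in _ --> X](mulr0 C); apply: cvgMr.
exact: cvg_harmonic.
Qed.

(** The mollified indicator is a trigonometric polynomial, so h integrates
    to zero against it; let the scale vanish and use dominated convergence. *)
Lemma orth_box A : (forall i, ray (A i)) -> (\int[mu]_(x in box A) (h x)%:E = 0)%E.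
Proof.
move=> rA; have [a ha] := box_conv rA.
pose F n (x : V) : \bar R := (tp (convT (KT (n.+1 ^ 2)) (\1_(box A))) x * h x)%:E.
have mh := intg_measurable ih.
have mB := measurable_box_indic rA.
have conj : forall n, (\int[mu]_x F n x = 0)%E.
  by move=> n; rewrite -EFin_Rint ?h_orth//; exact: intg_tpM.
have [] := @dominated_convergence _ _ _ mu setT measurableT F
   (fun x => (\1_(box A) x * h x)%:E) (fun x => `|h x|%:E).
- by move=> n; apply/measurable_EFinP; apply: measurable_funM => //; exact: measurable_tp.
- by apply/measurable_EFinP; exact: measurable_funM.
- have neg : mu.-negligible (\bigcup_(i in [set: 'I_3]) ([set x : V | vcoord x i = 0] `|` [set x : V | vcoord x i = a i])).
    rewrite bigcup_fset_set; last exact: finite_finset.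
    by apply: big_ind => [|A1 A2|i _]; [exact: negligible_set0|exact: negligibleU|apply: negligibleU; exact: coord_negligible].
  have aen : \forall x \ae mu, forall i, vcoord x i != 0 /\ vcoord x i != a i.
    apply: negligibleS neg => x /= /existsNP[i /not_andP hi]; exists i => //=.
    by case: hi => /negP; rewrite negbK => /eqP; [left|right].
  apply: ae_sub (ae_and ae_cell aen) => x [cx hx] _.
  have [C hC] := ha x cx (fun i => (hx i).1) (fun i => (hx i).2).
  apply: cvg_EFin; first exact: nearW.
  rewrite /F /=; apply: cvgMl.
  apply/cvgrPdist_lt => e e0; have := cvg_inv_nat C; move/cvgrPdist_lt/(_ e e0).
  apply: filterS => n; rewrite sub0r normrN => hn.
  rewrite distrC; apply: (le_lt_trans (hC n)); exact: le_lt_trans (ler_norm _) hn.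
- exact: (intg_norm ih).
- apply: aeW => x n _; rewrite /F abse_EFin lee_fin normrM ler_piMl//.
  rewrite tp_conv; last exact: intg_box.
  rewrite -(Rint_K_sub (n.+1 ^ 2) x); apply: Rint_norm_le.
  + apply: (intg_bndl (measurable_tp_subr (KT _) x) (fun y => tp_le (KT _) (x - y))).
    exact: intg_box.
  + exact: intg_tp_sub.
  + move=> y; rewrite normrM (ger0_norm (K_ge0 _ _)) ler_piMr ?K_ge0// indicE.
    by case: (_ \in _); rewrite ?normr1 ?normr0.
move=> _ _ hc.
have e : (\int[mu]_x (\1_(box A) x * h x)%:E = 0)%E.
  rewrite -(cvg_lim _ hc)//.
  rewrite (_ : [sequence _]_n = (fun=> 0%E)); first exact: lim_cst.
  by apply/funext => n; exact: conj.
rewrite -e integral_mkcond; apply: eq_integral => x _.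
rewrite patchE indicE; case: (_ \in _); by rewrite ?mul1r ?mul0r.
Qed.

Definition null_on (E : set V) := (\int[mu]_(x in E) (h x)%:E = 0)%E.

Lemma null_onT : null_on setT.
Proof.
have := orth_box (A := fun=> setT) (fun=> or_introl erefl).
by rewrite (_ : box _ = setT)//; apply/seteqP; split.
Qed.

Lemma sub_integrable (E : set V) : measurable E -> mu.-integrable E (EFin \o h).
Proof. by move=> mE; apply: integrableS ih. Qed.

(** Dynkin's lemma, applied to one coordinate at a time. *)
Lemma null_on_preimage d' (T' : measurableType d') (p : V -> T') (G : set (set T')) (E : set V) :
  measurable_fun setT p -> @measurable d' T' = <<s G >> -> setI_closed G ->
  measurable E -> null_on E -> (forall A, G A -> null_on (E `&` p @^-1` A)) ->
  forall A, measurable A -> null_on (E `&` p @^-1` A).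
Proof.
move=> mp mG GI mE E0 hG A; rewrite mG.
have mpre B : measurable B -> measurable (p @^-1` B).
  by move=> mB; rewrite -[X in measurable X]setTI; exact: mp.
apply: (dynkin_induction (P := fun A => null_on (E `&` p @^-1` A)) mG GI) => //.
- by rewrite preimage_setT setIT.
- move=> S mS hS.
  have mS1 : measurable (E `&` p @^-1` S) by apply: measurableI => //; exact: mpre.
  have mS2 : measurable (E `&` p @^-1` (~` S)).
    by apply: measurableI => //; apply: mpre; exact: measurableC.
  move: E0; rewrite /null_on.
  rewrite -{1}(setIT E) -(preimage_setT p) -(setUv S) preimage_setU setIUr integral_setU//.
  + by rewrite hS add0e.
  + rewrite -setIUr -preimage_setU setUv preimage_setT setIT.
    exact: measurable_int (sub_integrable mE).
  + by apply/disj_setPS => x [[_ ?] [_ ?]].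
- move=> F mF tF hF; rewrite /null_on preimage_bigcup setI_bigcupr integral_bigcup.
  + by apply: eseries0 => k _ _; exact: hF.
  + apply/trivIsetP => i j _ _ ij; move/trivIsetP: tF => /(_ i j I I ij) h'.
    by rewrite setIACA setIid -preimage_setI h' preimage_set0 setI0.
  + by move=> k; apply: measurableI => //; exact: mpre.
  + apply: sub_integrable; apply: bigcup_measurable => k _.
    by apply: measurableI => //; exact: mpre.
Qed.

Lemma ray_generate : @measurable _ (measurableTypeR R) = <<s [set A | ray A] >>.
Proof.
apply/seteqP; split.
  rewrite {1}RGenOInfty.measurableE; apply: sub_smallest2r; first exact: smallest_sigma_algebra.
  by move=> A [a ->]; right; exists a.
apply: smallest_sub; first exact: sigma_algebra_measurable.
by move=> A; exact: measurable_ray.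
Qed.

Lemma ray_setI : setI_closed [set A : set R | ray A].
Proof.
move=> A B [->|[a ->]] [->|[b ->]].
- by rewrite setIT; left.
- by rewrite setTI; right; exists b.
- by rewrite setIT; right; exists a.
- right; exists (Num.max a b); apply/seteqP; split => x /=; rewrite !in_itv/= !andbT gt_max.
    by move=> [-> ->].
  by case/andP.
Qed.

Lemma null_on_box A B C : measurable (A : set (measurableTypeR R)) ->
  measurable (B : set (measurableTypeR R)) -> measurable (C : set (measurableTypeR R)) ->
  null_on ((A `*` B) `*` C).
Proof.
have mT' : measurable ([set: measurableTypeR R]) by exact: measurableT.
have s0 A' B' C' : ray A' -> ray B' -> ray C' -> null_on ((A' `*` B') `*` C').
  move=> rA rB rC.
  have := orth_box (A := fun i => if i == o0 then A' else if i == o1 then B' else C').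
  rewrite /null_on (_ : box _ = (A' `*` B') `*` C'); last first.
    apply/seteqP; split => x /=.
      by move=> hx; have [h0 h1 h2] := And3 (hx o0) (hx o1) (hx o2).
    by move=> [[h0 h1] h2] i; case: (I3P i) => ->.
  by apply => i; case: (I3P i) => -> /=.
have s1 A' B' C' : measurable (A' : set (measurableTypeR R)) -> ray B' -> ray C' -> null_on ((A' `*` B') `*` C').
  move=> mA rB rC.
  have e (X : set R) : (setT `*` B') `*` C' `&` (fun x : V => x.1.1) @^-1` X = (X `*` B') `*` C'.
    by apply/seteqP; split => [[[a b] c]|[[a b] c]] /=; [case=> [[[_ ?] ?] ?]|case=> [[? ?] ?]].
  rewrite -e; apply: (null_on_preimage measurable_coord1 ray_generate ray_setI) => //.
  - by apply: measurableX; [apply: measurableX => //|]; exact: measurable_ray.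
  - by apply: s0 => //; left.
  - by move=> X rX; rewrite e; exact: s0.
have s2 A' B' C' : measurable (A' : set (measurableTypeR R)) ->
    measurable (B' : set (measurableTypeR R)) -> ray C' -> null_on ((A' `*` B') `*` C').
  move=> mA mB rC.
  have e (X : set R) : (A' `*` setT) `*` C' `&` (fun x : V => x.1.2) @^-1` X = (A' `*` X) `*` C'.
    by apply/seteqP; split => [[[a b] c]|[[a b] c]] /=; [case=> [[[? _] ?] ?]|case=> [[? ?] ?]].
  rewrite -e; apply: (null_on_preimage measurable_coord2 ray_generate ray_setI) => //.
  - by apply: measurableX; [apply: measurableX => //|]; exact: measurable_ray.
  - by apply: s1 => //; left.
  - by move=> X rX; rewrite e; exact: s1.
move=> mA mB mC.
have e (X : set R) : (A `*` B) `*` setT `&` (fun x : V => x.2) @^-1` X = (A `*` B) `*` X.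
  by apply/seteqP; split => [[[a b] c]|[[a b] c]] /=; [case=> [[[? ?] _] ?]|case=> [[? ?] ?]].
rewrite -e; apply: (null_on_preimage measurable_coord3 ray_generate ray_setI) => //.
- by apply: measurableX => //; exact: measurableX.
- by apply: s2 => //; left.
- by move=> X rX; rewrite e; exact: s2.
Qed.

Lemma rectangle_setI d1 d2 (T1 : measurableType d1) (T2 : measurableType d2) :
  setI_closed [set A `*` B | A in @measurable _ T1 & B in @measurable _ T2].
Proof.
move=> _ _ [A1 mA1 [B1 mB1 <-]] [A2 mA2 [B2 mB2 <-]].
by exists (A1 `&` A2); [exact: measurableI|exists (B1 `&` B2); [exact: measurableI|rewrite setXI]].
Qed.

Lemma null_on_measurable (E : set V) : measurable E -> null_on E.
Proof.
have mT' : measurable ([set: measurableTypeR R]) by exact: measurableT.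
pose T2 := (measurableTypeR R * measurableTypeR R)%type.
have s (E2 : set T2) C : measurable E2 -> measurable (C : set (measurableTypeR R)) -> null_on (E2 `*` C).
  move=> mE mC.
  have e (X : set T2) : setT `*` C `&` (fun x : V => x.1) @^-1` X = X `*` C.
    by apply/seteqP; split => [[a b]|[a b]] /=; [case=> [[_ ?] ?]|case].
  rewrite -e; apply: (null_on_preimage (measurable_fst) (measurable_prod_measurableType _ _) (@rectangle_setI _ _ _ _)) => //.
  - exact: measurableX.
  - by rewrite -setXTT; exact: null_on_box.
  - by move=> _ [A mA [B mB <-]]; rewrite e; exact: null_on_box.
move=> mE; have := @null_on_preimage _ V id _ setT (@measurable_id _ _ _) (measurable_prod_measurableType _ _)
  (@rectangle_setI _ _ _ _) measurableT null_onT _ E mE.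
rewrite setTI preimage_id; apply => _ [A mA [B mB <-]].
by rewrite setTI preimage_id; exact: s.
Qed.

(** By Dynkin's lemma h has zero integral on every measurable set. *)
Lemma orth_ae0 : \forall x \ae mu, h x = 0.
Proof.
have hE E : E `<=` setT -> measurable E ->
    (\int[mu]_(x in E) (EFin \o h) x = \int[mu]_(x in E) (cst 0 : V -> \bar R) x)%E.
  by move=> _ mE; rewrite integral0; exact: null_on_measurable.
have := @integral_ae_eq _ _ _ mu setT measurableT (cst 0%E) (EFin \o h) ih (measurable_cst _) hE.
by apply: ae_sub => x /(_ I) /= [].
Qed.

End Completeness.

(** * Geometric approximation in L^2 *)

Section Geometric.
Context {R : realType}.

(** A limit together with a rate. Rates survive sums and pairings, and
    [geo_unique] identifies the limits. *)
Definition geo (r : R) (a : nat -> R) (l : R) := exists C : R, forall n, `|a n - l| <= C * r ^+ n.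

Lemma geo_small (r C : R) : 0 < r < 1 -> C * r ^+ n @[n --> \oo] --> 0.
Proof.
move=> /andP[r0 r1]; rewrite -[X in _ --> X](mulr0 C); apply: cvgMr.
by apply: cvg_expr; rewrite ger0_norm// ltW.
Qed.

Lemma geo_cvg r a l : 0 < r < 1 -> geo r a l -> a n @[n --> \oo] --> l.
Proof.
move=> hr [C hC]; apply/cvgrPdist_lt => e e0.
have := geo_small C hr; move/cvgrPdist_lt/(_ e e0); apply: filterS => n.
rewrite sub0r normrN distrC => hn; apply: (le_lt_trans (hC n)).
exact: le_lt_trans (ler_norm _) hn.
Qed.

Lemma geo_unique r a l l' : 0 < r < 1 -> geo r a l -> geo r a l' -> l = l'.
Proof. by move=> hr /(geo_cvg hr) h /(geo_cvg hr); apply: cvg_unique. Qed.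

Lemma geoD r a b l m : geo r a l -> geo r b m -> geo r (fun n => a n + b n) (l + m).
Proof.
move=> [C hC] [D hD]; exists (C + D) => n; rewrite opprD addrACA mulrDl.
by apply: (le_trans (ler_normD _ _)); exact: lerD.
Qed.

Lemma geoZ r (c : R) a l : geo r a l -> geo r (fun n => c * a n) (c * l).
Proof.
move=> [C hC]; exists (`|c| * C) => n; rewrite -mulrBr normrM -mulrA.
exact: ler_wpM2l.
Qed.

Lemma geo_sum (I : Type) (s : seq I) r (a : I -> nat -> R) (l : I -> R) :
  (forall i, geo r (a i) (l i)) -> geo r (fun n => \sum_(i <- s) a i n) (\sum_(i <- s) l i).
Proof.
move=> h; elim: s => [|i s IH].
  by exists 0 => n; rewrite !big_nil subrr normr0 mul0r.
have [C hC] := geoD (h i) IH; exists C => n; rewrite !big_cons; exact: hC.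
Qed.

Lemma geo_ext r a b l : a =1 b -> geo r a l -> geo r b l.
Proof. by move=> /funext ->. Qed.

Lemma geo_dist (a : nat -> R) (M r : R) : 0 <= M -> 0 < r < 1 ->
  (forall n, `|a n.+1 - a n| <= M * r ^+ n) ->
  forall n p, `|a (n + p)%N - a n| <= M * r ^+ n / (1 - r).
Proof.
move=> M0 /andP[r0 r1] h n p.
have r2 : 0 < 1 - r by rewrite subr_gt0.
suff : `|a (n + p)%N - a n| <= M * r ^+ n * (1 - r ^+ p) / (1 - r).
  move/le_trans; apply; rewrite ler_pM2r ?invr_gt0//.
  have rp : 0 <= r ^+ p by rewrite exprn_ge0 ?ltW.
  by apply: ler_piMr; [exact: mulr_ge0 M0 (exprn_ge0 _ (ltW r0)) | lra].
elim: p => [|p IH]; first by rewrite addn0 subrr normr0 expr0 subrr mulr0 mul0r.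
have -> : a (n + p.+1)%N - a n = (a (n + p).+1 - a (n + p)%N) + (a (n + p)%N - a n).
  by rewrite addnS; ring.
apply: (le_trans (ler_normD _ _)); apply: (le_trans (lerD (h _) IH)).
rewrite le_eqVlt; apply/orP; left; apply/eqP; rewrite exprD exprS.
by field; rewrite gt_eqF.
Qed.

Lemma geo_cauchy (a : nat -> R) (M r : R) : 0 <= M -> 0 < r < 1 ->
  (forall n, `|a n.+1 - a n| <= M * r ^+ n) ->
  exists l, a n @[n --> \oo] --> l /\ forall n, `|a n - l| <= M * r ^+ n / (1 - r).
Proof.
move=> M0 hr h; have /andP[r0 r1] := hr.
have hd := geo_dist M0 hr h.
have ca : cvgn a.
  pose d n := a n.+1 - a n.
  have cd : cvgn (series d).
    apply: normed_cvg; apply: (series_le_cvg (v_ := geometric M r)) => //=.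
    - by move=> n; rewrite mulr_ge0// exprn_ge0// ltW.
    - by apply: is_cvg_geometric_series; rewrite ger0_norm// ltW.
  have e : a = (fun n => a 0%N + series d n).
    apply/funext => n; rewrite /series /= /d telescope_sumr//; ring.
  by rewrite e; apply: is_cvgD => //; exact: is_cvg_cst.
exists (limn a); split => // n.
have c2 : `|a n - a m| @[m --> \oo] --> `|a n - limn a|.
  by apply: cvg_norm; apply: cvgB => //; exact: cvg_cst.
apply: (cvgr_to_le c2); exists n => // m /= nm.
by rewrite distrC -(subnKC nm); exact: hd.
Qed.

End Geometric.

Section SquareIntegrable.
Context {R : realType}.
Local Notation V := (measurableTypeR R * measurableTypeR R * measurableTypeR R)%type.
Local Notation mu := (@tmu R).
Implicit Types (f g h : V -> R) (l : seq (R * freq * R)).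

Definition L2 g := measurable_fun setT g /\ intg mu (fun x => g x ^+ 2).

Lemma L2M f g : L2 f -> L2 g -> intg mu (fun x => f x * g x).
Proof.
move=> [mf f2] [mg g2]; apply: (intg_le _ (intgD f2 g2)); first exact: measurable_funM.
move=> x; rewrite normrM -[f x ^+ 2]real_normK ?num_real// -[g x ^+ 2]real_normK ?num_real//.
have := sqr_ge0 (`|f x| - `|g x|); have := normr_ge0 (f x); have := normr_ge0 (g x).
move: (`|f x|) (`|g x|) => a b; nra.
Qed.

Lemma L2D f g : L2 f -> L2 g -> L2 (fun x => f x + g x).
Proof.
move=> hf hg; have [mf f2] := hf; have [mg g2] := hg.
split; first exact: measurable_funD.
apply: (@intg_eq _ _ _ mu (fun x : V => f x ^+ 2 + g x ^+ 2 + 2 * (f x * g x))).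
  by move=> x; ring.
by apply: intgD; [exact: intgD | apply: intgZ; exact: L2M].
Qed.

Lemma L2Z (c : R) f : L2 f -> L2 (fun x => c * f x).
Proof.
move=> [mf f2]; split; first exact: measurable_funM.
by apply: (@intg_eq _ _ _ mu (fun x : V => c ^+ 2 * f x ^+ 2)); [move=> x; ring | exact: intgZ].
Qed.

Lemma L2B f g : L2 f -> L2 g -> L2 (fun x => f x - g x).
Proof.
move=> hf hg; have := L2D hf (L2Z (-1) hg).
by rewrite (_ : (fun x => _ + _) = (fun x => f x - g x))//; apply/funext => x; rewrite mulN1r.
Qed.

Lemma L2_tp l : L2 (tp l).
Proof.
split; first exact: measurable_tp.
by apply: (@intg_eq _ _ _ mu _ _ _ (intg_tp2 l l)) => x; rewrite expr2.
Qed.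

Lemma L2_intg f : L2 f -> intg mu f.
Proof.
move=> hf; have := L2M (L2_tp oneT) hf.
by apply: intg_eq => x; rewrite tp_oneT mul1r.
Qed.

Lemma torus_L2P g : torus_L2 g <-> torus_periodic g /\ L2 g.
Proof.
split.
- move=> [pg mg ig]; split => //; split => //.
  apply: intg_lty => [|x|]; [exact: measurable_funX|exact: sqr_ge0|exact: ig].
- move=> [pg [mg ig]]; split => //.
  have := EFin_Rint ig; rewrite /= => e.
  by rewrite -[X in (X < _)%E]e ltry.
Qed.

(** The weight e trades the two norms against each other; it will be the
    rate itself. *)
Lemma pairing_young (e : R) f g : 0 < e -> L2 f -> L2 g ->
  `|\int[mu]_x (f x * g x)| <= e * \int[mu]_x (g x ^+ 2) + e^-1 * \int[mu]_x (f x ^+ 2).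
Proof.
move=> e0 hf hg; have [mf f2] := hf; have [mg g2] := hg.
rewrite -RintZ// -(RintZ e^-1 f2) -RintD; [|exact: intgZ..].
apply: Rint_norm_le; [exact: L2M|by apply: intgD; exact: intgZ|].
move=> x; rewrite normrM -[f x ^+ 2]real_normK ?num_real// -[g x ^+ 2]real_normK ?num_real//.
have := normr_ge0 (f x); have := normr_ge0 (g x); move: (`|f x|) (`|g x|) => a b b0 a0.
rewrite -subr_ge0 -(pmulr_rge0 _ e0).
have -> : e * (e * b ^+ 2 + e^-1 * a ^+ 2 - a * b) = ((e * b - a) ^+ 2 + (e * b) ^+ 2 + a ^+ 2) / 2.
  by field; rewrite gt_eqF.
by rewrite mulr_ge0// !addr_ge0 ?sqr_ge0.
Qed.

(** The norm is squared, hence the rate too. *)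
Definition L2geo (r : R) (S : nat -> V -> R) G :=
  exists C : R, forall n, \int[mu]_x ((S n x - G x) ^+ 2) <= C * (r ^+ n) ^+ 2.

Lemma L2geo_pairing r S G f : 0 < r < 1 -> (forall n, L2 (S n)) -> L2 G -> L2 f -> L2geo r S G ->
  geo r (fun n => \int[mu]_x (S n x * f x)) (\int[mu]_x (G x * f x)).
Proof.
move=> /andP[r0 r1] hS hG hf [C hC].
exists (\int[mu]_x (f x ^+ 2) + C) => n.
have rn : 0 < r ^+ n by rewrite exprn_gt0.
rewrite -RintB; [|exact: L2M..].
rewrite (Rint_ext _ (g := fun x : V => (S n x - G x) * f x)); last by move=> x; ring.
apply: (le_trans (pairing_young rn (L2B (hS n) hG) hf)).
rewrite mulrDl [X in _ <= X + _]mulrC lerD2l mulrC ler_pdivrMr//.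
by apply: (le_trans (hC n)); rewrite expr2 mulrA.
Qed.

Lemma L2geo_pairing2 r S T G H : 0 < r < 1 -> (forall n, L2 (S n)) -> (forall n, L2 (T n)) ->
  L2 G -> L2 H -> L2geo r S G -> L2geo r T H ->
  geo r (fun n => \int[mu]_x (S n x * T n x)) (\int[mu]_x (G x * H x)).
Proof.
move=> hr hS hT hG hH gS gT; have /andP[r0 r1] := hr.
have [A hA] := L2geo_pairing hr hS hG hH gS.
have [B hB] := L2geo_pairing hr hT hH hG gT.
have [C hC] := gS; have [D hD] := gT.
have C0 : 0 <= C.
  by apply: le_trans (le_trans (hC 0%N) _); [apply: Rint_ge0 => x; exact: sqr_ge0|rewrite !expr0 expr1n mulr1].
have D0 : 0 <= D.
  by apply: le_trans (le_trans (hD 0%N) _); [apply: Rint_ge0 => x; exact: sqr_ge0|rewrite !expr0 expr1n mulr1].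
exists (A + B + (D + C)) => n.
have rn : 0 < r ^+ n by rewrite exprn_gt0.
have rn1 : r ^+ n <= 1 by rewrite exprn_ile1// ltW.
have iST : intg mu (fun x => (S n x - G x) * (T n x - H x)) by apply: L2M; exact: L2B.
have i1 : intg mu (fun x => S n x * H x - G x * H x) by apply: intgB; exact: L2M.
have i2 : intg mu (fun x => T n x * G x - H x * G x) by apply: intgB; exact: L2M.
have -> : \int[mu]_x (S n x * T n x) - \int[mu]_x (G x * H x) =
   \int[mu]_x (S n x * H x - G x * H x) + \int[mu]_x (T n x * G x - H x * G x)
   + \int[mu]_x ((S n x - G x) * (T n x - H x)).
  rewrite -RintB; [|exact: L2M..].
  rewrite -(RintD i1 i2) -(RintD (intgD i1 i2) iST).
  by apply: Rint_ext => x; ring.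
rewrite mulrDl mulrDl RintB; [|exact: L2M..]; rewrite RintB; [|exact: L2M..].
apply: (le_trans (ler_normD _ _)); apply: lerD.
  by apply: (le_trans (ler_normD _ _)); apply: lerD; [exact: hA|exact: hB].
apply: (le_trans (pairing_young ltr01 (L2B (hS n) hG) (L2B (hT n) hH))).
rewrite invr1 !mul1r mulrDl; apply: lerD; [apply: (le_trans (hD n))|apply: (le_trans (hC n))];
  by apply: ler_wpM2l => //; rewrite expr2 ler_piMl// ltW.
Qed.

(** ** Completeness of L^2, for geometrically convergent sequences *)

Section RieszFischer.
Variables (r C : R) (S : nat -> seq (R * freq * R)).
Hypothesis r01 : 0 < r < 1.
Hypothesis C0 : 0 <= C.
Hypothesis hS : forall n, \int[mu]_x ((tp (S n.+1) x - tp (S n) x) ^+ 2) <= C * (r ^+ n) ^+ 4.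

Let D n (x : V) : R := ((r ^+ n) ^+ 2)^-1 * (tp (S n.+1) x - tp (S n) x) ^+ 2.
Let E (x : V) : \bar R := (\big[+%E/0%R]_(0 <= n <oo) (D n x)%:E)%E.

Let r0 : 0 < r. Proof. by case/andP: r01. Qed.
Let r1 : r < 1. Proof. by case/andP: r01. Qed.

Let D_ge0 n x : 0 <= D n x.
Proof. by rewrite mulr_ge0 ?sqr_ge0// invr_ge0 sqr_ge0. Qed.

Let mD n : measurable_fun setT (D n).
Proof.
apply: measurable_funM => //; apply: measurable_funX; apply: measurable_funB; exact: measurable_tp.
Qed.

Let mE : measurable_fun setT E.
Proof.
apply: ge0_emeasurable_sum => [n x _ _|n _]; first by rewrite lee_fin.
exact/measurable_EFinP.
Qed.

Let E_ge0 x : (0 <= E x)%E.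
Proof. by apply: nneseries_ge0 => n _ _; rewrite lee_fin. Qed.

Let intE : (\int[mu]_x E x < +oo)%E.
Proof.
rewrite integral_nneseries//; last by move=> n x _; rewrite lee_fin.
  have hD n : (\int[mu]_x (D n x)%:E <= (C * (r ^+ 2) ^+ n)%:E)%E.
    have i2 : intg mu (fun x => (tp (S n.+1) x - tp (S n) x) ^+ 2).
      by apply: (L2B (L2_tp _) (L2_tp _)).2.
    rewrite -EFin_Rint; last exact: intgZ.
    rewrite lee_fin RintZ// ler_pdivrMl ?exprn_gt0//.
    apply: (le_trans (hS n)); rewrite -!exprM.
    by rewrite le_eqVlt; apply/orP; left; apply/eqP; rewrite mulrCA -exprD; congr (_ * _ ^+ _); lia.
  apply: (@le_lt_trans _ _ (\big[+%E/0%R]_(0 <= n <oo) (C * (r ^+ 2) ^+ n)%:E)%E).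
    by apply: lee_nneseries => [n _ _|n _]; [apply: integral_ge0 => x _; rewrite lee_fin|exact: hD].
  have r2 : `|r ^+ 2| < 1 by rewrite ger0_norm ?sqr_ge0// exprn_ilt1// ltW.
  have cg := @is_cvg_geometric_series _ C _ r2.
  have -> : (\big[+%E/0%R]_(0 <= n <oo) (C * (r ^+ 2) ^+ n)%:E = (limn (series (geometric C (r ^+ 2))))%:E)%E.
    apply/cvg_lim => //; rewrite (_ : (fun n => _) = EFin \o series (geometric C (r ^+ 2))).
      by apply: cvg_EFin; [exact: nearW|exact: cg].
    by apply/funext => n; rewrite /series /= sumEFin.
  exact: ltry.
by move=> n; exact/measurable_EFinP.
Qed.

Let step x n : (E x < +oo)%E ->
  `|tp (S n.+1) x - tp (S n) x| <= Num.sqrt (fine (E x)) * r ^+ n.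
Proof.
move=> Ex; have Dn : D n x <= fine (E x).
  rewrite -lee_fin fineK ?ge0_fin_numE//.
  apply: le_trans (nneseries_lim_ge (u_ := fun k => (D k x)%:E) (P := xpredT) n.+1 _); last first.
    by move=> k _ _; rewrite lee_fin.
  rewrite sumEFin lee_fin big_nat_recr//= lerDr sumr_ge0//.
rewrite -(@ler_pXn2r _ 2)// ?nnegrE ?mulr_ge0 ?sqrtr_ge0 ?exprn_ge0 ?(ltW r0)//.
rewrite real_normK ?num_real// exprMn sqr_sqrtr ?fine_ge0//.
by move: Dn; rewrite /D ler_pdivrMl ?exprn_gt0// mulrC.
Qed.

(** The increments are summable in norm. With the weights r ^ (- 2 n) their
    squares have an integrable sum E, and at each point where E is finite
    the sequence converges at the rate r. The limit is set to zero
    elsewhere; E is periodic and measurable, hence so is the limit. *)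
Lemma riesz_fischer : exists G : V -> R, [/\ torus_periodic G, L2 G & L2geo r (fun n => tp (S n)) G].
Proof.
pose e x := fine (E x) / (1 - r) ^+ 2.
have r2 : 0 < 1 - r by rewrite subr_gt0.
have hlim x : exists l : R, ((E x < +oo)%E -> tp (S n) x @[n --> \oo] --> l /\
     forall n, (tp (S n) x - l) ^+ 2 <= e x * (r ^+ n) ^+ 2) /\ (~ (E x < +oo)%E -> l = 0).
  have [Ex|Ex] := pselect (E x < +oo)%E; last by exists 0; split.
  have [l [cl hl]] := geo_cauchy (sqrtr_ge0 (fine (E x))) r01 (fun n => step n Ex).
  exists l; split=> [_|//]; split=> // n.
  rewrite -[leLHS]real_normK ?num_real//.
  apply: le_trans (_ : (Num.sqrt (fine (E x)) * r ^+ n / (1 - r)) ^+ 2 <= _).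
    by rewrite lerXn2r ?nnegrE// !mulr_ge0 ?sqrtr_ge0 ?exprn_ge0 ?invr_ge0 ?ltW.
  by rewrite !exprMn sqr_sqrtr ?fine_ge0// /e exprVn mulrAC.
have pE x k : lattice k -> E (x + k) = E x.
  by move=> hk; rewrite /E; apply: eq_eseriesr => n _; rewrite /D !(tp_periodic _ _ hk).
have {hlim} hlim x : exists l : R, (E x < +oo)%E -> tp (S n) x @[n --> \oo] --> l /\
     forall n, (tp (S n) x - l) ^+ 2 <= e x * (r ^+ n) ^+ 2.
  by have [l [h _]] := hlim x; exists l.
pose G x : R := if (E x < +oo)%E then limn (fun n => tp (S n) x) else 0.
have hG x : (E x < +oo)%E -> tp (S n) x @[n --> \oo] --> G x /\
     forall n, (tp (S n) x - G x) ^+ 2 <= e x * (r ^+ n) ^+ 2.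
  move=> Ex; have [l hl] := hlim x; have [cl bl] := hl Ex.
  by rewrite /G Ex (cvg_lim _ cl).
have G0 x : ~ (E x < +oo)%E -> G x = 0 by rewrite /G; case: (_ < _)%E.
have mB : measurable [set x : V | (E x < +oo)%E].
  by rewrite -[X in measurable X]setTI; exact: emeasurable_fun_infty_o.
have mi : measurable_fun setT (\1_[set x : V | (E x < +oo)%E] : V -> R) by exact: measurable_indic.
have mG : measurable_fun setT G.
  apply: (measurable_fun_cvg (h := fun n (x : V) => tp (S n) x * \1_[set x : V | (E x < +oo)%E] x)).
    by move=> n; apply: measurable_funM => //; exact: measurable_tp.
  move=> x _; have [Ex|Ex] := pselect (E x < +oo)%E.
    rewrite -[G x]mulr1; rewrite indicE mem_set//; apply: cvgMl; exact: (hG x Ex).1.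
  rewrite G0// indicE memNset//; under eq_fun do rewrite mulr0; exact: cvg_cst.
have iE : intg mu (fun x => fine (E x)).
  apply: (intg_fine _).1; apply/integrableP; split => //.
  by under eq_integral do rewrite gee0_abs//.
have ie : intg mu e by exact: intgZr.
have e_ge0 x : 0 <= e x by rewrite mulr_ge0 ?fine_ge0// invr_ge0 sqr_ge0.
have L2G : L2 G.
  split=> //; apply: (intg_le _ (intgD (intgZ 2 (L2_tp (S 0%N)).2) (intgZ 2 ie))).
    exact: measurable_funX.
  move=> x; rewrite ger0_norm ?sqr_ge0//.
  have [Ex|Ex] := pselect (E x < +oo)%E; last first.
    by rewrite G0// expr0n addr_ge0// mulr_ge0// sqr_ge0.
  have := (hG x Ex).2 0%N; rewrite expr0 expr1n mulr1.
  have := sqr_ge0 (2 * tp (S 0%N) x - G x).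
  move: (tp _ x) (G x) (e x) => a b c; nra.
exists G; split=> //.
  move=> x k hk; rewrite /G pE//; case: ifP => // _.
  rewrite (_ : (fun n => tp (S n) (x + k)) = (fun n => tp (S n) x))//.
  by apply/funext => n; exact: tp_periodic.
exists (\int[mu]_x e x) => n.
rewrite -RintZr//.
pose F (x : V) := (tp (S n) x - G x) ^+ 2 * \1_[set x : V | (E x < +oo)%E] x.
have iF0 := (L2B (L2_tp (S n)) L2G).2.
have iF : intg mu F.
  apply: (@intg_bndr _ _ _ mu _ _ 1 mi _ iF0) => x.
  by rewrite indicE; case: (_ \in _); rewrite ?normr1 ?normr0.
have -> : \int[mu]_x ((tp (S n) x - G x) ^+ 2) = \int[mu]_x F x.
  apply: Rint_ae_eq; [exact: intg_measurable iF0|exact: intg_measurable iF|].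
  have iE' : mu.-integrable setT E.
    by apply/integrableP; split => //; under eq_integral do rewrite gee0_abs//.
  apply: ae_sub (integrable_ae measurableT iE') => x /(_ I).
  by rewrite /F indicE ge0_fin_numE// => Ex; rewrite mem_set// mulr1.
apply: Rint_le => //; first exact: intgZr.
move=> x; rewrite /F indicE; have [Ex|Ex] := pselect (E x < +oo)%E.
  by rewrite mem_set// mulr1; exact: (hG x Ex).2.
by rewrite memNset// mulr0 mulr_ge0// sqr_ge0.
Qed.

End RieszFischer.

End SquareIntegrable.

(** * The helicity as a limit of mollified helicities *)

Section HelicityLimit.
Context {R : realType}.
Local Notation V := (measurableTypeR R * measurableTypeR R * measurableTypeR R)%type.
Local Notation mu := (@tmu R).
Implicit Types (l : seq (R * freq * R)) (k : freq) (i j : 'I_3).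

Lemma kv_lattice k : lattice (kv k : vec R).
Proof. by move=> i; exists (fcoord k i); rewrite vcoord_kv. Qed.

Lemma lattice_kv (x : vec R) : lattice x -> exists k : freq, x = kv k.
Proof.
move=> h; have [a ha] := h o0; have [b hb] := h o1; have [c hc] := h o2.
exists (a, b, c); case: x h ha hb hc => [[x y] z] _ /= ha hb hc.
by rewrite /kv /= -ha -hb -hc.
Qed.

Lemma wsqr_kv k : (2 * pi) ^+ 2 * dot (kv k) (kv k) = wsqr k :> R.
Proof.
by rewrite /wsqr /dot mulr_sumr; apply: eq_bigr => i _; rewrite vcoord_kv /wave; ring.
Qed.

(** Pairings with single waves, of both parities, encode the Fourier
    coefficients. *)
Definition w1 k (b : R) : seq (R * freq * R) := [:: (1, k, b)].

Lemma tp_w1 k b : tp (w1 k b) = chr k b :> (vec R -> R).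
Proof. by apply/funext => x; rewrite tp_cons tp_nil addr0 mul1r. Qed.

Lemma cos_w1 k : (fun x : vec R => cos (2 * pi * dot (kv k) x)) = tp (w1 k 0).
Proof. by rewrite tp_w1; apply/funext => x; rewrite /chr addr0. Qed.

Lemma sin_w1 k : (fun x : vec R => sin (2 * pi * dot (kv k) x)) = tp (w1 k (- (pi / 2))).
Proof.
rewrite tp_w1; apply/funext => x; rewrite /chr -[RHS]opprK -cosDpi.
by rewrite -addrA (_ : - (pi / 2) + pi = pi / 2) ?cosDpihalf ?opprK//; field.
Qed.

Lemma fourier_coefE (T : (vec R -> R) -> R) k :
  fourier_coef T (kv k) = Complex (T (tp (w1 k 0))) (- T (tp (w1 k (- (pi / 2))))).
Proof. by rewrite /fourier_coef cos_w1 sin_w1. Qed.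

(** The defining property of the multiplied function, tested against real
    waves. *)
Definition has_multiplier (s : R) (T : (vec R -> R) -> R) (g : vec R -> R) :=
  torus_periodic g /\ L2 g /\ forall k b, b = 0 \/ b = - (pi / 2) ->
    \int[mu]_x (g x * tp (w1 k b) x) = wpow s k * T (tp (w1 k b)).

Lemma complexZ (c a b : R) : (c%:C * Complex a b)%C = Complex (c * a) (c * b).
Proof. by rewrite /GRing.mul /= !mul0r subr0 addr0. Qed.

Lemma frac_laplacian_setE s T :
  [set g | torus_L2 g /\ forall k : vec R, lattice k -> fourier_coef (distr_of_fun g) k =
      (((2 * pi) ^+ 2 * dot k k) `^ s)%:C%C * fourier_coef T k] =
  [set g : vec R -> R | has_multiplier s T g].
Proof.
apply/seteqP; split => g /=.
- move=> [/torus_L2P[pg Lg] hk]; split => //; split => // k b hb.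
  have := hk _ (kv_lattice k); rewrite !fourier_coefE wsqr_kv complexZ => -[e1 e2].
  case: hb => ->; first exact: e1.
  by apply: oppr_inj; rewrite -[RHS]mulrN; exact: e2.
- move=> [pg [Lg hk]]; split; first exact/torus_L2P.
  move=> x /lattice_kv[k ->]; rewrite !fourier_coefE wsqr_kv complexZ.
  have e1 := hk k 0 (or_introl erefl); have e2 := hk k (- (pi / 2)) (or_intror erefl).
  by rewrite mulrN -e2 -e1.
Qed.

Lemma chr_phase k b (x : vec R) :
  chr k b x = cos b * chr k 0 x + - sin b * chr k (- (pi / 2)) x.
Proof. by have := sin_w1 k; rewrite tp_w1 => /(congr1 (@^~ x)) <-; rewrite /chr addr0 cosD; ring. Qed.

(** The difference is orthogonal to every trigonometric polynomial. *)
Lemma multiplier_unique s T g g' : has_multiplier s T g -> has_multiplier s T g' ->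
  \forall x \ae mu, g x = g' x.
Proof.
move=> [_ [Lg hg]] [_ [Lg' hg']].
have Lh := L2B Lg Lg'.
have h0 k b : b = 0 \/ b = - (pi / 2) -> \int[mu]_x (chr k b x * (g x - g' x)) = 0.
  move=> hb; rewrite -tp_w1.
  rewrite (Rint_ext _ (g := fun x : V => g x * tp (w1 k b) x - g' x * tp (w1 k b) x)); last first.
    by move=> x; ring.
  rewrite RintB; [|exact: L2M Lg (L2_tp _)|exact: L2M Lg' (L2_tp _)].
  by rewrite hg// hg'// subrr.
have h : forall l, \int[mu]_x (tp l x * (g x - g' x)) = 0.
  elim=> [|t l IH].
    by rewrite -[RHS](Rint_0 mu); apply: Rint_ext => x; rewrite tp_nil mul0r.
  have i0 b : intg mu (fun x => chr t.1.2 b x * (g x - g' x)).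
    by rewrite -tp_w1; exact: L2M (L2_tp _) Lh.
  rewrite (Rint_ext _ (g := fun x : V => t.1.1 * cos t.2 * (chr t.1.2 0 x * (g x - g' x)) +
     t.1.1 * - sin t.2 * (chr t.1.2 (- (pi / 2)) x * (g x - g' x)) + tp l x * (g x - g' x))); last first.
    by move=> x; rewrite tp_cons (chr_phase _ t.2); ring.
  have j1 := intgZ (t.1.1 * cos t.2) (i0 0); have j2 := intgZ (t.1.1 * - sin t.2) (i0 (- (pi / 2))).
  rewrite (RintD (intgD j1 j2) (L2M (L2_tp l) Lh)) (RintD j1 j2) IH RintZ// RintZ//.
  by rewrite !h0 ?mulr0 ?addr0//; [right|left].
apply: ae_sub (orth_ae0 (L2_intg Lh) h) => x /eqP; by rewrite subr_eq0 => /eqP.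
Qed.

(** The function chosen by the definition agrees with any explicit
    candidate, up to a null set. *)
Lemma frac_laplacian_ae s T g : has_multiplier s T g ->
  has_multiplier s T (frac_laplacian s T) /\ \forall x \ae mu, frac_laplacian s T x = g x.
Proof.
move=> hg; have h : has_multiplier s T (frac_laplacian s T).
  have : [set g : vec R -> R | has_multiplier s T g] (frac_laplacian s T).
    by rewrite /frac_laplacian frac_laplacian_setE; exact: xgetPex (ex_intro _ g hg).
  by [].
split=> //; exact: multiplier_unique h hg.
Qed.

(** Fourier coefficients pass to the limit on both sides: along P by
    hypothesis, and along the multiplied sequence by convergence in norm. *)
Lemma multiplier_limit (r : R) s T (P : nat -> seq (R * freq * R)) (C : R) : 0 < r < 1 -> 0 <= C ->
  (forall k b, geo r (fun n => \int[mu]_x (tp (P n) x * tp (w1 k b) x)) (T (tp (w1 k b)))) ->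
  (forall n, \int[mu]_x ((tp (multT (wpow s) (P n.+1)) x - tp (multT (wpow s) (P n)) x) ^+ 2)
     <= C * (r ^+ n) ^+ 4) ->
  exists g, has_multiplier s T g /\ L2geo r (fun n => tp (multT (wpow s) (P n))) g.
Proof.
move=> r01 C0 hT hP; have [g [pg Lg gg]] := riesz_fischer r01 C0 hP.
exists g; split=> //; split=> //; split=> // k b _.
apply: (geo_unique r01 (L2geo_pairing r01 _ Lg (L2_tp _) gg)); first by move=> n; exact: L2_tp.
apply: geo_ext (geoZ (wpow s k) (hT k b)) => n.
rewrite pairing_multT; last exact: wpowN.
rewrite -RintZ; last exact: intg_tp2.
by apply: Rint_ext => x; rewrite /w1 /multT /tp /= !big_seq1 /=; ring.
Qed.

Section Field.
Variables (theta A : R) (f : vec R -> vec R).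
Hypothesis theta01 : 1 / 2 < theta < 1.
Hypothesis A0 : 0 <= A.
Hypothesis rf : rough theta A (comp f).
Let u := comp f.
Let tu := rough_tame rf.

Let theta_01 : 0 < theta < 1.
Proof. by case/andP: theta01 => h1 ->; rewrite andbT; apply: lt_trans h1; rewrite divr_gt0. Qed.

(** Chosen so that r ^ 4 = 2 ^ (1 - 2 theta), the ratio of the squared norms
    of consecutive increments; the convergence in [riesz_fischer] loses one
    square. *)
Definition rate (th : R) : R := 2 `^ ((1 - 2 * th) / 4).

Let r := rate theta.

Lemma rate01 : 0 < r < 1.
Proof.
have s0 : 0 < (2 * theta - 1) / 4 by case/andP: theta01 => h1 h2; lra.
rewrite /r /rate powR_gt0//= (_ : (1 - 2 * theta) / 4 = - ((2 * theta - 1) / 4)); last by field.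
rewrite powRN invf_lt1 ?powR_gt0// //.
have e1 : 1 = 1 `^ ((2 * theta - 1) / 4) :> R by rewrite powR1.
rewrite [ltLHS]e1.
by apply: gt0_ltr_powR; rewrite // ?nnegrE// ltr1n.
Qed.

Lemma powR_2X n (a : R) : (2 ^ n)%:R `^ a = (2 `^ a) ^+ n.
Proof. by rewrite natrX -powR_mulrn// -powRrM mulrC powRrM powR_mulrn ?powR_ge0. Qed.

Lemma rate_scale n : (2 ^ n)%:R * ((2 ^ n)%:R `^ (theta * 2))^-1 = (r ^+ n) ^+ 4.
Proof.
have e : r ^+ 4 = 2 * (2 `^ (theta * 2))^-1.
  rewrite /r /rate -powR_mulrn ?powR_ge0// -powRrM.
  rewrite (_ : (1 - 2 * theta) / 4 * 4%:R = 1 + - (theta * 2)); last by field.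
  by rewrite powRD ?powRr1// ?powRN// pnatr_eq0 implybT.
by rewrite powR_2X -exprVn natrX -exprMn -e -!exprM mulnC.
Qed.

Lemma u_L2 i : L2 (u i).
Proof.
split; first exact: (tame_meas tu).
by apply: (@intg_eq _ _ _ mu _ _ _ (intg_uu tu i i)) => x; rewrite expr2.
Qed.

Let M : R := 104 * CK ^+ 2 * (4 * (1 + A)).

Lemma M_ge0 : 0 <= M.
Proof. exact: mulr_ge0 (mulr_ge0 (ler0n _ 104) (sqr_ge0 _)) (mulr_ge0 (ler0n _ 4) (addr_ge0 ler01 A0)). Qed.

Let pos2 n : (0 < 2 ^ n)%N. Proof. by rewrite expn_gt0. Qed.

Lemma Qf_dyadic i n : Qf (wpow (1 / 2)) (diffT u (2 ^ n) i) * 4 <= M * (r ^+ n) ^+ 4.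
Proof.
have h := Qf_half_diffT theta_01 rf A0 i (pos2 n).
rewrite -rate_scale; apply: (le_trans (ler_wpM2r (ler0n _ 4) h)).
by rewrite le_eqVlt; apply/orP; left; apply/eqP; rewrite /M /BN; ring.
Qed.

Lemma mT_L2geo i : L2geo r (fun n => tp (mT u (2 ^ n) i)) (u i).
Proof.
have /andP[r0 r1] := rate01.
exists (4 * CK ^+ 2 * (1 + A)) => n.
have h0 : 0 <= 4 * CK ^+ 2 :> R by rewrite mulr_ge0 ?sqr_ge0.
have i2 := intg_osc tu (2 ^ n) (isT : 2 <= 3)%N.
apply: (@le_trans _ _ (\int[mu]_x (4 * CK ^+ 2 * osc u (2 ^ n) x ^+ 2))).
  apply: Rint_le; [exact: (L2B (L2_tp _) (u_L2 i)).2|exact: intgZ|] => x.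
  have h := mT_near tu i x (pos2 n).
  rewrite -[leLHS]real_normK ?num_real//.
  apply: le_trans (_ : (2 * CK * osc u (2 ^ n) x) ^+ 2 <= _).
    by rewrite lerXn2r ?nnegrE// (le_trans _ h).
  by rewrite le_eqVlt; apply/orP; left; apply/eqP; ring.
rewrite RintZ// -[leRHS]mulrA; apply: (ler_wpM2l h0).
apply: (le_trans (Rint_osc2 rf (pos2 n))); apply: ler_wpM2l; first exact: addr_ge0.
apply: (@le_trans _ _ ((r ^+ n) ^+ 4)).
  by rewrite -rate_scale ler_peMl ?invr_ge0 ?powR_ge0// ler1n.
by rewrite ler_wiXn2l// ?exprn_ge0 ?exprn_ile1 ?(ltW r0) ?(ltW r1).
Qed.

Lemma velocity_multiplier i : exists g,
  has_multiplier (1 / 4) (distr_of_fun (fun y => vcoord (f y) i)) g /\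
  L2geo r (fun n => tp (multT (wpow (1 / 4)) (mT u (2 ^ n) i))) g.
Proof.
apply: (multiplier_limit rate01 M_ge0).
  move=> k b; apply: L2geo_pairing rate01 _ (u_L2 i) (L2_tp _) (mT_L2geo i).
  by move=> n; exact: L2_tp.
move=> n; apply: le_trans (Qf_dyadic i n).
rewrite -norm_mult_quarter.
rewrite (Rint_ext _ (g := fun x : V => tp (multT (wpow (1 / 4)) (diffT u (2 ^ n) i)) x *
   tp (multT (wpow (1 / 4)) (diffT u (2 ^ n) i)) x)); last first.
  by move=> x; rewrite /diffT multT_cat tp_cat multT_scale tp_scale mulN1r -expnS expr2.
apply: ler_peMr; last by rewrite ler1n.
by apply: Rint_ge0 => x; rewrite -expr2 sqr_ge0.
Qed.

Lemma curl_distrE g i l : curl_distr g i (tp l) =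
  \int[mu]_x (vcoord (g x) (i + 1) * tp (dT (i + 2%:R) l) x) -
  \int[mu]_x (vcoord (g x) (i + 2%:R) * tp (dT (i + 1) l) x).
Proof.
have e (a : V -> R) j : - distr_partial j (distr_of_fun a) (tp l) = \int[mu]_x (a x * tp (dT j l) x).
  rewrite /distr_partial opprK; apply: Rint_ext => x.
  exact: (congr1 (fun z => a x * z) (@derive_val _ _ _ _ _ _ _ (is_derive_dT j l x))).
have e1 := e (fun x => vcoord (g x) (i + 1)) (i + 2%:R).
have e2 := e (fun x => vcoord (g x) (i + 2%:R)) (i + 1).
exact: etrans (addrC _ _) (f_equal2 +%R e1 (etrans (esym (opprK _)) (congr1 -%R e2))).
Qed.

Lemma curl_multiplier i : exists g,
  has_multiplier (- (1 / 4)) (curl_distr f i) g /\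
  L2geo r (fun n => tp (multT (wpow (- (1 / 4))) (curlT (mT u (2 ^ n)) i))) g.
Proof.
apply: (multiplier_limit rate01 M_ge0).
  move=> k b; rewrite curl_distrE.
  have h j l : geo r (fun n => \int[mu]_x (tp (mT u (2 ^ n) j) x * tp l x)) (\int[mu]_x (u j x * tp l x)).
    apply: L2geo_pairing rate01 _ (u_L2 j) (L2_tp _) (mT_L2geo j).
    by move=> n; exact: L2_tp.
  have := geoD (h (i + 1) (dT (i + 2%:R) (w1 k b))) (geoZ (-1) (h (i + 2%:R) (dT (i + 1) (w1 k b)))).
  rewrite mulN1r; apply: geo_ext => n.
  by rewrite Rint_curlM !tp_by_parts; ring.
move=> n; set d := diffT u (2 ^ n).
pose a j l := multT (wpow (- (1 / 4))) (dT j l).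
have e x : tp (multT (wpow (- (1 / 4))) (curlT (mT u (2 ^ n.+1)) i)) x -
    tp (multT (wpow (- (1 / 4))) (curlT (mT u (2 ^ n)) i)) x =
    tp (a (i + 1) (d (i + 2%:R))) x - tp (a (i + 2%:R) (d (i + 1))) x.
  rewrite /curlT /a /d /diffT -expnS !dT_cat !multT_cat !dT_scale !multT_scale !tp_cat !tp_scale.
  ring.
have b1 := norm_mult_quarterN (i + 1) (d (i + 2%:R)).
have b2 := norm_mult_quarterN (i + 2%:R) (d (i + 1)).
have q1 := Qf_dyadic (i + 2%:R) n; have q2 := Qf_dyadic (i + 1) n.
rewrite -/d in q1 q2.
apply: (@le_trans _ _ (\int[mu]_x (2 * (tp (a (i + 1) (d (i + 2%:R))) x * tp (a (i + 1) (d (i + 2%:R))) x)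
  + 2 * (tp (a (i + 2%:R) (d (i + 1))) x * tp (a (i + 2%:R) (d (i + 1))) x)))).
  apply: Rint_le; [exact: (L2B (L2_tp _) (L2_tp _)).2|by apply: intgD; apply: intgZ; exact: intg_tp2|].
  move=> x; rewrite e; move: (tp _ x) (tp _ x) => p q.
  rewrite -subr_ge0 (_ : _ - _ = (p + q) ^+ 2) ?sqr_ge0//; ring.
rewrite RintD; [|by apply: intgZ; exact: intg_tp2..].
rewrite RintZ ?RintZ; [|exact: intg_tp2..].
rewrite -/(a _ _) in b1; rewrite -/(a _ _) in b2.
move: (\int[mu]_x _) (\int[mu]_x _) (Qf _ _) (Qf _ _) (M * _) b1 b2 q1 q2 => p q s t z; lra.
Qed.

(** The two quarter powers are adjoint to each other and cancel on a curl. *)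
Lemma hel_multipliers n : hel u (2 ^ n) =
  \sum_i \int[mu]_x (tp (multT (wpow (1 / 4)) (mT u (2 ^ n) i)) x *
     tp (multT (wpow (- (1 / 4))) (curlT (mT u (2 ^ n)) i)) x).
Proof.
apply: eq_bigr => i _; rewrite pairing_multT; last exact: wpowN.
apply: Rint_ext => x; rewrite multT_comp /curlT multT_cat multT_scale !tp_cat !tp_scale.
by rewrite !quarter_cancel.
Qed.

(** Both factors of the integral defining the helicity are limits in norm of
    multiplied mollifications, so the helicity is the limit of their
    pairings. *)
Lemma hel_cvg : geo r (fun n => hel u (2 ^ n)) (helicity f).
Proof.
have /choice[g hg] := velocity_multiplier; have /choice[g' hg'] := curl_multiplier.
pose F i := frac_laplacian (1 / 4) (distr_of_fun (fun y => vcoord (f y) i)).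
pose F' i := frac_laplacian (- (1 / 4)) (curl_distr f i).
have hF i := frac_laplacian_ae (hg i).1; have hF' i := frac_laplacian_ae (hg' i).1.
have -> : helicity f = \sum_i \int[mu]_x (g i x * g' i x).
  have iF i : intg mu (fun x => F i x * F' i x).
    by apply: L2M; [exact: (hF i).1.2.1|exact: (hF' i).1.2.1].
  transitivity (\int[mu]_x (\sum_i F i x * F' i x)); first by [].
  rewrite (Rint_sum _ iF); apply: eq_bigr => i _.
  have Lg := (hg i).1.2.1; have Lg' := (hg' i).1.2.1.
  apply: Rint_ae_eq; [exact: intg_measurable (iF i)|exact: intg_measurable (L2M Lg Lg')|].
  by apply: ae_sub (ae_and (hF i).2 (hF' i).2) => x [<- <-].
apply: geo_ext (geo_sum _ _).
  move=> n; rewrite hel_multipliers; exact: erefl.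
move=> i; apply: L2geo_pairing2 rate01 _ _ (hg i).1.2.1 (hg' i).1.2.1 (hg i).2 (hg' i).2;
  by move=> n; exact: L2_tp.
Qed.

(** Sum the geometric series of the increments of [hel_diff]. *)
Lemma hel_approx n :
  `|hel u (2 ^ n) - helicity f| <= 48 * CK ^+ 2 * (4 * (1 + A)) / (1 - r ^+ 4) * (r ^+ n) ^+ 4.
Proof.
have /andP[r0 r1] := rate01.
have r4 : 0 < r ^+ 4 < 1 by rewrite exprn_gt0//= exprn_ilt1// ltW.
have m0 : 0 <= 48 * CK ^+ 2 * (4 * (1 + A)).
  exact: mulr_ge0 (mulr_ge0 (ler0n _ 48) (sqr_ge0 _)) (mulr_ge0 (ler0n _ 4) (addr_ge0 ler01 A0)).
have [n'|l [cl hl]] := geo_cauchy (a := fun n => hel u (2 ^ n)) m0 r4 _.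
  rewrite -exprM mulnC exprM -rate_scale expnS.
  apply: (le_trans (hel_diff theta_01 rf A0 (pos2 n'))).
  by rewrite le_eqVlt; apply/orP; left; apply/eqP; rewrite /BN; ring.
have -> : helicity f = l by apply: (cvg_unique _ (geo_cvg rate01 hel_cvg) cl).
apply: (le_trans (hl n)); rewrite le_eqVlt; apply/orP; left; apply/eqP.
by rewrite -exprM mulnC exprM mulrAC.
Qed.

End Field.

End HelicityLimit.

(** * Smooth test functions *)

Section Towers.
Context {R : realType}.

(** All the derivatives are given at once, which avoids an induction on the
    order of differentiability. *)
Definition tower (c : nat -> R -> R) := forall n (x : R), is_derive x 1 (c n) (c n.+1 x).

(** ** The flat exponential *)

(** The classical flat function exp(- 1 / x), divided by x ^ m so that the
    family is closed under differentiation. *)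
Definition flat m (x : R) : R := if 0 < x then (x^-1) ^+ m * expR (- x^-1) else 0.

Lemma flat_le0 m (x : R) : x <= 0 -> flat m x = 0.
Proof. by rewrite /flat leNgt => /negbTE ->. Qed.

Lemma flat_ge0 m x : 0 <= flat m x.
Proof.
by rewrite /flat; case: ifP => // x0; rewrite mulr_ge0 ?expR_ge0// exprn_ge0// invr_ge0 ltW.
Qed.

Lemma flat0_le1 x : flat 0 x <= 1.
Proof.
rewrite /flat; case: ifP => // x0; rewrite expr0 mul1r -expR0 ler_expR oppr_le0 invr_ge0; exact: ltW.
Qed.

(** The exponential series at 1 / x dominates any power of 1 / x; the
    exponent m + 2 leaves a square. *)
Lemma flat_sqr m x : flat m x <= (m.+2)`!%:R * x ^+ 2.
Proof.
rewrite /flat; case: ifP => [x0|_]; last by rewrite mulr_ge0 ?sqr_ge0.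
have h := expR_ge1Dxn m.+1 (ltW (eq_ind_r is_true x0 (invr_gt0 x))).
rewrite expRN ler_pdivrMr ?expR_gt0//.
have e : (x^-1) ^+ m.+2 <= (m.+2)`!%:R * expR x^-1.
  rewrite mulrC -ler_pdivrMr ?ltr0n ?fact_gt0//; apply: le_trans h.
  by rewrite lerDr.
have -> : x^-1 ^+ m = x ^+ 2 * x^-1 ^+ m.+2.
  rewrite -[m.+2]addn2 exprD mulrCA -exprMn divff ?gt_eqF// expr1n mulr1//.
have -> : (m.+2)`!%:R * x ^+ 2 * expR x^-1 = x ^+ 2 * ((m.+2)`!%:R * expR x^-1) by ring.
exact: (ler_wpM2l (sqr_ge0 x) e).
Qed.

Lemma is_derive_flat0 (f : R -> R) (C : R) : (forall x, `|f x| <= C * x ^+ 2) ->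
  is_derive (0 : R) 1 f 0.
Proof.
move=> hf; have f0 : f 0 = 0.
  by apply/eqP; rewrite -normr_le0 (le_trans (hf 0))// expr0n mulr0.
have C0 : 0 <= C by have := le_trans (normr_ge0 _) (hf 1); rewrite expr1n mulr1.
have h : h^-1 *: ((f \o shift 0) (h *: (1 : R)) - f 0) @[h --> 0^'] --> (0 : R).
  apply/cvgrPdist_lt => e e0; near=> h.
  rewrite /= sub0r normrN addr0 f0 subr0 /GRing.scale /= mulr1 normrM normfV.
  have h0 : h != 0 by near: h; exact: nbhs_dnbhs_neq.
  have hh : `|h| < e / (C + 1).
    near: h; apply: dnbhs0_lt; rewrite divr_gt0// ltr_pwDr//.
  rewrite mulrC ltr_pdivrMr ?normr_gt0//; apply: (le_lt_trans (hf h)).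
  rewrite -[h ^+ 2]real_normK ?num_real// expr2 mulrA ltr_pM2r ?normr_gt0//.
  rewrite ltr_pdivlMr ?ltr_pwDr// in hh; apply: le_lt_trans hh.
  by rewrite mulrC ler_wpM2l// lerDl.
by split; [apply/cvg_ex; exists 0 | exact: cvg_lim h].
Unshelve. all: by end_near.
Qed.

Lemma is_derive_flat m (x : R) :
  is_derive x 1 (flat m) (- m%:R * flat m.+1 x + flat m.+2 x).
Proof.
have [x0|x0|->] := ltgtP x 0.
- rewrite !(flat_le0 _ (ltW x0)) mulr0 addr0.
  apply: near_eq_is_derive (is_derive_cst (0 : R) x 1).
  near=> y; rewrite flat_le0//; apply: ltW; near: y; exact: lt_nbhsl.
- pose g := (fun y : R => y^-1) ^+ m * (expR \o (fun y : R => - y^-1)).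
  have dV : is_derive x 1 (fun y : R => y^-1) (- x ^- 2).
    have := @is_deriveV R (id : R -> R) x 1 1 _ (is_derive_id _ _).
    move=> /(_ (lt0r_neq0 x0)) h; apply: is_derive_eq h _.
    by rewrite /GRing.scale /= mulr1.
  have dE : is_derive x 1 (expR \o (fun y : R => - y^-1)) (expR (- x^-1) * x ^- 2).
    have dN := is_deriveN dV; rewrite opprK in dN.
    exact: (@is_derive1_comp R expR (fun y => - y^-1) x _ _ (is_derive_expR _) dN).
  have dg : is_derive x 1 g (- m%:R * flat m.+1 x + flat m.+2 x).
    apply: is_derive_eq (is_deriveM (is_deriveX m dV) dE) _.
    rewrite /flat x0 /GRing.scale /= fctE -exprVn.
    by case: m g => [|m] g /=; rewrite ?mul0r ?oppr0 ?exprS ?expr0; ring.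
  apply: near_eq_is_derive dg.
  near=> y; rewrite /flat; have -> : 0 < y by near: y; exact: lt_nbhsr.
  have ex (f : R -> R) k z : (f ^+ k) z = f z ^+ k by elim: k => [|k IH]; rewrite ?expr0// !exprS -IH.
  by rewrite /g /GRing.mul /= ex.
- rewrite !flat_le0// mulr0 addr0; apply: (@is_derive_flat0 _ (m.+2)`!%:R) => y.
  by rewrite ger0_norm ?flat_ge0// flat_sqr.
Unshelve. all: by end_near.
Qed.

(** ** A bump on the unit interval *)

(** Linear combinations of products of flat functions at both ends of the
    unit interval, closed under differentiation. *)
Definition bterm (s : seq (R * nat * nat)) (x : R) : R :=
  \sum_(t <- s) t.1.1 * (flat t.1.2 x * flat t.2 (1 - x)).

Definition dterm (s : seq (R * nat * nat)) := flatten
  [seq [:: (- t.1.1 * t.1.2%:R, t.1.2.+1, t.2); (t.1.1, t.1.2.+2, t.2);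
           (t.1.1 * t.2%:R, t.1.2, t.2.+1); (- t.1.1, t.1.2, t.2.+2)] | t <- s].

Lemma is_derive_bterm s (x : R) : is_derive x 1 (bterm s) (bterm (dterm s) x).
Proof.
elim: s => [|t s IH].
  rewrite /bterm big_nil (_ : (fun _ => _) = cst 0); first exact: is_derive_cst.
  by apply/funext => y; rewrite big_nil.
have -> : bterm (t :: s) = t.1.1 \*: (flat t.1.2 * (flat t.2 \o (fun y => 1 - y))) + bterm s.
  by apply/funext => y; rewrite /bterm big_cons.
have dr : is_derive x 1 (fun y : R => 1 - y) (-1).
  by have := is_deriveB (is_derive_cst (1 : R) x 1) (is_derive_id x 1); rewrite sub0r.
have d1 := @is_derive1_comp R (flat t.2) (fun y => 1 - y) _ _ _ (is_derive_flat t.2 (1 - x)) dr.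
apply: is_derive_eq (is_deriveD (is_deriveZ t.1.1 (is_deriveM (is_derive_flat t.1.2 x) d1)) IH) _.
rewrite /bterm /= !big_cons /GRing.scale /= addrA addrA addrA; congr (_ + _); ring.
Qed.

Definition bump_tower n := bterm (iter n dterm [:: (1, 0%N, 0%N)]).

Lemma bump_towerP : tower bump_tower.
Proof. by move=> n x; exact: is_derive_bterm. Qed.

Lemma bump_towerE x : bump_tower 0 x = flat 0 x * flat 0 (1 - x).
Proof. by rewrite /bump_tower /bterm /= big_seq1 mul1r. Qed.

Lemma bterm_out s x : ~~ (0 < x < 1) -> bterm s x = 0.
Proof.
rewrite negb_and -!leNgt => /orP h; rewrite /bterm big1// => t _.
case: h => h; first by rewrite (flat_le0 _ h) mul0r mulr0.
by rewrite (flat_le0 t.2 (_ : 1 - x <= 0)) ?mulr0// subr_le0.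
Qed.

Lemma is_derive_continuous (f : R -> R) (x d : R) : is_derive x 1 f d -> {for x, continuous f}.
Proof.
by move=> [h _]; apply: differentiable_continuous; apply/derivable1_diffP.
Qed.

Local Notation b := (bump_tower 0).
Local Notation leb := (@lebesgue_measure R).

Lemma bump_continuous : continuous b.
Proof. by move=> x; exact: is_derive_continuous (bump_towerP 0 x). Qed.

Lemma bump_ge0 x : 0 <= b x. Proof. by rewrite bump_towerE mulr_ge0 ?flat_ge0. Qed.

Lemma bump_le1 x : b x <= 1.
Proof. by rewrite bump_towerE mulr_ile1 ?flat_ge0 ?flat0_le1. Qed.

Lemma bump_gt0 x : 0 < x < 1 -> 0 < b x.
Proof.
move=> /andP[x0 x1]; rewrite bump_towerE /flat x0 subr_gt0 x1 !expr0 !mul1r.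
by rewrite mulr_gt0 ?expR_gt0.
Qed.

Lemma bump_out x : ~~ (0 < x < 1) -> b x = 0.
Proof. exact: bterm_out. Qed.

Lemma measurable_bump : measurable_fun setT (b : measurableTypeR R -> R).
Proof. by apply: continuous_measurable_fun; exact: bump_continuous. Qed.

Lemma bump_integrable (D : set R) : measurable D -> leb.-integrable D (EFin \o b).
Proof.
move=> mD; apply: (integrableS measurableT) => //.
apply: (@le_integrable _ _ _ leb setT measurableT _ (EFin \o \1_(`[0, 1] : set R))).
- by apply/measurable_EFinP; exact: measurable_bump.
- move=> x _ /=; rewrite lee_fin !ger0_norm ?bump_ge0// indicE.
  have [h|h] := boolP (0 < x < 1).
    rewrite mem_set ?bump_le1//= in_itv /=; case/andP: h => h1 h2; by rewrite !ltW.
  by rewrite bump_out.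
- by apply: integrable_indic_itv.
Qed.

Definition mass (x : R) : R := \int[leb]_(t in `]-oo, x]) b t.

Lemma is_derive_mass (x : R) : is_derive x 1 mass (b x).
Proof.
have [|h1 h2] := @continuous_FTC1 R b -oo%O x (x + 1) (ltr_pwDr ltr01 (lexx x))
  (bump_integrable (measurable_itv _)) _ (@bump_continuous x).
  by rewrite ltNyr.
by split; [exact: h1 | exact: etrans (esym (derive1E _ _)) h2].
Qed.

Lemma mass_MVT x y : x <= y -> exists2 c : R, c \in `[x, y] & mass y - mass x = b c * (y - x).
Proof.
move=> xy; apply: MVT_segment => // [z _|]; first exact: is_derive_mass.
by apply: continuous_subspaceT => z; exact: is_derive_continuous (is_derive_mass z).
Qed.

(** A smooth step, constant outside of the unit interval. *)
Definition step (x : R) : R := mass x - mass 0.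

(** The height of the step; its value is not normalized to 1, and cancels in
    the end. *)
Definition jump : R := step 1.

Lemma is_derive_step (x : R) : is_derive x 1 step (b x).
Proof.
by apply: is_derive_eq (is_deriveB (is_derive_mass x) (is_derive_cst (mass 0) x 1)) _; rewrite subr0.
Qed.

Lemma step_le0 x : x <= 0 -> step x = 0.
Proof.
move=> x0; have [c] := mass_MVT x0; rewrite in_itv/= => /andP[_ c0] e.
rewrite /step -opprB e bump_out ?mul0r ?oppr0// negb_and -leNgt c0//.
Qed.

Lemma step_ge1 x : 1 <= x -> step x = jump.
Proof.
move=> x1; have [c] := mass_MVT x1; rewrite in_itv/= => /andP[c1 _] e.
apply/eqP; rewrite -subr_eq0 /jump /step opprB addrA subrK e bump_out ?mul0r//.
by rewrite negb_and -!leNgt c1 orbT.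
Qed.

Lemma step_nondecreasing x y : x <= y -> step x <= step y.
Proof.
move=> xy; have [c _ e] := mass_MVT xy.
by rewrite lerD2r -subr_ge0 e mulr_ge0 ?bump_ge0// subr_ge0.
Qed.

Lemma jump_gt0 : 0 < jump.
Proof.
have [|c hc e] := @MVT _ mass b 0 1 ltr01 (fun z _ => is_derive_mass z).
  by apply: continuous_subspaceT => z; exact: is_derive_continuous (is_derive_mass z).
rewrite in_itv/= in hc; rewrite /jump /step e subr0 mulr1; exact: bump_gt0.
Qed.

Lemma step_ge0 x : 0 <= step x.
Proof.
have [x0|x0] := leP x 0; first by rewrite step_le0.
by rewrite -(step_le0 (lexx 0)) step_nondecreasing// ltW.
Qed.

Lemma step_le_jump x : step x <= jump.
Proof.
have [x1|x1] := leP 1 x; first by rewrite step_ge1.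
by rewrite /jump step_nondecreasing// ltW.
Qed.

(** ** Rescaling *)

(** The n-th derivative picks up the factor d ^ (- n). *)
Definition rescale (d s : R) (c : nat -> R -> R) n (t : R) : R := d ^- n * c n (d^-1 * t + - s / d).

Lemma rescaleP d s c : tower c -> tower (rescale d s c).
Proof.
move=> tc n t.
have h := @is_derive1_comp R (c n) (fun y => d^-1 * y + - s / d) _ _ _ (tc n (d^-1 * t + - s / d)) (is_derive_affine d^-1 (- s / d) t).
apply: is_derive_eq (is_deriveZ (d ^- n) h) _.
by rewrite /rescale /GRing.scale /= exprS invfM; ring.
Qed.

Definition step_tower n := if n is n'.+1 then bump_tower n' else step.

Lemma step_towerP : tower step_tower.
Proof. by case=> [|n] x; [exact: is_derive_step|exact: bump_towerP]. Qed.

Lemma towerB c c' : tower c -> tower c' -> tower (fun n t => c n t - c' n t).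
Proof. by move=> h h' n x; exact: is_deriveB. Qed.

Lemma tower_continuous c n : tower c -> continuous (c n).
Proof. by move=> h x; exact: is_derive_continuous (h n x). Qed.

End Towers.

(** * Test functions on space-time *)

Section SpaceTimeTest.
Context {R : realType}.
Local Notation W := (vec R * R)%type.
Implicit Types (l : seq (R * freq * R)) (z v : W).
Variable c : nat -> R -> R.
Hypothesis tc : tower c.

(** Finite sums of products of a derivative of the time profile and a
    trigonometric polynomial: a class closed under directional derivatives. *)
Definition stf (s : seq (nat * seq (R * freq * R))) z : R :=
  \sum_(r <- s) c r.1 z.2 * tp r.2 z.1.

Definition gradT (w : vec R) l := [seq (t.1.1 * (2 * pi * dot (kv t.1.2) w), t.1.2, t.2 + pi / 2) | t <- l].

Definition dst v (s : seq (nat * seq (R * freq * R))) := flatten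
  [seq [:: (r.1.+1, scaleT v.2 r.2); (r.1, gradT v.1 r.2)] | r <- s].

Lemma is_derive_gradT l (x w : vec R) : is_derive x w (tp l) (tp (gradT w l) x).
Proof.
apply: is_derive_eq (is_derive_tp l x w) _.
rewrite /gradT /tp big_map; apply: eq_bigr => t _ /=; by rewrite chr_quarter mulrA.
Qed.

(** This carries a directional derivative over to a function of more
    variables, which has the same restriction to the line. *)
Lemma is_derive_on_line (U : normedModType R) (f : U -> R) (a v : U) (d : R) :
  is_derive a v f d -> is_derive (0 : R) 1 (fun s : R => f (s *: v + a)) d.
Proof.
move=> [h1 h2].
have e : (fun h : R => h^-1 *: (((fun s : R => f (s *: v + a)) \o shift 0) (h *: (1 : R)) -
      f (0 *: v + a))) = (fun h => h^-1 *: ((f \o shift a) (h *: v) - f a)).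
  by apply/funext => h; rewrite /= addr0 scale0r add0r /GRing.scale /= mulr1.
split; first by rewrite /derivable e.
by rewrite /derive e.
Qed.

Lemma is_derive_time n z v : is_derive z v (fun z : W => c n z.2) (v.2 * c n.+1 z.2).
Proof.
apply: is_derive_line.
have h := @is_derive1_comp R (c n) (fun y => v.2 * y + z.2) 0 _ _ _ (is_derive_affine v.2 z.2 0).
have := h _ (tc n (v.2 * 0 + z.2)).
rewrite mulr0 add0r mulrC.
by rewrite (_ : _ \o _ = (fun s : R => c n (s *: v + z).2))//; apply/funext => s /=; rewrite mulrC.
Qed.

Lemma is_derive_space l z v : is_derive z v (fun z : W => tp l z.1) (tp (gradT v.1 l) z.1).
Proof.
apply: is_derive_line.
exact: (is_derive_on_line (is_derive_gradT l z.1 v.1)).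
Qed.

Lemma is_derive_stf s z v : is_derive z v (stf s) (stf (dst v s) z).
Proof.
elim: s => [|r s IH].
  rewrite /stf big_nil (_ : (fun _ => _) = cst 0); first exact: is_derive_cst.
  by apply/funext => y; rewrite big_nil.
have -> : stf (r :: s) = (fun z : W => c r.1 z.2) * (fun z : W => tp r.2 z.1) + stf s.
  by apply/funext => y; rewrite /stf big_cons.
apply: is_derive_eq (is_deriveD (is_deriveM (is_derive_time r.1 z v) (is_derive_space r.2 z v)) IH) _.
rewrite /stf /= !big_cons /= tp_scale /GRing.scale /=; ring.
Qed.

Lemma continuous_dot (w : vec R) : continuous (dot w).
Proof.
have -> : dot w = (fun y : vec R => w.1.1 * y.1.1 + w.1.2 * y.1.2 + w.2 * y.2).
  by apply/funext => y; rewrite dotE.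
move=> x; apply: cvgD; [apply: cvgD|]; apply: cvgMr.
- apply: (@continuous_comp _ _ _ (fst : vec R -> R * R) (fst : R * R -> R)); exact: cvg_fst.
- apply: (@continuous_comp _ _ _ (fst : vec R -> R * R) (snd : R * R -> R)); [exact: cvg_fst|exact: cvg_snd].
- exact: cvg_snd.
Qed.

Lemma continuous_tp l : continuous (tp l : vec R -> R).
Proof.
elim: l => [|t l IH] x.
  by rewrite (_ : tp [::] = cst 0); [exact: cvg_cst|apply/funext => y; rewrite tp_nil].
rewrite (_ : tp (t :: l) = fun y => t.1.1 * chr t.1.2 t.2 y + tp l y); last first.
  by apply/funext => y; rewrite tp_cons.
apply: cvgD; last exact: IH; apply: cvgMr.
rewrite /chr; apply: continuous_comp; last exact: continuous_cos.
apply: cvgD; last exact: cvg_cst; apply: cvgMr.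
exact: continuous_dot.
Qed.

Lemma continuous_stf s : continuous (stf s).
Proof.
elim: s => [|r s IH] z.
  rewrite (_ : stf [::] = cst 0); first exact: cvg_cst.
  by apply/funext => y; rewrite /stf big_nil.
rewrite (_ : stf (r :: s) = fun y => c r.1 y.2 * tp r.2 y.1 + stf s y); last first.
  by apply/funext => y; rewrite /stf big_cons.
apply: cvgD; last exact: IH; apply: cvgM.
  apply: (@continuous_comp _ _ _ (snd : W -> R) (c r.1)); first exact: cvg_snd.
  exact: tower_continuous.
apply: (@continuous_comp _ _ _ (fst : W -> vec R) (tp r.2)); first exact: cvg_fst.
exact: continuous_tp.
Qed.

Lemma iter_derive_stf (vs : seq W) s : exists s', iter_derive vs (stf s) = stf s'.
Proof.
elim: vs => [|v vs [s' IH]]; first by exists s.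
exists (dst v s'); rewrite /= IH; apply/funext => z.
exact: (@derive_val _ _ _ _ _ _ _ (is_derive_stf s' z v)).
Qed.

(** All the iterated derivatives stay in the class, by [iter_derive_stf]. *)
Lemma smooth_stf s : smooth (stf s).
Proof.
move=> vs; have [s' ->] := iter_derive_stf vs s; split; first exact: continuous_stf.
by move=> v z; have [h _] := is_derive_stf s' z v.
Qed.

Definition wave_test n l z : R := c n z.2 * tp l z.1.

Lemma wave_testE n l : wave_test n l = stf [:: (n, l)].
Proof. by apply/funext => z; rewrite /stf big_seq1. Qed.

Lemma test_wave (a b : R) n l : (forall t, ~~ (a <= t <= b) -> c n t = 0) ->
  test_function_on a b (wave_test n l).
Proof.
move=> h; split; first by rewrite wave_testE; exact: smooth_stf.
- by move=> t x k hk; rewrite /wave_test /= tp_periodic.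
- by move=> x t /h; rewrite /wave_test /= => ->; rewrite mul0r.
Qed.

Lemma dt_wave n l z : dt (wave_test n l) z = c n.+1 z.2 * tp l z.1.
Proof.
rewrite /dt wave_testE.
apply: etrans (@derive_val _ _ _ _ _ _ _ (is_derive_stf _ z _)) _.
rewrite /stf /= !big_cons big_nil /= tp_scale mul1r addr0.
rewrite (_ : tp (gradT 0 l) z.1 = 0) ?mulr0 ?addr0//.
rewrite /gradT /tp big_map big1// => t _ /=; by rewrite dotE /= !mulr0 !addr0 !mulr0 mul0r.
Qed.

Lemma dx_wave i n l : dx i (wave_test n l) = wave_test n (dT i l).
Proof.
apply/funext => z; rewrite /dx wave_testE.
apply: etrans (@derive_val _ _ _ _ _ _ _ (is_derive_stf _ z _)) _.
rewrite /stf /= !big_cons big_nil /= tp_scale mul0r mulr0 add0r addr0.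
congr (_ * _); apply: esym.
rewrite -(@derive_val _ _ _ _ _ _ _ (is_derive_dT i l z.1)).
exact: (@derive_val _ _ _ _ _ _ _ (is_derive_gradT l z.1 (unit_vec i))).
Qed.

End SpaceTimeTest.

(** * The fundamental lemma of the calculus of variations in time *)

Section TimeLemma.
Context {R : realType}.
Local Notation leb := (@lebesgue_measure R).
Local Notation RT := (measurableTypeR R).

Definition ind (a b t : R) : R := \1_(`[a, b] : set R) t.

Lemma indE (a b t : R) : ind a b t = (a <= t <= b)%R%:R.
Proof.
rewrite /ind indicE; congr (nat_of_bool _)%:R; apply/idP/idP; rewrite inE /= in_itv//.
Qed.

Lemma ind_ge0 a b t : 0 <= ind a b t. Proof. by rewrite indE ler0n. Qed.

Lemma measurable_ind a b : measurable_fun setT (ind a b : RT -> R).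
Proof. by apply: measurable_indic; exact: measurable_itv. Qed.

Lemma intg_ind a b : intg leb (ind a b).
Proof. exact: integrable_indic_itv. Qed.

Lemma Rint_ind a b : a <= b -> \int[leb]_t ind a b t = b - a.
Proof.
move=> ab; rewrite /Rintegral (_ : (fun t => (ind a b t)%:E) = (fun t => (\1_(`[a, b] : set R) t)%:E))//.
rewrite (@integral_indic _ RT R leb setT measurableT _ (measurable_itv _)).
transitivity (fine (lebesgue_measure ([set` `[a, b]] : set R))); first by rewrite setIT.
rewrite lebesgue_measure_itv/= lte_fin.
by move: ab; rewrite le_eqVlt => /orP[/eqP ->|->]; rewrite ?ltxx /= ?subrr.
Qed.

Lemma intg_supp (f : RT -> R) (M a b : R) : measurable_fun setT f ->
  (forall t, `|f t| <= M * ind a b t) -> intg leb f.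
Proof. by move=> mf h; apply: (intg_le mf (intgZ M (intg_ind a b)) h). Qed.

Lemma measurable_tower (c : nat -> R -> R) n : tower c -> measurable_fun setT (c n : RT -> R).
Proof. by move=> tc; apply: continuous_measurable_fun; exact: tower_continuous. Qed.

(** The approximation of the Dirac mass at s from the right, of mass [jump]. *)
Definition kern (d s : R) : R -> R := rescale d s step_tower 1.

Lemma kernE d s t : kern d s t = d^-1 * bump_tower 0 (d^-1 * t + - s / d).
Proof. by rewrite /kern /rescale expr1. Qed.

Section Kern.
Variables (d s : R).
Hypothesis d0 : 0 < d.

Lemma arg_itv t : (0 < d^-1 * t + - s / d < 1) = (s < t < s + d).
Proof.
have -> : d^-1 * t + - s / d = (t - s) / d by rewrite mulNr mulrBl mulrC.
by rewrite pmulr_lgt0 ?invr_gt0// subr_gt0 ltr_pdivrMr// mul1r ltrBlDl.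
Qed.

Lemma arg_le0 t : t <= s -> d^-1 * t + - s / d <= 0.
Proof.
move=> ts; have -> : d^-1 * t + - s / d = (t - s) / d by rewrite mulNr mulrBl mulrC.
by rewrite ler_pdivrMr// mul0r subr_le0.
Qed.

Lemma arg_ge1 t : s + d <= t -> 1 <= d^-1 * t + - s / d.
Proof.
move=> ts; have -> : d^-1 * t + - s / d = (t - s) / d by rewrite mulNr mulrBl mulrC.
by rewrite ler_pdivlMr// mul1r lerBrDl.
Qed.

Lemma kern_out t : ~~ (s < t < s + d) -> kern d s t = 0.
Proof. by move=> h; rewrite kernE bump_out ?mulr0// arg_itv. Qed.

Lemma kern_ge0 t : 0 <= kern d s t.
Proof. by rewrite kernE mulr_ge0 ?bump_ge0// invr_ge0 ltW. Qed.

Lemma kern_le t : kern d s t <= d^-1 * ind s (s + d) t.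
Proof.
have [/andP[h1 h2]|h] := boolP (s < t < s + d).
  have -> : ind s (s + d) t = 1 by rewrite indE (ltW h1) (ltW h2).
  by rewrite mulr1 kernE ler_piMr ?bump_le1// invr_ge0 ltW.
by rewrite kern_out// mulr_ge0 ?ind_ge0// invr_ge0 ltW.
Qed.

Lemma measurable_kern : measurable_fun setT (kern d s : RT -> R).
Proof. exact: (measurable_tower 1 (rescaleP d s step_towerP)). Qed.

Lemma intg_kern : intg leb (kern d s).
Proof.
by apply: (intg_supp measurable_kern (M := d^-1)) => t; rewrite (ger0_norm (kern_ge0 t)); exact: kern_le.
Qed.

Lemma Rint_kern : \int[leb]_t kern d s t = jump.
Proof.
pose F := rescale d s step_tower 0.
have tw := rescaleP d s step_towerP.
have sd : s < s + d by rewrite ltrDl.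
have cF t : {for t, continuous F} by exact: is_derive_continuous (tw 0%N t).
have := @continuous_FTC2 R (kern d s) F s (s + d) sd _ _ _.
have F1 : F (s + d) = jump.
  by rewrite /F /rescale expr0 invr1 mul1r /=; exact: step_ge1 (arg_ge1 (lexx _)).
have F0 : F s = 0.
  by rewrite /F /rescale expr0 invr1 mul1r /=; exact: step_le0 (arg_le0 (lexx _)).
rewrite F1 F0 sube0 => h.
apply: EFin_inj; rewrite -h.
- rewrite (EFin_Rint intg_kern) [RHS]integral_mkcond; apply: eq_integral => t _.
  rewrite patchE; case: ifPn => // /negP ht.
  rewrite kern_out//; apply/negP => /andP[h1 h2]; apply: ht.
  by rewrite inE /= in_itv/= !ltW.
- by apply: continuous_subspaceT => t; exact: is_derive_continuous (tw 1%N t).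
- split=> [t _||].
  + by have [e _] := tw 0%N t.
  + exact/cvg_at_right_filter/cF.
  + exact/cvg_at_left_filter/cF.
- move=> t _; rewrite derive1E; exact: (@derive_val _ _ _ _ _ _ _ (tw 0%N t)).
Qed.

End Kern.

(** The kernel is at most 1 / d times the indicator of an interval of length
    d, so the error is dominated by the mean oscillation of c around s. *)
Lemma kern_lebesgue (c : RT -> R) (M s : R) : measurable_fun setT c -> (forall t, `|c t| <= M) ->
  lebesgue_pt c s -> forall e : R, 0 < e -> exists2 d0 : R, 0 < d0 &
  forall d, 0 < d < d0 -> `|\int[leb]_t (c t * kern d s t) - jump * c s| <= e.
Proof.
move=> mc hM hs e e0.
have e4 : 0 < e / 4 by rewrite divr_gt0.
have : \forall r \near (0 : R)^'+, (davg c s r < (e / 4)%:E)%E.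
  have h : nbhs (0%E : \bar R) [set x : \bar R | (x < (e / 4)%:E)%E].
    by apply: open_nbhs_nbhs; split; [exact: open_ereal_lt_ereal|rewrite /= lte_fin].
  exact: hs _ h.
move=> /nbhs_ballP[r0 /= r00 hr].
exists (r0 / 2); first by rewrite divr_gt0.
move=> d /andP[d0 dr].
have ick : intg leb (fun t => c t * kern d s t) := intg_bndl mc hM (intg_kern s d0).
have ik := intg_kern s d0.
have -> : jump * c s = \int[leb]_t (c s * kern d s t) by rewrite RintZ// Rint_kern// mulrC.
rewrite -RintB//; last exact: intgZ.
have dd : 0 < 2 * d by rewrite mulr_gt0.
have mB : measurable (ball s (2 * d) : set RT) by exact: measurable_ball.
pose J (t : RT) := `|c t - c s| * \1_(ball s (2 * d) : set RT) t.
have mJ : measurable_fun setT J.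
  apply: measurable_funM; last exact: measurable_indic.
  by apply: measurableT_comp => //; exact: measurable_funB.
have iJ : intg leb J.
  apply: (intg_supp mJ (M := M + M) (a := s - 2 * d) (b := s + 2 * d)) => t.
  rewrite normrM normr_id; apply: ler_pM => //.
    by apply: (le_trans (ler_normB _ _)); exact: lerD.
  rewrite indicE indE; case: (boolP (_ \in _)); last by rewrite normr0.
  rewrite inE /ball /= => h; rewrite normr1.
  suff -> : s - 2 * d <= t <= s + 2 * d by [].
  move: h; rewrite ltr_distlC => /andP[h1 h2]; rewrite !ltW//.
have hJ : \int[leb]_t J t <= e * d.
  have := hr (2 * d); rewrite /ball /= sub0r normrN gtr0_norm// => /(_ _ dd).
  have -> : 2 * d < r0 by move: dr; rewrite ltr_pdivlMr// mulrC.
  move=> /(_ isT); rewrite /davg /iavg lebesgue_measure_ball ?(ltW dd)//.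
  have -> : (\int[leb]_(y in ball s (2 * d)) `|((center (c s) \o c) y)%:E| = (\int[leb]_t J t)%:E)%E.
    rewrite EFin_Rint// [LHS]integral_mkcond; apply: eq_integral => t _.
    rewrite patchE /J indicE; case: (_ \in _); rewrite ?mulr1 ?mulr0//.
  have dd2 : 0 < (2 * d) *+ 2 by rewrite mulrn_wgt0.
  rewrite inver gt_eqF// -EFinM lte_fin ltr_pdivrMl// => h; apply: ltW; apply: (lt_le_trans h).
  by rewrite le_eqVlt; apply/orP; left; apply/eqP; field.
apply: (@le_trans _ _ (\int[leb]_t (d^-1 * J t))); last first.
  by rewrite RintZ// ler_pdivrMl// mulrC.
apply: Rint_norm_le; [by apply: intgB => //; exact: intgZ|exact: intgZ|].
move=> t; rewrite -mulrBl normrM (ger0_norm (kern_ge0 s d0 t)) /J.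
have [h|h] := boolP (s < t < s + d); last first.
  by rewrite kern_out// mulr0 mulr_ge0 ?mulr_ge0 ?invr_ge0 ?(ltW d0)// indicE ler0n.
have -> : \1_(ball s (2 * d) : set RT) t = 1 :> R.
  rewrite indicE mem_set// /ball /= ltr_distlC; case/andP: h => h1 h2.
  by apply/andP; split; lra.
rewrite mulr1 mulrC ler_wpM2r//; apply: (le_trans (kern_le s d0 t)).
by rewrite ler_piMr ?invr_ge0 ?(ltW d0)// indE lern1 leq_b1.
Qed.

Definition weak_derivative (c f : RT -> R) :=
  forall (g : nat -> R -> R) (a b : R), tower g -> 0 < a ->
    (forall n t, ~~ (a <= t <= b) -> g n t = 0) ->
    \int[leb]_t (c t * g 1%N t + f t * g 0%N t) = 0.

Lemma step_kern_tower (d s t : R) :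
  tower (fun n x => rescale d s step_tower n x - rescale d t step_tower n x).
Proof. by apply: towerB; apply: rescaleP; exact: step_towerP. Qed.

(** The difference of two steps is a smoothed indicator of the interval,
    which is exact outside of two windows of length d. *)
Lemma step_window (d s t x : R) : 0 < d -> s <= t ->
  `|rescale d s step_tower 0 x - rescale d t step_tower 0 x - jump * ind s t x| <=
  jump * (ind s (s + d) x + ind t (t + d) x).
Proof.
move=> d0 st; rewrite /rescale !expr0 invr1 !mul1r /=.
set p := step _; set q := step _.
have j0 := ltW (@jump_gt0 R).
have p0 : 0 <= p <= jump by rewrite step_ge0 step_le_jump.
have q0 : 0 <= q <= jump by rewrite step_ge0 step_le_jump.
have pl : x <= s -> p = 0 by move=> h; rewrite /p step_le0// arg_le0.
have ql : x <= t -> q = 0 by move=> h; rewrite /q step_le0// arg_le0.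
have pg : s + d <= x -> p = jump by move=> h; rewrite /p step_ge1// arg_ge1.
have qg : t + d <= x -> q = jump by move=> h; rewrite /q step_ge1// arg_ge1.
have norm_le (a b : R) : - b <= a -> a <= b -> `|a| <= b by move=> *; rewrite ler_norml; apply/andP.
have j1 n : 0 <= jump * n%:R :> R by rewrite mulr_ge0.
case/andP: p0 => p0 p1; case/andP: q0 => q0 q1.
have [xs|xs] := ltP x s.
  rewrite (pl (ltW xs)) (ql (ltW (lt_le_trans xs st))) (_ : ind s t x = 0) ?mulr0 ?subr0 ?normr0; last first.
    by rewrite indE leNgt xs.
  by rewrite mulr_ge0// addr_ge0 ?ind_ge0.
have [xt|xt] := leP x t.
  rewrite (ql xt) (_ : ind s t x = 1) ?mulr1 ?subr0; last by rewrite indE xs xt.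
  have [xd|xd] := leP x (s + d).
    apply: (@le_trans _ _ jump); first by apply: norm_le; lra.
    by rewrite ler_peMr// [X in X + _]indE xs xd /= lerDl ind_ge0.
  by rewrite (pg (ltW xd)) subrr normr0 mulr_ge0// addr_ge0 ?ind_ge0.
rewrite (_ : ind s t x = 0) ?mulr0 ?subr0; last by rewrite indE xs leNgt xt.
have [xd|xd] := leP x (t + d).
  apply: (@le_trans _ _ jump); first by apply: norm_le; lra.
  by rewrite ler_peMr// [X in _ + X]indE (ltW xt) xd /= lerDr ind_ge0.
have xsd : s + d <= x by rewrite (le_trans _ (ltW xd))// lerD2r.
rewrite (qg (ltW xd)) (pg xsd) subrr normr0.
exact: mulr_ge0 j0 (addr_ge0 (ind_ge0 _ _ _) (ind_ge0 _ _ _)).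
Qed.

Lemma eps_zero (a C : R) : 0 <= C -> (forall e, 0 < e -> `|a| <= C * e) -> a = 0.
Proof.
move=> C0 h; apply/eqP; rewrite -normr_le0; apply/ler_addgt0Pr => e e0; rewrite add0r.
have e1 : 0 < e / (C + 1) by rewrite divr_gt0// ltr_pwDr.
apply: (le_trans (h _ e1)); rewrite mulrA ler_pdivrMr ?ltr_pwDr// mulrC.
by rewrite ler_wpM2l ?(ltW e0)// lerDl.
Qed.

Section WeakDerivative.
Variables (c f : RT -> R) (M : R).
Hypotheses (mc : measurable_fun setT c) (mf : measurable_fun setT f).
Hypotheses (hc : forall t, `|c t| <= M) (hf : forall t, `|f t| <= M).
Hypothesis wd : weak_derivative c f.

Let M0 : 0 <= M. Proof. exact: le_trans (normr_ge0 _) (hc 0). Qed.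

(** Test with the difference of two steps, whose derivative is a difference
    of two approximate Dirac masses at the end points. *)
Lemma weak_derivative_integral (s t : R) : 0 < s -> s <= t ->
  lebesgue_pt c s -> lebesgue_pt c t -> c t - c s = \int[leb]_x (f x * ind s t x).
Proof.
move=> s0 st ls lt; have j0 := @jump_gt0 R.
have ifi a b : intg leb (fun x => f x * ind a b x) := intg_bndl mf hf (intg_ind a b).
suff : jump * (c s - c t) + jump * \int[leb]_x (f x * ind s t x) = 0.
  move=> /eqP; rewrite -mulrDr mulf_eq0 gt_eqF//= => /eqP h.
  by rewrite -[RHS]subr0 -h; ring.
apply: (@eps_zero _ (2 + 2 * M * jump)); first by rewrite addr_ge0// !mulr_ge0// ltW.
move=> e e0.
have [d1 d10 h1] := kern_lebesgue mc hc ls e0.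
have [d2 d20 h2] := kern_lebesgue mc hc lt e0.
pose d := Num.min e (Num.min (d1 / 2) (d2 / 2)).
have d0 : 0 < d by rewrite !lt_min e0 !divr_gt0.
have de : d <= e by rewrite ge_min lexx.
have dd1 : d < d1.
  have : d <= d1 / 2 by rewrite !ge_min lexx !orbT.
  by move/le_lt_trans; apply; rewrite ltr_pdivrMr// ltr_pMr// ltr1n.
have dd2 : d < d2.
  have : d <= d2 / 2 by rewrite !ge_min lexx !orbT.
  by move/le_lt_trans; apply; rewrite ltr_pdivrMr// ltr_pMr// ltr1n.
have {}h1 := h1 d; rewrite d0 dd1 in h1; have {}h1 := h1 isT.
have {}h2 := h2 d; rewrite d0 dd2 in h2; have {}h2 := h2 isT.
pose g n x := rescale d s step_tower n x - rescale d t step_tower n x.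
have out n x : ~~ (s <= x <= t + d) -> g n x = 0.
  rewrite negb_and -!ltNge => /orP[xs|xt]; rewrite /g /rescale.
    case: n => [|n] /=; first by rewrite !step_le0 ?mulr0 ?subr0// arg_le0// ltW// (lt_le_trans xs).
    rewrite /bump_tower !bterm_out ?mulr0 ?subr0// arg_itv//.
      by rewrite negb_and -leNgt (le_trans (ltW xs) st).
    by rewrite negb_and -leNgt (ltW xs).
  have xs : s + d <= x by apply: le_trans (ltW xt); rewrite lerD2r.
  case: n => [|n] /=; first by rewrite !step_ge1 ?subrr// arg_ge1// ltW.
  rewrite /bump_tower !bterm_out ?mulr0 ?subr0// arg_itv// negb_and -!leNgt ?xs ?(ltW xt) orbT//.
have w := wd (step_kern_tower d s t) s0 out.
have ick a : intg leb (fun x => c x * kern d a x) := intg_bndl mc hc (intg_kern a d0).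
have mg : measurable_fun setT (g 0%N : RT -> R) := measurable_tower 0 (step_kern_tower d s t).
pose D x := g 0%N x - jump * ind s t x.
have mD : measurable_fun setT (D : RT -> R).
  by apply: measurable_funB => //; apply: measurable_funM => //; exact: measurable_ind.
have iw : intg leb (fun x => jump * (ind s (s + d) x + ind t (t + d) x)).
  by apply: intgZ; apply: intgD; exact: intg_ind.
have iD : intg leb D by apply: (intg_le mD iw) => x; exact: step_window.
have ifD : intg leb (fun x => f x * D x) := intg_bndl mf hf iD.
have bD : `|\int[leb]_x (f x * D x)| <= M * (jump * (d + d)).
  apply: (@le_trans _ _ (\int[leb]_x (M * (jump * (ind s (s + d) x + ind t (t + d) x))))).
    apply: Rint_norm_le => //; first exact: intgZ.
    by move=> x; rewrite normrM ler_pM//; exact: step_window.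
  rewrite RintZ// RintZ; last by apply: intgD; exact: intg_ind.
  rewrite RintD; [|exact: intg_ind..].
  by rewrite !Rint_ind ?lerDl ?(ltW d0)// ![_ + d - _]addrC !addKr.
have e1 : \int[leb]_x (c x * kern d s x) - \int[leb]_x (c x * kern d t x) +
   \int[leb]_x (f x * D x) + jump * \int[leb]_x (f x * ind s t x) = 0.
  rewrite -[RHS]w -RintB// -RintD//; last exact: intgB.
  rewrite -RintZ// -RintD; [|by apply: intgD => //; exact: intgB|exact: intgZ].
  by apply: Rint_ext => x; rewrite /D /g /kern; ring.
move: e1 h1 h2 bD.
move: (\int[leb]_x (c x * kern d s x)) (\int[leb]_x (c x * kern d t x)) (\int[leb]_x (f x * D x))
  (\int[leb]_x (f x * ind s t x)) => I1 I2 I3 I4 e1 h1 h2 bD.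
have -> : jump * (c s - c t) + jump * I4 = - (I1 - jump * c s) + (I2 - jump * c t) - I3.
  by rewrite -[RHS]addr0 -e1; ring.
apply: (le_trans (ler_normB _ _)); apply: (le_trans (lerD (ler_normD _ _) (lexx _))).
rewrite normrN; apply: (le_trans (lerD (lerD h1 h2) bD)).
have : M * (jump * (d + d)) <= 2 * M * jump * e.
  have -> : M * (jump * (d + d)) = 2 * M * jump * d by ring.
  by apply: ler_wpM2l => //; rewrite !mulr_ge0// ltW.
have -> : (2 + 2 * M * jump) * e = e + e + 2 * M * jump * e by ring.
exact: lerD.
Qed.

End WeakDerivative.

Lemma bounded_locally_integrable (c : RT -> R) (M : R) : measurable_fun setT c ->
  (forall t, `|c t| <= M) -> locally_integrable setT c.
Proof.
move=> mc hM; split=> //; first exact: openT.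
move=> K _ cK; have mK : measurable (K : set RT) by exact: compact_measurable.
have M0 : 0 <= M := le_trans (normr_ge0 _) (hM 0).
apply: (@le_lt_trans _ _ (\int[leb]_(x in K) (cst M%:E) x)%E).
  apply: ge0_le_integral => //.
  - by apply/measurable_EFinP; apply: measurableT_comp => //; exact: measurable_funTS.
  - by move=> x _; rewrite lee_fin.
rewrite integral_cst// lte_mul_pinfty// ?lee_fin//.
exact: compact_finite_measure.
Qed.

(** The kernel [kern] is itself an admissible profile. *)
Lemma null_distribution (c : RT -> R) (M : R) (s : R) : measurable_fun setT c ->
  (forall t, `|c t| <= M) ->
  (forall (g : nat -> R -> R) (a b : R), tower g -> 0 < a ->
    (forall n t, ~~ (a <= t <= b) -> g n t = 0) -> \int[leb]_t (c t * g 0%N t) = 0) ->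
  0 < s -> lebesgue_pt c s -> c s = 0.
Proof.
move=> mc hM h s0 ls; suff : jump * c s = 0 by move=> /eqP; rewrite mulf_eq0 gt_eqF ?jump_gt0//= => /eqP.
apply: (@eps_zero _ 1) => // e e0; rewrite mul1r.
have [d0 d00 hd] := kern_lebesgue mc hM ls e0.
have d2 : 0 < d0 / 2 by rewrite divr_gt0.
have {hd} := hd (d0 / 2); rewrite d2 ltr_pdivrMr// ltr_pMr// ltr1n => /(_ isT).
pose g n := rescale (d0 / 2) s step_tower n.+1.
rewrite (h g s (s + d0 / 2)) ?sub0r ?normrN//.
  by move=> n x; exact: rescaleP step_towerP n.+1 x.
move=> n x hx; rewrite /g /rescale /= /bump_tower bterm_out ?mulr0// arg_itv//.
by apply: contra hx => /andP[h1 h2]; rewrite !ltW.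
Qed.

End TimeLemma.

(** * Uniform bounds, measurability and exceptional times *)

Section LinftyBound.
Context {R : realType}.
Local Notation V := (measurableTypeR R * measurableTypeR R * measurableTypeR R)%type.
Local Notation RT := (measurableTypeR R).
Local Notation mu := (@tmu R).
Local Notation leb := (@lebesgue_measure R).

Lemma poweR_inv_le (x : \bar R) (p M : R) : 0 < p -> (0 <= x)%E ->
  (x `^ p^-1 <= M%:E)%E -> (x <= (M `^ p)%:E)%E.
Proof.
move=> p0 x0 h; have -> : x = ((x `^ p^-1) `^ p)%E.
  by rewrite -poweRrM mulVf ?gt_eqF// poweRe1.
have h0 := poweR_ge0 x p^-1.
rewrite -poweR_EFin; apply: gt0_ler_poweR => //; first exact: ltW.
  by rewrite in_itv/= h0 leey.
by rewrite in_itv/= leey andbT (le_trans h0 h).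
Qed.

Lemma ae_time (P : R -> Prop) :
  {ae @time_measure R, forall t, P t} <-> {ae leb, forall t : RT, 0 < t -> P t}.
Proof.
have mI : measurable (`]0%R, +oo[ : set RT) by exact: measurable_itv.
split.
- move=> [B [mB B0 hB]]; exists (B `&` `]0%R, +oo[%classic); split.
  + exact: measurableI.
  + exact: B0.
  + move=> t /= /not_implyP[t0 nP]; split; first exact: hB.
    by rewrite /= in_itv/= t0.
- move=> [B [mB B0 hB]]; exists (B `|` ~` `]0%R, +oo[%classic); split.
  + by apply: measurableU => //; exact: measurableC.
  + rewrite /time_measure /= /mrestr setIUl setICl setU0.
    apply/eqP; rewrite eq_le measure_ge0 andbT -B0.
    by apply: le_measure; rewrite ?inE//; exact: measurableI.
  + move=> t /= nP; have [t0|t0] := ltP 0 t.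
      by left; apply: hB => /= h; exact: nP (h t0).
    by right; rewrite /= in_itv/= andbT => h; move: t0; rewrite leNgt h.
Qed.

(** Each of the two terms of the norm is below the essential supremum; raise
    them to the third power. *)
Lemma linfty_bound (theta : R) (u : R -> vec R -> vec R) : Linfty_sobolev theta 3 u ->
  exists2 M : R, 0 <= M & {ae leb, forall t : RT, 0 < t ->
    (\int[mu]_x (enorm (u t x) ^+ 3)%:E <= M%:E)%E /\ (gagliardo theta 3 (u t) <= M%:E)%E}.
Proof.
rewrite /Linfty_sobolev => h; set e := ess_sup _ _ in h.
pose M0 := Num.max 0 (fine e).
have eM : (e <= M0%:E)%E.
  rewrite /M0; case: (e) h => [r| |] //= _; last by rewrite leNye.
  by rewrite lee_fin le_max lexx orbT.
have M00 : 0 <= M0 by rewrite le_max lexx.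
exists (M0 `^ 3); first exact: powR_ge0.
apply/ae_time; apply: ae_sub (ess_sup_ge (@time_measure R) (fun t => sobolev_norm theta 3 (u t))) => t.
move=> /le_trans/(_ eM); rewrite /sobolev_norm => hs.
have g0 : (0 <= gagliardo theta 3 (u t))%E.
  apply: integral_ge0 => x _; apply: integral_ge0 => y _.
  by rewrite lee_fin mulr_ge0 ?powR_ge0// invr_ge0 powR_ge0.
have n0 := Lnorm_ge0 (@torus_measure R) 3%:E (fun x => (enorm (u t x))%:E).
have p0 := poweR_ge0 (gagliardo theta 3 (u t)) (1 / 3).
split.
- have : ('N[@torus_measure R]_3%:E[(fun x => (enorm (u t x))%:E)] <= M0%:E)%E.
    by apply: le_trans hs; exact: leeDl.
  rewrite unlock /=; set I := (X in (X `^ _ <= _)%E -> _).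
  have -> : (\int[mu]_x (enorm (u t x) ^+ 3)%:E = I)%E.
    apply: eq_integral => x _; rewrite ger0_norm ?enorm_ge0//.
    by rewrite powR_mulrn ?enorm_ge0.
  apply: poweR_inv_le; rewrite ?ltr0n//.
  by apply: integral_ge0 => x _; rewrite lee_fin powR_ge0.
- apply: poweR_inv_le; rewrite ?ltr0n//.
  by rewrite -div1r; apply: le_trans hs; exact: leeDr.
Qed.

End LinftyBound.

Section Sections.
Context {R : realType}.
Local Notation V := (measurableTypeR R * measurableTypeR R * measurableTypeR R)%type.
Local Notation RT := (measurableTypeR R).
Local Notation mu := (@tmu R).
Local Notation leb := (@lebesgue_measure R).

Lemma measurable_section (F : V * RT -> R) t : measurable_fun setT F ->
  measurable_fun setT (fun x : V => F (x, t)).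
Proof. by move=> mF; apply: measurableT_comp mF _; exact: measurable_pair2. Qed.

Lemma measurable_Eint (F : V * RT -> R) : measurable_fun setT F -> (forall z, 0 <= F z) ->
  measurable_fun setT (fun t : RT => \int[mu]_x (F (x, t))%:E)%E.
Proof.
move=> mF F0; apply: (@measurable_fun_fubini_tonelli_G _ _ _ _ _ mu (EFin \o F)) => //.
exact/measurable_EFinP.
Qed.

(** The positive and the negative part are covered by Tonelli's theorem,
    which does not require integrability on the product. *)
Lemma measurable_Rint (F : V * RT -> R) : measurable_fun setT F ->
  measurable_fun setT (fun t : RT => \int[mu]_x F (x, t)).
Proof.
move=> mF.
have -> : (fun t : RT => \int[mu]_x F (x, t)) =
   fine \o (fun t : RT => (\int[mu]_x (Num.max (F (x, t)) 0)%:E - \int[mu]_x (Num.max (- F (x, t)) 0)%:E)%E).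
  apply/funext => t /=; rewrite /Rintegral integralE; congr (fine (_ - _)%E);
    apply: eq_integral => x _.
  + by rewrite funeposE -EFin_max.
  + by rewrite funenegE -EFin_max.
apply: measurableT_comp; first exact: fine_measurable.
apply: emeasurable_funB.
- apply: (@measurable_Eint (fun z => Num.max (F z) 0)) => [|z]; last by rewrite le_max lexx orbT.
  by apply: measurable_maxr => //; exact: measurable_cst.
- apply: (@measurable_Eint (fun z => Num.max (- F z) 0)) => [|z]; last by rewrite le_max lexx orbT.
  apply: measurable_maxr; last exact: measurable_cst.
  exact: measurableT_comp.
Qed.

Lemma tower_bounded (g : nat -> R -> R) (a b : R) n : tower g ->
  (forall n t, ~~ (a <= t <= b) -> g n t = 0) -> exists K : R, forall t, `|g n t| <= K.
Proof.
move=> tg out; have [ab|ab] := leP a b; last first.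
  exists 0 => t; rewrite out ?normr0//.
  by apply/negP => /andP[h1 h2]; move: ab; rewrite ltNge (le_trans h1 h2).
have [|c _ hc] := @EVT_max R (fun t => `|g n t|) a b ab _; last first.
  exists `|g n c| => t; have [h|h] := boolP (a <= t <= b).
    by apply: hc; rewrite in_itv.
  by rewrite out// normr0.
by apply: continuous_subspaceT => t; apply: cvg_norm; exact: tower_continuous.
Qed.

(** A property of functions that is stable under linear combinations holds
    for all trigonometric polynomials as soon as it holds for the waves of
    two phases, because any other phase is a combination of these. The waves
    are countably many, which makes the principle compatible with
    exceptional null sets. *)
Lemma trig_ind (P : seq (R * freq * R) -> Prop) :
  (forall l m, tp l =1 tp m -> P l -> P m) ->
  (forall l m, P l -> P m -> P (l ++ m)) -> (forall c l, P l -> P (scaleT c l)) ->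
  (forall k b, b = 0 \/ b = - (pi / 2) -> P (w1 k b)) -> forall l, P l.
Proof.
move=> ext PD PZ Pw; elim=> [|[[a k] b] l IH].
  apply: (ext (scaleT 0 (w1 0 0))); first by move=> x; rewrite tp_scale mul0r tp_nil.
  by apply: PZ; apply: Pw; left.
apply: (ext (scaleT (a * cos b) (w1 k 0) ++ (scaleT (a * - sin b) (w1 k (- (pi / 2))) ++ l))).
  by move=> x; rewrite !tp_cat !tp_scale !tp_w1 tp_cons /= (chr_phase _ b); ring.
apply: (PD _ _ (PZ _ _ (Pw _ _ _))); first by left.
by apply: (PD _ _ (PZ _ _ (Pw _ _ _))) => //; right.
Qed.

Lemma ae_countable (T : countType) d (X : measurableType d) (m : {measure set X -> \bar R})
    (P : T -> X -> Prop) :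
  (forall i, \forall x \ae m, P i x) -> \forall x \ae m, forall i, P i x.
Proof.
move=> h; have : \forall x \ae m, forall n : nat, forall i, unpickle n = Some i -> P i x.
  apply/ae_foralln => n; case: (unpickle n) => [i|]; last by apply: aeW.
  by apply: ae_sub (h i) => x hx _ [<-].
by apply: ae_sub => x hx i; apply: (hx (pickle i)); rewrite pickleK.
Qed.

End Sections.

(** * Weak solutions, one time at a time *)

Lemma cancel_common (R : realType) (x y p : R) : x + p = 0 -> y + p = 0 -> x - y = 0.
Proof. move=> h1 h2; have := addIr p (etrans h1 (esym h2)) => ->; exact: subrr. Qed.

Section EulerTime.
Context {R : realType}.
Local Notation V := (measurableTypeR R * measurableTypeR R * measurableTypeR R)%type.
Local Notation RT := (measurableTypeR R).
Local Notation mu := (@tmu R).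
Local Notation leb := (@lebesgue_measure R).
Implicit Types (l m : seq (R * freq * R)) (i j : 'I_3) (t s : R).

Variable u : R -> vec R -> vec R.
Hypothesis hu : euler_weak_solution u.
Variable M : R.
Hypothesis M0 : 0 <= M.
Hypothesis hM : {ae leb, forall t : RT, 0 < t -> (\int[mu]_x (enorm (u t x) ^+ 3)%:E <= M%:E)%E}.

(** Zero at negative times, so that the field is measurable on the whole of
    space-time. *)
Definition uext i (z : V * RT) : R := if 0 < z.2 then vcoord (u z.2 z.1) i else 0.

Lemma measurable_spacetime : measurable (@spacetime R : set (V * RT)).
Proof.
have -> : @spacetime R = (snd : V * RT -> RT) @^-1` `]0, +oo[%classic.
  by apply/seteqP; split => z /=; rewrite in_itv/= andbT.
rewrite -[X in measurable X]setTI; apply: measurable_snd => //; exact: measurable_itv.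
Qed.

Lemma measurable_uext i : measurable_fun setT (uext i).
Proof.
have [_ mu_ _ _ _] := hu.
have -> : uext i = (fun z : V * RT => vcoord (u z.2 z.1) i) \_ (@spacetime R).
  apply/funext => z; rewrite patchE /uext; case: ifPn => h; case: ifPn => //.
    by rewrite notin_setE.
  by rewrite inE /spacetime /= => h2; rewrite h2 in h.
apply: (measurable_restrictT _ measurable_spacetime).1.
exact: (measurableT_comp (measurable_vcoord i) mu_).
Qed.

Definition sect (w : 'I_3 -> V * RT -> R) t : 'I_3 -> V -> R := fun i x => w i (x, t).

Lemma sect_uext t : 0 < t -> sect uext t = comp (u t).
Proof. by move=> t0; apply/funext => i; apply/funext => x; rewrite /sect /uext /= t0. Qed.

Definition cubes t : \bar R := (\int[mu]_x (env (sect uext t) x ^+ 3)%:E)%E.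

Lemma measurable_cubes : measurable_fun setT (cubes : RT -> \bar R).
Proof.
apply: (@measurable_Eint _ (fun z => (\sum_i `|uext i z|) ^+ 3)) => [|z].
  apply: measurable_funX; apply: measurable_sum => i.
  by apply: measurableT_comp => //; exact: measurable_uext.
by rewrite exprn_ge0// sumr_ge0.
Qed.

(** The times at which the third moment of the velocity obeys the uniform
    bound. *)
Definition steady : set RT := [set t | (cubes t <= (27 * M)%:E)%E].

Lemma measurable_steady : measurable steady.
Proof.
rewrite -[X in measurable X]setTI.
exact: (emeasurable_fun_infty_c measurableT measurable_cubes (27 * M)%:E).
Qed.

Lemma measurable_enorm_u t : 0 < t -> measurable_fun setT (fun x : V => enorm (u t x)).
Proof.
move=> t0.
have ms : measurable_fun setT (Num.sqrt : RT -> RT).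
  by apply: continuous_measurable_fun; exact: sqrt_continuous.
apply: (measurableT_comp ms).
have m i : measurable_fun setT (fun x : V => vcoord (u t x) i).
  have := measurable_section t (measurable_uext i).
  by rewrite (_ : (fun x => uext i (x, t)) = (fun x => vcoord (u t x) i))//; apply/funext => x; rewrite /uext /= t0.
by apply: measurable_sum => i; exact: measurable_funM.
Qed.

Lemma ae_steady : \forall t \ae leb, steady t.
Proof.
apply: ae_sub hM => t h; have [t0|t0] := ltP 0 t; last first.
  rewrite /steady /= /cubes (eq_integral (cst 0%E)) ?integral0 ?lee_fin ?mulr_ge0// => x _.
  rewrite /env big1 ?expr0n// => i _; by rewrite /sect /uext /= ltNge t0 normr0.
have {}h := h t0; rewrite /steady /= /cubes sect_uext//.
apply: (@le_trans _ _ (\int[mu]_x (27%:E * (enorm (u t x) ^+ 3)%:E))%E).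
  apply: ge0_integral_mono => x; first by rewrite lee_fin exprn_ge0// env_ge0.
  rewrite -EFinM lee_fin.
  have -> : 27 * enorm (u t x) ^+ 3 = (3 * enorm (u t x)) ^+ 3 by ring.
  by apply: lerXn2r; rewrite ?nnegrE ?env_ge0 ?mulr_ge0 ?enorm_ge0//; exact: env_comp_le.
rewrite ge0_integralZl_EFin//.
- by rewrite EFinM; apply: lee_wpmul2l.
- by move=> x _; rewrite lee_fin exprn_ge0// enorm_ge0.
- by apply/measurable_EFinP; apply: measurable_funX; exact: measurable_enorm_u.
Qed.

(** The velocity, set to zero at the exceptional times, so that its moments
    are bounded at every time. *)
Definition vel i (z : V * RT) : R := uext i z * \1_steady z.2.

Lemma measurable_vel i : measurable_fun setT (vel i).
Proof.
apply: measurable_funM; first exact: measurable_uext.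
by apply: (measurableT_comp (measurable_indic measurable_steady)); exact: measurable_snd.
Qed.

Lemma vel_steady t : steady t -> sect vel t = sect uext t.
Proof.
by move=> st; apply/funext => i; apply/funext => x; rewrite /sect /vel /= indicE mem_set// mulr1.
Qed.

Lemma vel_unsteady t : ~ steady t -> sect vel t = fun _ _ => 0.
Proof.
by move=> st; apply/funext => i; apply/funext => x; rewrite /sect /vel /= indicE memNset// mulr0.
Qed.

Let v t := sect vel t.

Lemma vel_cube t : measurable_fun setT (fun x => env (v t) x ^+ 3) /\
  (\int[mu]_x (env (v t) x ^+ 3)%:E <= (27 * M)%:E)%E.
Proof.
have mv i : measurable_fun setT (v t i) by exact: (measurable_section t (measurable_vel i)).
split.
  apply: measurable_funX; apply: measurable_sum => i.
  by apply: measurableT_comp => //; exact: mv.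
have [st|st] := pselect (steady t); first by rewrite /v (vel_steady st).
rewrite /v (vel_unsteady st) (eq_integral (cst 0%E)) ?integral0 ?lee_fin ?mulr_ge0// => x _.
by rewrite /env big1 ?expr0n// => i _; rewrite normr0.
Qed.

Lemma vel_cube_le t : intg mu (fun x => env (v t) x ^+ 3) /\ \int[mu]_x (env (v t) x ^+ 3) <= 27 * M.
Proof.
have [m h] := vel_cube t; apply: intg_ge0 => // x; by rewrite exprn_ge0// env_ge0.
Qed.

Lemma vel_tame t : tame (v t).
Proof.
split; first by move=> i; exact: (measurable_section t (measurable_vel i)).
exact: (vel_cube_le t).1.
Qed.

(** A bound of the second moments too, since a ^ p <= 1 + a ^ 3. *)
Definition VB : R := 1 + 27 * M.

Lemma VB_ge0 : 0 <= VB.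
Proof. exact: addr_ge0 ler01 (mulr_ge0 (ler0n _ 27) M0). Qed.

Lemma vel_Rint_le t (F : V -> R) (K : R) : intg mu F -> 0 <= K ->
  (forall x, `|F x| <= K * (1 + env (v t) x ^+ 3)) -> `|\int[mu]_x F x| <= K * VB.
Proof.
move=> iF K0 hF; have [i3 h3] := vel_cube_le t.
have i1 := @intg_cst _ _ R mu 1.
apply: (@le_trans _ _ (\int[mu]_x (K * (1 + env (v t) x ^+ 3)))).
  by apply: Rint_norm_le => //; apply: intgZ; exact: (intgD i1 i3).
rewrite RintZ; last exact: (intgD i1 i3).
apply: ler_wpM2l => //; rewrite (RintD i1 i3) torus_integral_cst.
by rewrite /VB lerD2l.
Qed.

Lemma vel_le t i x : `|v t i x| <= 1 + env (v t) x ^+ 3.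
Proof.
apply: (le_trans (u_le_env _ _ _)); rewrite -[env _ _]expr1.
exact: pow_le_cube (env_ge0 _ _) (isT : 1 <= 3)%N.
Qed.

Lemma vel2_le t i j x : `|v t i x * v t j x| <= 1 + env (v t) x ^+ 3.
Proof.
rewrite normrM; apply: le_trans (pow_le_cube (env_ge0 (v t) x) (isT : 2 <= 3)%N).
by rewrite expr2 ler_pM// u_le_env.
Qed.

Lemma intg_vel_tp t i l : intg mu (fun x => v t i x * tp l x).
Proof.
apply: (@intg_eq _ _ _ mu _ _ _ (intg_tpM l (intg_u (vel_tame t) i))) => x; exact: mulrC.
Qed.

Lemma intg_vel2_tp t i j l : intg mu (fun x => v t i x * v t j x * tp l x).
Proof.
apply: (@intg_eq _ _ _ mu _ _ _ (intg_tpM l (intg_uu (vel_tame t) i j))) => x; exact: mulrC.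
Qed.

Lemma vel_tp_le t i l : `|\int[mu]_x (v t i x * tp l x)| <= tpbound l * VB.
Proof.
apply: (@vel_Rint_le t _ _ (intg_vel_tp t i l) (tpbound_ge0 l)) => x.
by rewrite normrM mulrC ler_pM// ?tp_le// vel_le.
Qed.

Lemma vel2_tp_le t i j l : `|\int[mu]_x (v t i x * v t j x * tp l x)| <= tpbound l * VB.
Proof.
apply: (@vel_Rint_le t _ _ (intg_vel2_tp t i j l) (tpbound_ge0 l)) => x.
by rewrite normrM mulrC ler_pM// ?tp_le// vel2_le.
Qed.

Definition moment t i l : R := \int[mu]_x (v t i x * tp l x).

(** The action of u (x) u on the gradient of the test function. *)
Definition transport t i l : R := \sum_j \int[mu]_x (v t i x * v t j x * tp (dT j l) x).

Lemma measurable_tp_fst l : measurable_fun setT (fun z : V * RT => tp l z.1).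
Proof. by apply: (measurableT_comp (measurable_tp l)); exact: measurable_fst. Qed.

Lemma measurable_moment i l : measurable_fun setT (fun t : RT => moment t i l).
Proof.
apply: (@measurable_Rint _ (fun z => vel i z * tp l z.1)).
by apply: measurable_funM; [exact: measurable_vel|exact: measurable_tp_fst].
Qed.

Lemma measurable_transport i l : measurable_fun setT (fun t : RT => transport t i l).
Proof.
apply: measurable_sum => j.
apply: (@measurable_Rint _ (fun z => vel i z * vel j z * tp (dT j l) z.1)).
apply: measurable_funM; last exact: measurable_tp_fst.
by apply: measurable_funM; exact: measurable_vel.
Qed.

Definition tpbound1 l : R := tpbound l + \sum_j tpbound (dT j l).

Lemma moment_le t i l : `|moment t i l| <= tpbound1 l * VB.
Proof.
apply: (le_trans (vel_tp_le t i l)); apply: ler_wpM2r; first exact: VB_ge0.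
by rewrite lerDl sumr_ge0// => j _; exact: tpbound_ge0.
Qed.

Lemma transport_le t i l : `|transport t i l| <= (\sum_j tpbound (dT j l)) * VB.
Proof.
rewrite mulr_suml; apply: (le_trans (ler_norm_sum _ _ _)).
by apply: ler_sum => j _; exact: vel2_tp_le.
Qed.

Section Window.
Variables (g : nat -> R -> R) (a b : R).
Hypothesis tg : tower g.
Hypothesis a0 : 0 < a.
Hypothesis out : forall n t, ~~ (a <= t <= b) -> g n t = 0.

Let energy (z : V * RT) : R := (\sum_i uext i z ^+ 2) * ind a b z.2.

Let energy_ge0 z : 0 <= energy z.
Proof. by rewrite mulr_ge0 ?ind_ge0// sumr_ge0// => i _; exact: sqr_ge0. Qed.

Let measurable_ind2 : measurable_fun setT (fun z : V * RT => ind a b z.2).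
Proof. by apply: (measurableT_comp (measurable_ind a b)); exact: measurable_snd. Qed.

Lemma intg_energy : intg (mu \x leb)%E energy.
Proof.
apply: intg_lty => //.
  apply: measurable_funM => //; apply: measurable_sum => i.
  by apply: measurable_funX; exact: measurable_uext.
have [_ _ h _ _] := hu; have {}h := h a b a0; rewrite integral_mkcond in h.
apply: le_lt_trans h; rewrite le_eqVlt; apply/orP; left; apply/eqP.
apply: eq_integral => z _; rewrite patchE /energy indE.
case: ifPn => [|/negP hz].
  rewrite inE /= => hz; rewrite hz mulr1; have z0 : 0 < z.2 by case/andP: hz => h1 _; exact: lt_le_trans h1.
  rewrite enorm_sqr sum3 /uext z0.
  by congr (_%:E); rewrite /vcoord.
by case: (boolP (a <= z.2 <= b)) => hz'; [case: hz; rewrite inE|rewrite mulr0].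
Qed.

Lemma intg_ind2 : intg (mu \x leb)%E (fun z : V * RT => ind a b z.2).
Proof.
have := intg_tensor (@intg_cst _ _ R mu 1) (intg_ind a b).
by apply: intg_eq => z; rewrite mul1r.
Qed.

Lemma intg_uext i : intg (mu \x leb)%E (fun z => uext i z * ind a b z.2).
Proof.
apply: (intg_le _ (intgD intg_ind2 intg_energy)).
  by apply: measurable_funM => //; exact: measurable_uext.
move=> z; rewrite normrM (ger0_norm (ind_ge0 _ _ _)) /energy -[X in X + _]mul1r -mulrDl.
apply: ler_wpM2r; first exact: ind_ge0.
apply: (@le_trans _ _ (1 + uext i z ^+ 2)).
  rewrite -[uext i z ^+ 2]real_normK ?num_real//; have := normr_ge0 (uext i z).
  by move: (`|_|) => y y0; have := sqr_ge0 (y - 1); nra.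
by rewrite lerD2l (bigD1 i)//= lerDl sumr_ge0// => j _; exact: sqr_ge0.
Qed.

Lemma intg_uext2 i j : intg (mu \x leb)%E (fun z => uext i z * uext j z * ind a b z.2).
Proof.
apply: (intg_le _ (intgZ 2 intg_energy)).
  by apply: measurable_funM => //; apply: measurable_funM; exact: measurable_uext.
move=> z; rewrite normrM (ger0_norm (ind_ge0 _ _ _)) /energy mulrA.
apply: ler_wpM2r; first exact: ind_ge0.
have h k : uext k z ^+ 2 <= \sum_i uext i z ^+ 2.
  by rewrite (bigD1 k)//= lerDl sumr_ge0// => ? _; exact: sqr_ge0.
rewrite normrM; have := h i; have := h j.
rewrite -[uext i z ^+ 2]real_normK ?num_real// -[uext j z ^+ 2]real_normK ?num_real//.
move: (`|_|) (`|_|) (\sum_i _) => p q S.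
have := sqr_ge0 (p - q); nra.
Qed.

Lemma intg_window n l (w : V * RT -> R) : intg (mu \x leb)%E (fun z => w z * ind a b z.2) ->
  intg (mu \x leb)%E (fun z => w z * (g n z.2 * tp l z.1)).
Proof.
move=> iw; have [K hK] := tower_bounded n tg out.
have mh : measurable_fun setT (fun z : V * RT => g n z.2 * tp l z.1).
  apply: measurable_funM; last exact: measurable_tp_fst.
  by apply: (measurableT_comp (measurable_tower n tg)); exact: measurable_snd.
have hb z : `|g n z.2 * tp l z.1| <= K * tpbound l by rewrite normrM ler_pM// tp_le.
have i0 := @intg_bndr _ _ _ (mu \x leb)%E _ _ _ mh hb iw.
apply: intg_eq i0 => z.
have [h|h] := boolP (a <= z.2 <= b); first by rewrite indE h mulr1.
by rewrite out// mul0r !mulr0.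
Qed.

(** Integrate in space first; the result may be replaced by f at the
    exceptional times. *)
Lemma spacetime_fubini (Phi F : V * RT -> R) (f : RT -> R) : measurable_fun setT f ->
  intg (mu \x leb)%E F -> (forall z, 0 < z.2 -> Phi z = F z) -> (forall z, z.2 <= 0 -> F z = 0) ->
  (forall t, steady t -> \int[mu]_x F (x, t) = f t) ->
  \int[@spacetime_measure R]_(z in spacetime) Phi z = \int[leb]_t f t.
Proof.
move=> mf iF h1 h2 h3; have [i2 e2] := Rfubini2 iF.
transitivity (\int[(mu \x leb)%E]_z F z).
  rewrite Rintegral_mkcond; apply: Rint_ext => z; rewrite patchE.
  case: ifPn => [|/negP hz].
    by rewrite inE /spacetime /= => /h1.
  rewrite h2// leNgt; apply/negP => hz0; apply: hz; by rewrite inE.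
rewrite -e2; apply: Rint_ae_eq => //; first exact: intg_measurable i2.
by apply: ae_sub ae_steady => t st; rewrite -h3.
Qed.

Lemma weak_moment i l :
  \int[@spacetime_measure R]_(z in spacetime)
    (vcoord (u z.2 z.1) i * dt (wave_test g 0 l) z
     + \sum_j vcoord (u z.2 z.1) i * vcoord (u z.2 z.1) j * dx j (wave_test g 0 l) z) =
  \int[leb]_t (moment t i l * g 1%N t + transport t i l * g 0%N t).
Proof.
have iF1 := intg_window 1 l (intg_uext i).
have iF2 j := intg_window 0 (dT j l) (intg_uext2 i j).
apply: (spacetime_fubini (F := fun z => uext i z * (g 1%N z.2 * tp l z.1) +
   \sum_j uext i z * uext j z * (g 0%N z.2 * tp (dT j l) z.1))).
- apply: measurable_funD; apply: measurable_funM.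
  + exact: measurable_moment.
  + exact: measurable_tower.
  + exact: measurable_transport.
  + exact: measurable_tower.
- by apply: intgD => //; apply: intg_sum.
- move=> z z0; rewrite (dt_wave tg) /uext z0; congr (_ + _).
  by apply: eq_bigr => j _; rewrite (dx_wave tg).
- move=> z z0; rewrite /uext ltNge z0 /= mul0r add0r big1// => j _; by rewrite !mul0r.
- move=> t st; have e k x : uext k (x, t) = v t k x.
    by rewrite -/(sect uext t k x) -(vel_steady st).
  rewrite (Rint_ext _ (g := fun x : V => v t i x * tp l x * g 1%N t +
    \sum_j v t i x * v t j x * tp (dT j l) x * g 0%N t)); last first.
    move=> x; rewrite e /=; congr (_ + _); first ring.
    by apply: eq_bigr => j _; rewrite e; ring.
  rewrite RintD; last 2 first.
  + by apply: intgZr; exact: intg_vel_tp.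
  + by apply: intg_sum => j; apply: intgZr; exact: intg_vel2_tp.
  rewrite RintZr; last exact: intg_vel_tp.
  rewrite Rint_sum => [|j]; last by apply: intgZr; exact: intg_vel2_tp.
  rewrite /moment /transport mulr_suml; congr (_ + _); apply: eq_bigr => j _.
  by rewrite RintZr//; exact: intg_vel2_tp.
Qed.

Definition divergence t l : R := \sum_j moment t j (dT j l).

Lemma weak_divergence l : \int[leb]_t (divergence t l * g 0%N t) = 0.
Proof.
have [_ _ _ hdiv _] := hu.
rewrite -(hdiv (wave_test g 0 l)); last first.
  by exists a, b; split; [exact: a0 | exact: (test_wave tg _ (out 0%N))].
apply: esym; have iF j := intg_window 0 (dT j l) (intg_uext j).
apply: (spacetime_fubini (F := fun z => \sum_j uext j z * (g 0%N z.2 * tp (dT j l) z.1))).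
- apply: measurable_funM; last exact: measurable_tower.
  by apply: measurable_sum => j; exact: measurable_moment.
- by apply: intg_sum.
- by move=> z z0; apply: eq_bigr => j _; rewrite (dx_wave tg) /uext z0.
- by move=> z z0; rewrite big1// => j _; rewrite /uext ltNge z0 mul0r.
- move=> t st; have e k x : uext k (x, t) = v t k x.
    by rewrite -/(sect uext t k x) -(vel_steady st).
  rewrite (Rint_ext _ (g := fun x : V => \sum_j v t j x * tp (dT j l) x * g 0%N t)); last first.
    by move=> x; apply: eq_bigr => j _; rewrite e /=; ring.
  rewrite Rint_sum => [|j]; last by apply: intgZr; exact: intg_vel_tp.
  by rewrite /divergence mulr_suml; apply: eq_bigr => j _; rewrite RintZr//; exact: intg_vel_tp.
Qed.

End Window.

(** ** Pairings with curls: the pressure disappears *)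

(** The moment of the field against the curl of the list l in the direction
    i, as a combination of two components of the weak formulation. *)
Definition curl_moment t i l : R := moment t (i + 1) (dT (i + 2%:R) l) - moment t (i + 2%:R) (dT (i + 1) l).

Definition curl_transport t i l : R :=
  transport t (i + 1) (dT (i + 2%:R) l) - transport t (i + 2%:R) (dT (i + 1) l).

Lemma measurable_curl_moment i l : measurable_fun setT (fun t : RT => curl_moment t i l).
Proof. by apply: measurable_funB; exact: measurable_moment. Qed.

Lemma measurable_curl_transport i l : measurable_fun setT (fun t : RT => curl_transport t i l).
Proof. by apply: measurable_funB; exact: measurable_transport. Qed.

(** The pressure acts on the two components through the same mixed
    derivative of the test function, hence disappears from their difference. *)
Lemma curl_weak_derivative i l :
  weak_derivative (fun t => curl_moment t i l) (fun t => curl_transport t i l).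
Proof.
move=> g a b tg a0 out.
have [_ _ _ _ [p _ hp]] := hu.
have test m : test_function (wave_test g 0 m).
  by exists a, b; split; [exact: a0 | exact: (test_wave tg _ (out 0%N))].
have e1 := hp (i + 1) _ (test (dT (i + 2%:R) l)).
have e2 := hp (i + 2%:R) _ (test (dT (i + 1) l)).
rewrite (weak_moment tg a0 out) (dx_wave tg) in e1.
rewrite (weak_moment tg a0 out) (dx_wave tg) dTC in e2.
have it k m : intg leb (fun t => moment t k m * g 1%N t + transport t k m * g 0%N t).
  have ig n : intg leb (g n).
    have [K hK] := tower_bounded n tg out.
    apply: (intg_supp (measurable_tower n tg) (M := K) (a := a) (b := b)) => t.
    have [h|h] := boolP (a <= t <= b); first by rewrite indE h mulr1.
    by rewrite out// normr0 indE (negbTE h) mulr0.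
  apply: intgD.
    exact: (intg_bndl (measurable_moment k m) (fun t => moment_le t k m) (ig 1%N)).
  exact: (intg_bndl (measurable_transport k m) (fun t => transport_le t k m) (ig 0%N)).
have e := cancel_common e1 e2.
apply: etrans e; rewrite -(RintB (it _ _) (it _ _)).
apply: Rint_ext => t; rewrite /curl_moment /curl_transport; ring.
Qed.

End EulerTime.

(** * The mollified helicity is Lipschitz in time *)

Section Subdivision.
Context {R : realType}.
Local Notation RT := (measurableTypeR R).
Local Notation leb := (@lebesgue_measure R).

(** An interval is not negligible. *)
Lemma ae_dense (P : R -> Prop) (a b : R) : {ae leb, forall t : RT, 0 < t -> P t} ->
  0 <= a -> a < b -> exists2 t, a < t < b & P t.
Proof.
move=> hP a0 ab; apply: contrapT => h.
have m : measurable (`]a, b[ : set RT) by exact: measurable_itv.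
have : leb.-negligible (`]a, b[ : set RT).
  apply: negligibleS hP => t /=; rewrite in_itv/= => tab ht; apply: h; exists t => //.
  by apply: ht; case/andP: tab => h1 _; exact: le_lt_trans h1.
move/negligibleP => /(_ m) => h0.
have e : leb (`]a, b[ : set RT) = (b%:E - a%:E)%E.
  transitivity (lebesgue_measure ([set` `]a, b[] : set R)); first by [].
  by rewrite lebesgue_measure_itv /= lte_fin ab.
have := etrans (esym e) h0; rewrite -EFinB => -[] /eqP; by rewrite subr_eq0 gt_eqF.
Qed.

(** On steps shorter than d the quadratic error is at most e times the
    length of the step, and the steps may end at good times because these
    are dense. *)
Lemma subdivision (P : R -> Prop) (h : R -> R) (L C : R) : 0 <= C ->
  {ae leb, forall t : RT, 0 < t -> P t} ->
  (forall s t, 0 < s -> s <= t -> P s -> P t ->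
     `|h t - h s| <= (L + C * (t - s)) * (t - s)) ->
  forall s t, 0 < s -> s <= t -> P s -> P t -> `|h t - h s| <= L * (t - s).
Proof.
move=> C0 hP hh s t s0 st Ps Pt.
apply/ler_addgt0Pr => e e0.
pose e' := e / (t - s + 1).
have ts0 : 0 <= t - s by rewrite subr_ge0.
have ts1 : 0 < t - s + 1 by rewrite ltr_pwDr.
have e'0 : 0 < e' by rewrite divr_gt0.
suff H : `|h t - h s| <= (L + e') * (t - s).
  apply: (le_trans H); rewrite mulrDl lerD2l /e' mulrAC ler_pdivrMr//.
  by rewrite ler_wpM2l ?(ltW e0)// lerDl.
pose d := e' / (C + 1).
have C1 : 0 < C + 1 by rewrite ltr_pwDr.
have d0 : 0 < d by rewrite divr_gt0.
have Cd : C * d <= e'.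
  by rewrite /d mulrA ler_pdivrMr// mulrC ler_wpM2l ?(ltW e'0)// lerDl.
have [n hn] : exists n : nat, t - s <= n%:R * (d / 2).
  exists (Num.truncn ((t - s) / (d / 2))).+1.
  by rewrite -ler_pdivrMr ?divr_gt0// ltW// truncnS_gt.
suff H : forall n r, 0 < r -> r <= t -> P r -> t - r <= n%:R * (d / 2) ->
    `|h t - h r| <= (L + e') * (t - r) by exact: H hn.
have small r q : 0 < r -> r <= q -> P r -> P q -> q - r <= d -> `|h q - h r| <= (L + e') * (q - r).
  move=> r0 rq Pr Pq qd; apply: (le_trans (hh r q r0 rq Pr Pq)).
  apply: ler_wpM2r; first by rewrite subr_ge0.
  by rewrite lerD2l; apply: le_trans Cd; exact: ler_wpM2l.
elim=> [|k IH] r r0 rt Pr hk.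
  apply: small => //; apply: (le_trans hk); rewrite mul0r; exact: ltW.
have [td|td] := leP (t - r) d; first exact: small.
have d2 : 0 < d / 2 by rewrite divr_gt0.
have d2d : d / 2 < d by rewrite ltr_pdivrMr// ltr_pMr// ltr1n.
have [||q /andP[q1 q2] Pq] := @ae_dense P (r + d / 2) (r + d) hP; first by rewrite ltW// addr_gt0.
  by rewrite ltrD2l.
have rq : r <= q by rewrite ltW// (lt_trans _ q1)// ltrDl.
have qt : q <= t by rewrite ltW// (lt_trans q2)// addrC -ltrBrDr.
have h1 : `|h q - h r| <= (L + e') * (q - r).
  by apply: small => //; rewrite lerBlDl ltW.
have h2 : `|h t - h q| <= (L + e') * (t - q).
  apply: IH => //; first exact: lt_le_trans rq.
  have -> : t - q = (t - r) - (q - r) by ring.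
  rewrite lerBlDr; apply: (le_trans hk); rewrite -natr1 mulrDl mul1r lerD2l.
  by rewrite lerBrDl ltW.
have -> : h t - h r = (h t - h q) + (h q - h r) by ring.
apply: (le_trans (ler_normD _ _)); apply: (le_trans (lerD h2 h1)).
by rewrite -mulrDr addrA subrK.
Qed.

(** Truncate f between - g and g. *)
Lemma Rint_ae_norm_le (f g : RT -> R) : intg leb f -> intg leb g -> (forall t, 0 <= g t) ->
  (\forall t \ae leb, `|f t| <= g t) -> `|\int[leb]_t f t| <= \int[leb]_t g t.
Proof.
move=> hf hg g0 h.
have mf := intg_measurable hf; have mg := intg_measurable hg.
pose F t := Num.min (Num.max (f t) (- g t)) (g t).
have mF : measurable_fun setT (F : RT -> R).
  apply: measurable_minr => //; apply: measurable_maxr => //; exact: measurableT_comp.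
have bF t : `|F t| <= g t.
  rewrite ler_norml /F le_min ge_min le_max !lexx !orbT /= andbT.
  by apply: le_trans (g0 t); rewrite oppr_le0.
have iF : intg leb F by exact: (intg_le mF hg bF).
rewrite (_ : \int[leb]_t f t = \int[leb]_t F t); first exact: Rint_norm_le.
apply: Rint_ae_eq => //; apply: ae_sub h => t; rewrite ler_norml => /andP[h1 h2].
by rewrite /F (max_idPl h1) (min_idPl h2).
Qed.

End Subdivision.

Lemma sub_quadD (R : realType) (a b c d e f g h : R) :
  a + b - (c + d) - (e + f - (g + h)) = (a - c - (e - g)) + (b - d - (f - h)).
Proof. ring. Qed.

Lemma sub_quadZ (R : realType) (c x y z w : R) :
  c * x - c * y - (c * z - c * w) = c * (x - y - (z - w)).
Proof. ring. Qed.

Lemma norm_shift (R : realType) (a b p q : R) : `|b| <= p -> `|a - b| <= q -> `|a| <= p + q.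
Proof.
move=> h1 h2; have -> : a = b + (a - b) by ring.
by apply: (le_trans (ler_normD _ _)); exact: lerD.
Qed.

Lemma bilinear_increment (R : realType) (a b c d a' b' c' d' : R) :
  a = a' -> c = c' -> b = b' -> d = d' -> c = b -> a - d = (a' - c') + (b' - d').
Proof. by move=> <- <- <- <- ->; ring. Qed.

Lemma curl_shuffle (R : realType) (a b c d e f : R) :
  a + -1 * b + (c + -1 * d) + (e + -1 * f) = c - f + (e - b) + (a - d).
Proof. ring. Qed.

Section GoodTimes.
Context {R : realType}.
Local Notation V := (measurableTypeR R * measurableTypeR R * measurableTypeR R)%type.
Local Notation RT := (measurableTypeR R).
Local Notation mu := (@tmu R).
Local Notation leb := (@lebesgue_measure R).
Implicit Types (l m : seq (R * freq * R)) (i j : 'I_3) (s t : R).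

Lemma tpbound_dT_refl a b (x : vec R) l : tpbound (dT a (dT b (reflT x l))) = tpbound (dT a (dT b l)).
Proof.
rewrite /tpbound /dT /reflT !big_map; apply: eq_bigr => t _ /=.
by rewrite !waveN !mulrN !mulNr opprK.
Qed.

Variable u : R -> vec R -> vec R.
Hypothesis hu : euler_weak_solution u.
Variable M : R.
Hypothesis M0 : 0 <= M.
Hypothesis hM : {ae leb, forall t : RT, 0 < t -> (\int[mu]_x (enorm (u t x) ^+ 3)%:E <= M%:E)%E}.

Local Notation v := (sect (vel u M)).
Local Notation mom := (moment u M).
Local Notation trans := (transport u M).
Local Notation cmom := (curl_moment u M).
Local Notation ctrans := (curl_transport u M).
Local Notation dvg := (divergence u M).
Local Notation B := (VB M).

(** ** Linearity in the test function *)

Lemma moment_ext t i l m : tp l =1 tp m -> mom t i l = mom t i m.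
Proof. by move=> e; apply: Rint_ext => x; rewrite e. Qed.

Lemma moment_cat t i l m : mom t i (l ++ m) = mom t i l + mom t i m.
Proof.
rewrite /moment -RintD; [|exact: intg_vel_tp..].
by apply: Rint_ext => x; rewrite tp_cat mulrDr.
Qed.

Lemma moment_scale t i c l : mom t i (scaleT c l) = c * mom t i l.
Proof.
rewrite /moment -RintZ; last exact: intg_vel_tp.
by apply: Rint_ext => x; rewrite tp_scale mulrCA.
Qed.

Lemma transport_ext t i l m : tp l =1 tp m -> trans t i l = trans t i m.
Proof.
by move=> e; apply: eq_bigr => j _; apply: Rint_ext => x; rewrite (dT_ext j e).
Qed.

Lemma transport_cat t i l m : trans t i (l ++ m) = trans t i l + trans t i m.
Proof.
rewrite /transport -big_split; apply: eq_bigr => j _ /=.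
rewrite -RintD; [|exact: intg_vel2_tp..].
by apply: Rint_ext => x; rewrite dT_cat tp_cat mulrDr.
Qed.

Lemma transport_scale t i c l : trans t i (scaleT c l) = c * trans t i l.
Proof.
rewrite /transport mulr_sumr; apply: eq_bigr => j _.
rewrite -RintZ; last exact: intg_vel2_tp.
by apply: Rint_ext => x; rewrite dT_scale tp_scale mulrCA.
Qed.

(** A bound of [curl_transport] that is uniform in time. *)
Definition curl_bound i l : R :=
  (\sum_j tpbound (dT j (dT (i + 2%:R) l)) + \sum_j tpbound (dT j (dT (i + 1) l))) * B.

Lemma curl_transport_le t i l : `|ctrans t i l| <= curl_bound i l.
Proof.
apply: (le_trans (ler_normB _ _)); rewrite /curl_bound mulrDl.
by apply: lerD; exact: transport_le.
Qed.

Definition curl_moment_bound i l : R :=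
  (tpbound1 (dT (i + 2%:R) l) + tpbound1 (dT (i + 1) l)) * B.

Lemma curl_moment_le t i l : `|cmom t i l| <= curl_moment_bound i l.
Proof.
apply: (le_trans (ler_normB _ _)); rewrite /curl_moment_bound mulrDl.
by apply: lerD; exact: moment_le.
Qed.

Lemma divergence_le t l : `|dvg t l| <= \sum_j tpbound1 (dT j l) * B.
Proof.
apply: (le_trans (ler_norm_sum _ _ _)).
by apply: ler_sum => j _; exact: moment_le.
Qed.

Lemma measurable_divergence l : measurable_fun setT (fun t : RT => dvg t l).
Proof. by apply: measurable_sum => j; exact: measurable_moment. Qed.

Variables (theta A : R).
Hypothesis hA : {ae leb, forall t : RT, 0 < t -> rough theta A (comp (u t))}.

Definition phase (e : bool) : R := if e then 0 else - (pi / 2).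

(** The times at which the field is regular and all the Fourier modes of the
    equation hold. *)
Definition good t := [/\ 0 < t, steady u M t, rough theta A (comp (u t)),
  (forall a : 'I_3 * freq * bool, lebesgue_pt (fun t => cmom t a.1.1 (w1 a.1.2 (phase a.2))) t) &
  (forall a : freq * bool, lebesgue_pt (fun t => dvg t (w1 a.1 (phase a.2))) t)].

Lemma ae_good : {ae leb, forall t : RT, 0 < t -> good t}.
Proof.
have h1 : \forall t \ae leb, forall a : 'I_3 * freq * bool,
    lebesgue_pt (fun t => cmom t a.1.1 (w1 a.1.2 (phase a.2))) t.
  apply: ae_countable => a; apply: lebesgue_differentiation.
  apply: bounded_locally_integrable (measurable_curl_moment hu M _ _) _ => t.
  exact: curl_moment_le.
have h2 : \forall t \ae leb, forall a : freq * bool, lebesgue_pt (fun t => dvg t (w1 a.1 (phase a.2))) t.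
  apply: ae_countable => a; apply: lebesgue_differentiation.
  apply: bounded_locally_integrable (measurable_divergence _) _ => t.
  exact: divergence_le.
have h := ae_and (ae_and h1 h2) (ae_and (ae_steady hu M0 hM) hA).
by apply: ae_sub h => t [[a b] [c d]] t0; split => //; exact: d.
Qed.

Lemma good_vel t : good t -> v t = comp (u t).
Proof. by move=> [t0 st _ _ _]; rewrite vel_steady// sect_uext. Qed.

(** The weak divergence is tested at the Lebesgue points of the moments of
    the waves. *)
Lemma good_divergence t : good t -> forall l, dvg t l = 0.
Proof.
move=> gt; apply: trig_ind.
- by move=> l m e <-; apply: eq_bigr => j _; apply: moment_ext; apply: dT_ext => x; rewrite e.
- move=> l m hl hm; rewrite -[RHS]addr0 -{1}hl -hm /divergence -big_split.
  by apply: eq_bigr => j _; rewrite dT_cat moment_cat.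
- move=> c l hl; rewrite -[RHS](mulr0 c) -hl /divergence mulr_sumr.
  by apply: eq_bigr => j _; rewrite dT_scale moment_scale.
- move=> k b hb; have [t0 _ _ _ hl] := gt.
  have [e be] : exists e, b = phase e by case: hb => ->; [exists true|exists false].
  rewrite be; apply: (null_distribution (measurable_divergence _) (fun s => divergence_le s _) _ t0 (hl (k, e))).
  by move=> g a c tg a0 out; exact: (weak_divergence hu M0 hM tg a0 out).
Qed.

(** The kernel seen from x is a test function. *)
Lemma good_solenoidal t N x : good t -> \sum_i tp (dT i (mT (v t) N i)) x = 0.
Proof.
move=> gt; have h0 := good_divergence gt (reflT x (KT (2 * N ^ 2))).
transitivity (- dvg t (reflT x (KT (2 * N ^ 2)))); last by rewrite h0 oppr0.
rewrite /divergence -sumrN; apply: eq_bigr => i _; rewrite dT_conv tp_conv; last exact: (intg_u (vel_tame hu M0 t) i).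
rewrite /moment dT_refl -RintN; last exact: intg_vel_tp.
by apply: Rint_ext => y; rewrite tp_scale tp_refl; ring.
Qed.

(** True for the waves at their Lebesgue points, hence for all trigonometric
    polynomials by linearity. The exceptional set is thus the same for all
    test functions, even for those which depend on the solution at another
    time. *)
Lemma good_identity s t : good s -> good t -> s <= t -> forall i l,
  cmom t i l - cmom s i l = \int[leb]_x (ctrans x i l * ind s t x).
Proof.
move=> gs gt st i.
have it l : intg leb (fun x => ctrans x i l * ind s t x).
  exact: (intg_bndl (measurable_curl_transport hu M i l) (fun x => curl_transport_le x i l) (intg_ind s t)).
have cext l m r : tp l =1 tp m -> cmom r i l = cmom r i m.
  move=> e; rewrite /curl_moment.
  by rewrite (moment_ext _ _ (dT_ext _ e)) (moment_ext _ (i + 2%:R) (dT_ext _ e)).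
have text l m r : tp l =1 tp m -> ctrans r i l = ctrans r i m.
  move=> e; rewrite /curl_transport.
  by rewrite (transport_ext _ _ (dT_ext _ e)) (transport_ext _ (i + 2%:R) (dT_ext _ e)).
apply: trig_ind.
- move=> l m e; rewrite (cext l m t e) (cext l m s e) => ->; apply: Rint_ext => x.
  by rewrite (text l m x e).
- move=> l m hl hm.
  rewrite (Rint_ext _ (g := fun x : RT => ctrans x i l * ind s t x + ctrans x i m * ind s t x)); last first.
    by move=> x; rewrite /curl_transport !dT_cat !transport_cat; ring.
  rewrite (RintD (it l) (it m)) -hl -hm /curl_moment !dT_cat !moment_cat; exact: sub_quadD.
- move=> c l hl.
  rewrite (Rint_ext _ (g := fun x : RT => c * (ctrans x i l * ind s t x))); last first.
    by move=> x; rewrite /curl_transport !dT_scale !transport_scale; ring.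
  rewrite (RintZ c (it l)) -hl /curl_moment !dT_scale !moment_scale; exact: sub_quadZ.
- move=> k b hb; have [s0 _ _ hs _] := gs; have [_ _ _ ht _] := gt.
  have [e be] : exists e, b = phase e by case: hb => ->; [exists true|exists false].
  rewrite be; set l := w1 k (phase e).
  pose K := Num.max (curl_moment_bound i l) (curl_bound i l).
  apply: (@weak_derivative_integral _ _ _ K (measurable_curl_moment hu M i l)
    (measurable_curl_transport hu M i l) _ _ (curl_weak_derivative hu M0 hM i l)) => //.
  + by move=> r; rewrite le_max curl_moment_le.
  + by move=> r; rewrite le_max curl_transport_le orbT.
  + exact: (hs (i, k, e)).
  + exact: (ht (i, k, e)).
Qed.

Lemma identity_of_curl (T W : 'I_3 -> seq (R * freq * R)) s t :
  (forall q, \sum_i mom q i (T i) = \sum_i cmom q i (W i)) ->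
  (forall q, \sum_i trans q i (T i) = \sum_i ctrans q i (W i)) ->
  good s -> good t -> s <= t ->
  \sum_i mom t i (T i) - \sum_i mom s i (T i) =
  \int[leb]_x ((\sum_i trans x i (T i)) * ind s t x).
Proof.
move=> e1 e2 gs gt st.
have it i : intg leb (fun x : RT => ctrans x i (W i) * ind s t x).
  exact: (intg_bndl (measurable_curl_transport hu M i _) (fun x => curl_transport_le x i _) (intg_ind s t)).
apply: etrans (f_equal2 (fun a b => a - b) (e1 t) (e1 s)) _.
apply: etrans (esym (sumrB _ _ _ _)) _.
have e3 x : (\sum_i trans x i (T i)) * ind s t x = \sum_i ctrans x i (W i) * ind s t x.
  exact: (etrans (congr1 (fun z => z * ind s t x) (e2 x)) (mulr_suml _ _ _ _)).
apply: esym; apply: etrans (Rint_ext leb e3) _.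
apply: etrans (Rint_sum _ it) _.
by apply: eq_bigr => i _; apply: esym; exact: good_identity.
Qed.

(** ** The quadratic form of the mollified helicity *)

Variable N : nat.
Hypothesis N0 : (0 < N)%N.

Let w t i := mT (v t) N i.
Let test t i := testT (v t) N i.

Let iv t i : intg mu (v t i) := intg_u (vel_tame hu M0 t) i.

(** The polarized form of [hel], between the fields at two times. *)
Definition bilinear s t : R := \sum_i \int[mu]_x (tp (w s i) x * tp (curlT (w t) i) x).

Lemma bilinear_sym s t : bilinear s t = bilinear t s.
Proof.
apply: etrans (esym (curl_sym (w s) (w t))) _.
by apply: eq_bigr => i _; exact: (pairC (curlT (w s) i) (w t i)).
Qed.

Lemma bilinear_moment s t : bilinear s t = \sum_i mom s i (test t i).
Proof.
apply: eq_bigr => i _; rewrite /moment /test /testT (conv_adjoint _ _ (iv s i)).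
apply: Rint_ext => x.
exact: (etrans (mulrC _ _) (congr1 (fun z => tp (curlT (w t) i) x * z) (tp_mT (vel_tame hu M0 s) N i x))).
Qed.

(** The mollified field is mollified once more: its curl is the test field
    [testT]. *)
Definition stream t i := convT (KT (2 * N ^ 2)) (tp (w t i)).

(** Mollification commutes with the curl. *)
Lemma test_stream t i : tp (test t i) =1 tp (curlT (stream t) i).
Proof.
move=> x; pose k := KT (2 * N ^ 2) : seq (R * freq * R).
have c m : tp (convT k (tp m)) x = \int[mu]_y (tp k (x - y) * tp m y).
  exact: (tp_conv k x (intg_tp m)).
have ik m : intg mu (fun y => tp k (x - y) * tp m y).
  exact: (intg_bndl (measurable_tp_subr k x) (fun y => tp_le k (x - y)) (intg_tp m)).
have e a b : tp (dT a (stream t b)) x = \int[mu]_y (tp k (x - y) * tp (dT a (w t b)) y).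
  exact: (etrans (conv_dT a k (w t b) x) (c _)).
apply: etrans (c (curlT (w t) i)) _; apply: esym.
apply: etrans (tp_curlT (stream t) i x) _.
apply: etrans (f_equal2 (fun a b => a - b) (e (i + 1) (i + 2%:R)) (e (i + 2%:R) (i + 1))) _.
apply: etrans (esym (RintB (ik (dT (i + 1) (w t (i + 2%:R)))) (ik (dT (i + 2%:R) (w t (i + 1)))))) _.
apply: Rint_ext => y; apply: esym.
exact: (etrans (congr1 (fun z => tp k (x - y) * z) (tp_curlT (w t) i y)) (mulrBr _ _ _)).
Qed.

Lemma moment_curl t (W : 'I_3 -> seq (R * freq * R)) :
  \sum_i mom t i (curlT W i) = \sum_i cmom t i (W i).
Proof.
rewrite !sum3 /curl_moment /curlT !moment_cat !moment_scale !oE; exact: curl_shuffle.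
Qed.

Lemma transport_curl t (W : 'I_3 -> seq (R * freq * R)) :
  \sum_i trans t i (curlT W i) = \sum_i ctrans t i (W i).
Proof.
rewrite !sum3 /curl_transport /curlT !transport_cat !transport_scale !oE; exact: curl_shuffle.
Qed.

Lemma test_identity s t r : good s -> good t -> s <= t ->
  \sum_i mom t i (test r i) - \sum_i mom s i (test r i) =
  \int[leb]_x ((\sum_i trans x i (test r i)) * ind s t x).
Proof.
move=> gs gt st.
have e1 q : \sum_i mom q i (test r i) = \sum_i cmom q i (stream r i).
  by rewrite -moment_curl; apply: eq_bigr => i _; apply: moment_ext; exact: test_stream.
have e2 q : \sum_i trans q i (test r i) = \sum_i ctrans q i (stream r i).
  by rewrite -transport_curl; apply: eq_bigr => i _; apply: transport_ext; exact: test_stream.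
exact: (identity_of_curl e1 e2 gs gt st).
Qed.
(** ** Lipschitz dependence of the test field on time *)

(** The bound is uniform in x since the reflected kernel has the same
    amplitudes. *)
Definition kbound : R := \sum_i curl_bound i (KT (2 * N ^ 2)).

Lemma curl_bound_ge0 i l : 0 <= curl_bound i l.
Proof. exact: le_trans (normr_ge0 _) (curl_transport_le 0 i l). Qed.

(** The curl of the mollified field at x is a pairing with the curl of the
    kernel seen from x, so [good_identity] applies to it. *)
Lemma curl_w t i x : tp (curlT (w t) i) x = cmom t i (reflT x (KT (2 * N ^ 2))).
Proof.
have e a b : tp (dT a (w t b)) x = - mom t b (dT a (reflT x (KT (2 * N ^ 2)))).
  rewrite /w dT_conv tp_conv; last exact: iv.
  rewrite dT_refl moment_scale mulN1r opprK; apply: Rint_ext => y.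
  by rewrite tp_refl mulrC.
by rewrite tp_curlT !e /curl_moment; ring.
Qed.

Lemma curl_w_lipschitz s t i x : good s -> good t -> s <= t ->
  `|tp (curlT (w t) i) x - tp (curlT (w s) i) x| <= kbound * (t - s).
Proof.
move=> gs gt st; pose k := KT (2 * N ^ 2) : seq (R * freq * R).
have e := etrans (f_equal2 (fun a b => a - b) (curl_w t i x) (curl_w s i x))
  (good_identity gs gt st i (reflT x k)).
have b r : `|ctrans r i (reflT x k) * ind s t r| <= kbound * ind s t r.
  rewrite normrM (ger0_norm (ind_ge0 _ _ _)); apply: ler_wpM2r; first exact: ind_ge0.
  apply: (le_trans (curl_transport_le _ _ _)).
  have er : curl_bound i (reflT x k) = curl_bound i k.
    by congr ((_ + _) * _); apply: eq_bigr => j _; exact: tpbound_dT_refl.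
  rewrite er /kbound (bigD1 i)//= lerDl sumr_ge0// => j _; exact: curl_bound_ge0.
have ek : kbound * (t - s) = \int[leb]_r (kbound * ind s t r).
  exact: (esym (etrans (RintZ kbound (intg_ind s t)) (congr1 (fun z => kbound * z) (Rint_ind st)))).
apply: (eq_ind_r (fun z => `|z| <= kbound * (t - s)) _ e).
apply: (eq_ind_r (fun z => `|\int[leb]_r (ctrans r i (reflT x k) * ind s t r)| <= z) _ ek).
apply: Rint_norm_le => //; last exact: (intgZ kbound (intg_ind s t)).
exact: (intg_bndl (measurable_curl_transport hu M i _) (fun x => curl_transport_le x i _) (intg_ind s t)).
Qed.

Definition tbound : R := \sum_j tpbound (dT j (KT (2 * N ^ 2))).

Lemma tbound_ge0 : 0 <= tbound.
Proof. by apply: sumr_ge0 => j _; exact: tpbound_ge0. Qed.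

Lemma kbound_ge0 : 0 <= kbound.
Proof. by apply: sumr_ge0 => j _; exact: curl_bound_ge0. Qed.

Lemma test_lipschitz s t i j x : good s -> good t -> s <= t ->
  `|tp (dT j (test t i)) x - tp (dT j (test s i)) x| <= tbound * (kbound * (t - s)).
Proof.
move=> gs gt st; pose k := dT j (KT (2 * N ^ 2)) : seq (R * freq * R).
have e r : tp (dT j (test r i)) x = \int[mu]_y (tp k (x - y) * tp (curlT (w r) i) y).
  exact: (etrans (congr1 (fun l => tp l x) (dT_conv j (KT (2 * N ^ 2)) (tp (curlT (w r) i))))
    (tp_conv k x (intg_tp _))).
have i1 r : intg mu (fun y => tp k (x - y) * tp (curlT (w r) i) y).
  exact: (intg_bndl (measurable_tp_subr k x) (fun y => tp_le k (x - y)) (intg_tp _)).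
have e' := etrans (f_equal2 (fun a b => a - b) (e t) (e s)) (esym (RintB (i1 t) (i1 s))).
pose C := tbound * (kbound * (t - s)).
apply: (eq_ind_r (fun z => `|z| <= C) _ e').
apply: (eq_ind _ (fun z => _ <= z) _ _ (torus_integral_cst C)).
apply: Rint_norm_le; [exact: (intgB (i1 t) (i1 s))|exact: (@intg_cst _ _ _ mu)|].
move=> y; apply: (eq_ind _ (fun z => `|z| <= C) _ _ (mulrBr _ _ _)).
rewrite normrM; apply: ler_pM => //; last exact: curl_w_lipschitz.
apply: (le_trans (tp_le _ _)); rewrite /tbound (bigD1 j)//= lerDl.
by apply: sumr_ge0 => a _; exact: tpbound_ge0.
Qed.

Definition fbound : R := 9 * (tbound * kbound * B).

(** The constant depends on the scale; it only enters the quadratic error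
    that [subdivision] removes. *)
Lemma flux_lipschitz s t r : good s -> good t -> s <= t ->
  `|\sum_i trans r i (test t i) - \sum_i trans r i (test s i)| <= fbound * (t - s).
Proof.
move=> gs gt st; have ts0 : 0 <= t - s by rewrite subr_ge0.
have K0 : 0 <= tbound * (kbound * (t - s)).
  by rewrite !mulr_ge0 ?tbound_ge0 ?kbound_ge0.
have b i j : `|\int[mu]_x (v r i x * v r j x * tp (dT j (test t i)) x) -
    \int[mu]_x (v r i x * v r j x * tp (dT j (test s i)) x)| <= tbound * (kbound * (t - s)) * B.
  have i1 q := intg_vel2_tp hu M0 r i j (dT j (test q i)).
  apply: (eq_ind _ (fun z => `|z| <= _) _ _ (RintB (i1 t) (i1 s))).
  apply: (@vel_Rint_le _ _ hu _ M0 r _ _ (intgB (i1 t) (i1 s)) K0) => x.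
  apply: (eq_ind _ (fun z => `|z| <= _) _ _ (mulrBr _ _ _)).
  rewrite normrM mulrC; apply: ler_pM => //; first exact: test_lipschitz.
  exact: vel2_le.
apply: (eq_ind _ (fun z => `|z| <= _) _ _ (sumrB _ _ _ _)).
apply: (le_trans (ler_norm_sum _ _ _)).
apply: (@le_trans _ _ (\sum_(i < 3) \sum_(j < 3) (tbound * (kbound * (t - s)) * B))).
  apply: ler_sum => i _; apply: (eq_ind _ (fun z => `|z| <= _) _ _ (sumrB _ _ _ _)).
  apply: (le_trans (ler_norm_sum _ _ _)).
  by apply: ler_sum => j _; exact: b.
rewrite !sumr_const !card_ord /fbound.
by rewrite le_eqVlt; apply/orP; left; apply/eqP; ring.
Qed.

Definition flux_bound : R := 36 * CK * CR * A * (N%:R ^+ 2 * (N%:R `^ (theta * 3))^-1).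

Lemma flux_test_le t : good t -> `|\sum_i trans t i (test t i)| <= flux_bound.
Proof.
move=> gt; have [_ _ ru _ _] := gt.
have -> : \sum_i trans t i (test t i) = flux (v t) (testT (v t) N) by [].
have e := good_vel gt.
have sol x : \sum_i tp (dT i (mT (comp (u t)) N i)) x = 0.
  by rewrite -e; exact: good_solenoidal.
by rewrite e; exact: (flux_le ru N0 sol).
Qed.

Lemma fbound_ge0 : 0 <= fbound.
Proof.
exact: mulr_ge0 (ler0n _ 9) (mulr_ge0 (mulr_ge0 tbound_ge0 kbound_ge0) (VB_ge0 M0)).
Qed.

Lemma ge0_flux_bound t : good t -> 0 <= flux_bound.
Proof. by move=> gt; apply: le_trans (normr_ge0 _) (flux_test_le gt). Qed.

(** At an intermediate time q the flux through the test field of time q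
    obeys the optimal bound, and replacing this test field by the one of
    time r costs the Lipschitz error. *)
Lemma test_increment s t r : good s -> good t -> good r -> s <= r <= t ->
  `|\sum_i mom t i (test r i) - \sum_i mom s i (test r i)| <=
  (flux_bound + fbound * (t - s)) * (t - s).
Proof.
move=> gs gt gr /andP[sr rt]; have st := le_trans sr rt.
have ts0 : 0 <= t - s by rewrite subr_ge0.
have b0 : 0 <= flux_bound + fbound * (t - s).
  by apply: addr_ge0; [exact: ge0_flux_bound gt|exact: mulr_ge0 fbound_ge0 ts0].
pose c := flux_bound + fbound * (t - s).
have ec : c * (t - s) = \int[leb]_x (c * ind s t x).
  exact: (esym (etrans (RintZ c (intg_ind s t)) (congr1 (fun z => c * z) (Rint_ind st)))).
apply: (eq_ind_r (fun z => `|z| <= c * (t - s)) _ (test_identity r gs gt st)).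
apply: (eq_ind_r (fun z => _ <= z) _ ec).
apply: Rint_ae_norm_le.
- have iS : intg leb (fun x : RT => \sum_i trans x i (test r i) * ind s t x); last first.
    by apply: intg_eq iS => x; apply: esym; exact: mulr_suml.
  apply: intg_sum => i.
  exact: (intg_bndl (measurable_transport hu M i _) (fun x => transport_le hu M0 x i _) (intg_ind s t)).
- by apply: intgZ; exact: intg_ind.
- by move=> x; exact: mulr_ge0 b0 (ind_ge0 _ _ _).
- apply: ae_sub ae_good => q gq; rewrite normrM (ger0_norm (ind_ge0 _ _ _)) indE.
  have [/andP[sq qt]|_] := boolP (s <= q <= t); last by rewrite !mulr0.
  rewrite !mulr1; have s0 : 0 < s by case: gs.
  have {}gq := gq (lt_le_trans s0 sq).
  apply: (norm_shift (b := \sum_i trans q i (test q i))); first exact: flux_test_le.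
  have [qr|rq] := leP q r.
    apply: (le_trans (flux_lipschitz q gq gr qr)); apply: ler_wpM2l; first exact: fbound_ge0.
    by apply: lerB.
  rewrite distrC; apply: (le_trans (flux_lipschitz q gr gq (ltW rq))).
  by apply: ler_wpM2l; [exact: fbound_ge0|apply: lerB].
Qed.

(** By symmetry of the bilinear form, the increment of the helicity is the
    sum of the increments of the field tested with the test fields of both
    end points. *)
Lemma hel_time s t : good s -> good t -> s <= t ->
  `|hel (v t) N - hel (v s) N| <= 2 * flux_bound * (t - s).
Proof.
move=> gs gt st; have s0 : 0 < s by case: gs.
apply: (@subdivision _ good (fun t => hel (v t) N) (2 * flux_bound) (2 * fbound)) => //.
- exact: mulr_ge0 (ler0n _ 2) fbound_ge0.
- exact: ae_good.
- move=> {s0 gs gt st}s {}t s0 st gs gt.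
  have e := bilinear_increment (bilinear_moment t t) (bilinear_moment s t)
    (bilinear_moment t s) (bilinear_moment s s) (bilinear_sym s t).
  apply: (eq_ind_r (fun z => `|z| <= _) _ e).
  have h1 := test_increment gs gt gt; rewrite st lexx in h1.
  have h2 := test_increment gs gt gs; rewrite st lexx in h2.
  apply: (le_trans (ler_normD _ _)); apply: (le_trans (lerD (h1 isT) (h2 isT))).
  by rewrite le_eqVlt; apply/orP; left; apply/eqP; ring.
Qed.

End GoodTimes.

(** * Hoelder functions of time and the choice of the scale *)

Section HolderExtension.
Context {R : realType}.
Local Notation RT := (measurableTypeR R).
Local Notation leb := (@lebesgue_measure R).

Lemma powR_le (x y g : R) : 0 <= g -> 0 <= x -> x <= y -> x `^ g <= y `^ g.
Proof. by move=> g0 x0 xy; apply: ge0_ler_powR; rewrite ?nnegrE// (le_trans x0). Qed.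

Lemma half_powers (d : R) : 0 < d -> exists n, (1 / 2) ^+ n <= d.
Proof.
move=> d0; have h : 0 < (1 / 2 : R) < 1 by apply/andP; split; lra.
have := geo_small 1 h; move/cvgrPdist_lt/(_ d d0) => [n _ /(_ n (leqnn n))] /=.
rewrite sub0r normrN mul1r => hn; exists n; apply: ltW; exact: le_lt_trans (ler_norm _) hn.
Qed.

(** Approach any other time along good times at dyadic distances; the values
    converge geometrically. Two arbitrary times are compared through a good
    time between them. *)
Lemma holder_extension (P : R -> Prop) (h : R -> R) (C g : R) : 0 < g -> 0 < C ->
  {ae leb, forall t : RT, 0 < t -> P t} ->
  (forall s t, P s -> P t -> `|h t - h s| <= C * `|t - s| `^ g) ->
  exists H : R -> R, (forall t, 0 < t -> P t -> H t = h t) /\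
    exists2 C' : R, 0 < C' & forall t s, 0 < t -> 0 < s -> `|H t - H s| <= C' * `|t - s| `^ g.
Proof.
move=> g0 C0 hP hC.
pose r : R := (1 / 2) `^ g.
have r0 : 0 < r by rewrite powR_gt0.
have r1 : r < 1.
  have e : 1 = 1 `^ g :> R by rewrite powR1.
  by rewrite [ltRHS]e; apply: gt0_ltr_powR; rewrite // ?nnegrE//; lra.
have hr : 0 < r < 1 by rewrite r0.
have rn n : ((1 / 2) ^+ n) `^ g = r ^+ n.
  have p0 : 0 <= 1 / 2 :> R by lra.
  by rewrite -[X in X `^ g](powR_mulrn n p0) -powRrM [n%:R * g]mulrC powRrM powR_mulrn ?powR_ge0.
(* The tail of the geometric series, plus the distance to its n-th term. *)
pose C1 := C / (1 - r) + C * 2 `^ g.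
have C1C : C <= C1.
  apply: (@le_trans _ _ (C / (1 - r))); first by rewrite ler_pdivlMr ?subr_gt0// ler_piMr ?(ltW C0)// gerBl (ltW r0).
  by rewrite lerDl mulr_ge0 ?powR_ge0// ltW.
have C10 : 0 < C1 by exact: lt_le_trans C1C.
have hl t : exists l : R, 0 < t -> (P t -> l = h t) /\
    forall s, P s -> s != t -> `|l - h s| <= C1 * `|t - s| `^ g.
  have [Pt|nPt] := pselect (P t).
    exists (h t) => t0; split=> // s Ps _; apply: (le_trans (hC s t Ps Pt)).
    by rewrite ler_wpM2r// powR_ge0.
  have [t0|t0] := ltP 0 t; last by exists 0.
  have hs n : exists s, t < s < t + (1 / 2) ^+ n /\ P s.
    have [||s hs Ps] := @ae_dense _ P t (t + (1 / 2) ^+ n) hP; [exact: ltW| |by exists s].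
    by rewrite ltrDl exprn_gt0.
  have /choice[s hs'] := hs.
  have dist n m : (n <= m)%N -> `|s m - s n| <= (1 / 2) ^+ n.
    move=> nm; have [/andP[a1 a2] _] := hs' n; have [/andP[b1 b2] _] := hs' m.
    have hnm : (1 / 2) ^+ m <= (1 / 2) ^+ n :> R by rewrite ler_wiXn2l//; lra.
    by rewrite ler_norml; apply/andP; split; lra.
  have [n|l [_ hl]] := @geo_cauchy R (fun n => h (s n)) C r (ltW C0) hr.
    apply: (le_trans (hC _ _ (hs' n).2 (hs' n.+1).2)); rewrite -rn.
    by rewrite ler_wpM2l ?(ltW C0)//; apply: powR_le; [exact: ltW|exact: normr_ge0|exact: dist].
  exists l => _; split=> // q Pq qt.
  have d0 : 0 < `|t - q| by rewrite normr_gt0 subr_eq0 eq_sym.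
  have [n hn] := half_powers d0.
  have -> : l - h q = (h (s n) - h q) - (h (s n) - l) by ring.
  apply: (le_trans (ler_normB _ _)); rewrite addrC /C1 mulrDl; apply: lerD.
    apply: (le_trans (hl n)); rewrite mulrAC ler_wpM2l ?divr_ge0 ?(ltW C0) ?subr_ge0 ?(ltW r1)//.
    have p0 : 0 <= 1 / 2 :> R by lra.
    by rewrite -rn; exact: (powR_le (ltW g0) (exprn_ge0 n p0) hn).
  apply: (le_trans (hC _ _ Pq (hs' n).2)); rewrite -mulrA ler_wpM2l ?(ltW C0)//.
  rewrite -powRM//; apply: powR_le; [exact: ltW|exact: normr_ge0|].
  have [/andP[a1 a2] _] := hs' n.
  have -> : s n - q = (s n - t) + (t - q) by ring.
  apply: (le_trans (ler_normD _ _)); rewrite mulr2n mulrDl mul1r lerD2r.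
  by apply: le_trans hn; rewrite ger0_norm; lra.
have /choice[H hH] := hl.
exists H; split; first by move=> t t0; have [] := hH t t0.
exists (2 * C1); first by rewrite mulr_gt0.
have main t s : 0 < t -> t < s -> `|H t - H s| <= 2 * C1 * `|t - s| `^ g.
  move=> t0 ts; have s0 := lt_trans t0 ts.
  have [q /andP[tq qs] Pq] := ae_dense hP (ltW t0) ts.
  have [_ h1] := hH t t0; have [_ h2] := hH s s0.
  have -> : H t - H s = (H t - h q) - (H s - h q) by ring.
  have n1 : `|t - q| `^ g <= `|t - s| `^ g.
    by apply: powR_le; [exact: ltW|exact: normr_ge0|rewrite !ltr0_norm; lra].
  have n2 : `|s - q| `^ g <= `|t - s| `^ g.
    by apply: powR_le; [exact: ltW|exact: normr_ge0|rewrite gtr0_norm ?ltr0_norm; lra].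
  apply: (le_trans (ler_normB _ _)).
  have qt : q != t by rewrite gt_eqF.
  have qs' : q != s by rewrite lt_eqF.
  have m1 := le_trans (h1 q Pq qt) (ler_wpM2l (ltW C10) n1).
  have m2 := le_trans (h2 q Pq qs') (ler_wpM2l (ltW C10) n2).
  by apply: (le_trans (lerD m1 m2)); rewrite -mulrDl -mulr2n mulr_natl.
move=> t s t0 s0; have [ts|st|->] := ltgtP t s; first exact: main.
  by rewrite distrC [`|t - s|]distrC; exact: main.
by rewrite subrr normr0 mulr_ge0 ?powR_ge0// mulr_ge0// ltW.
Qed.

Lemma holder_continuous (H : R -> R) (C g : R) : 0 < g -> 0 < C ->
  (forall t s, 0 < t -> 0 < s -> `|H t - H s| <= C * `|t - s| `^ g) ->
  forall t, 0 < t -> {for t, continuous H}.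
Proof.
move=> g0 C0 h t t0; apply/cvgrPdist_lt => e e0.
pose d := (e / C) `^ g^-1.
have eC : 0 < e / C by rewrite divr_gt0.
have d0 : 0 < d by rewrite powR_gt0.
near=> s.
have s0 : 0 < s by near: s; exact: lt_nbhsr.
have sd : `|t - s| < d by near: s; exact: cvgr_dist_lt.
apply: (le_lt_trans (h t s t0 s0)); rewrite mulrC -ltr_pdivlMr//.
have -> : e / C = d `^ g by rewrite /d -powRrM mulVf ?gt_eqF// powRr1// ltW.
by apply: gt0_ltr_powR; rewrite // ?nnegrE ?normr_ge0 ?ltW.
Unshelve. all: by end_near.
Qed.

(** ** The optimal dyadic scale *)

(** The least power of two above y. *)
Lemma dyadic_scale (y : R) : 1 <= y -> exists n, y <= (2 ^ n)%:R <= 2 * y.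
Proof.
move=> y1; have y0 : 0 < y by exact: lt_le_trans y1.
have ex : exists n : nat, y <= (2 ^ n)%:R.
  have [n hn] := half_powers (eq_ind_r is_true y0 (invr_gt0 y)).
  exists n; move: hn; rewrite div1r exprVn lef_pV2 ?posrE ?exprn_gt0// natrX//.
case: (ex_minnP ex) => n hn hmin; exists n; rewrite hn /=.
case: n hn hmin => [|n] hn hmin.
  by rewrite expn0; apply: (le_trans y1); rewrite ler_peMl ?ler1n// ltW.
rewrite expnS natrM ler_pM2l//.
by rewrite leNgt; apply/negP => h; have := hmin n (ltW h); rewrite ltnn.
Qed.

(** The scale X ^ (- 1) with X ^ (1 - theta) = 1 / d, up to a factor 2,
    balances the error X ^ (1 - 2 theta) of the approximation with the flux
    X ^ (2 - 3 theta) during a time d. *)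
Lemma scale_optimum (theta d : R) : 1 / 2 < theta < 1 -> 0 < d <= 1 -> exists n,
  let X : R := (2 ^ n)%:R in
  X * (X `^ (theta * 2))^-1 <= d `^ ((2 * theta - 1) / (1 - theta)) /\
  X ^+ 2 * (X `^ (theta * 3))^-1 * d <= 2 * d `^ ((2 * theta - 1) / (1 - theta)).
Proof.
move=> /andP[th1 th2] /andP[d0 d1].
have t1 : 0 < 1 - theta by rewrite subr_gt0.
(* The scale at which the two errors balance exactly. *)
pose y := d `^ (- (1 - theta)^-1).
have y0 : 0 < y by rewrite powR_gt0.
have y1 : 1 <= y.
  rewrite /y powRN invf_ge1 ?powR_gt0//.
  rewrite [leRHS](_ : 1 = 1 `^ (1 - theta)^-1); last by rewrite powR1.
  by apply: powR_le => //; [rewrite invr_ge0 ltW|exact: ltW].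
have [n /andP[yX Xy]] := dyadic_scale y1; exists n => X; rewrite -/X in yX Xy.
have X0 : 0 < X by exact: lt_le_trans yX.
have e1 : X * (X `^ (theta * 2))^-1 = (X `^ (2 * theta - 1))^-1.
  rewrite -{1}(powRr1 (ltW X0)) -!powRN -powRD; last by rewrite (lt0r_neq0 X0) implybT.
  by congr (_ `^ _); ring.
have e2 : X ^+ 2 * (X `^ (theta * 3))^-1 = (X `^ (2 * theta - 1))^-1 * X `^ (1 - theta).
  rewrite -(powR_mulrn _ (ltW X0)) -!powRN -!powRD; try by rewrite (lt0r_neq0 X0) implybT.
  by congr (_ `^ _); ring.
have yg : (y `^ (2 * theta - 1))^-1 = d `^ ((2 * theta - 1) / (1 - theta)).
  by rewrite /y -powRrM -powRN; congr (_ `^ _); field; rewrite gt_eqF.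
have yd : y `^ (1 - theta) = d^-1.
  by rewrite /y -powRrM mulNr mulVf ?gt_eqF// powR_inv1// ltW.
have b1 : (X `^ (2 * theta - 1))^-1 <= (y `^ (2 * theta - 1))^-1.
  rewrite lef_pV2 ?posrE ?powR_gt0//; apply: powR_le => //; last exact: ltW.
  by lra.
split; first by rewrite e1 -yg.
have b2 : X `^ (1 - theta) <= 2 * d^-1.
  apply: (@le_trans _ _ ((2 * y) `^ (1 - theta))); first by apply: powR_le => //; exact: ltW.
  rewrite powRM ?(ltW y0)// yd; apply: ler_wpM2r; first by rewrite invr_ge0 ltW.
  by apply: ler1_powR; [rewrite ler1n|lra].
have b0 : 0 <= (X `^ (2 * theta - 1))^-1 by rewrite invr_ge0 powR_ge0.
rewrite e2 -yg -ler_pdivlMr//.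
apply: (le_trans (ler_pM b0 (powR_ge0 _ _) b1 b2)).
by rewrite le_eqVlt; apply/orP; left; apply/eqP; rewrite mulrCA mulrA.
Qed.

End HolderExtension.

Lemma final_small (R : realType) (K1 K2 Kb h h' k k' p : R) :
  `|k - h| <= K1 * p -> `|k' - h'| <= K1 * p -> `|k - k'| <= 2 * (K2 * (2 * p)) -> 0 <= Kb -> 0 <= p ->
  `|h - h'| <= (2 * K1 + 4 * K2 + 2 * Kb + 1) * p.
Proof.
move=> h1 h2 h3 Kb0 p0.
have -> : h - h' = (k - k') - (k - h) + (k' - h') by ring.
apply: (le_trans (ler_normD _ _)).
apply: (le_trans (lerD (ler_normB _ _) (lexx _))).
apply: (le_trans (lerD (lerD h3 h1) h2)).
have := mulr_ge0 Kb0 p0; nra.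
Qed.

Lemma final_large (R : realType) (K1 K2 Kb h h' k k' p : R) :
  `|k - h| <= K1 -> `|k' - h'| <= K1 -> `|k| <= Kb -> `|k'| <= Kb -> 0 <= K2 -> 1 <= p ->
  `|h - h'| <= (2 * K1 + 4 * K2 + 2 * Kb + 1) * p.
Proof.
move=> h1 h2 h3 h4 K20 p1.
have K10 := le_trans (normr_ge0 _) h1; have Kb0 := le_trans (normr_ge0 _) h3.
have -> : h - h' = (k - k') - (k - h) + (k' - h') by ring.
apply: (le_trans (ler_normD _ _)).
apply: (le_trans (lerD (ler_normB _ _) (lexx _))).
apply: (le_trans (lerD (lerD (le_trans (ler_normB _ _) (lerD h3 h4)) h1) h2)).
have c0 : 0 <= 2 * K1 + 4 * K2 + 2 * Kb + 1 by lra.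
apply: (@le_trans _ _ (2 * K1 + 4 * K2 + 2 * Kb + 1)); first lra.
exact: ler_peMr.
Qed.

Section Assembly.
Context {R : realType}.
Local Notation V := (measurableTypeR R * measurableTypeR R * measurableTypeR R)%type.
Local Notation RT := (measurableTypeR R).
Local Notation mu := (@tmu R).
Local Notation leb := (@lebesgue_measure R).
Variables (theta M A : R) (u : R -> vec R -> vec R).
Hypothesis theta01 : 1 / 2 < theta < 1.
Hypothesis hu : euler_weak_solution u.
Hypothesis M0 : 0 <= M.
Hypothesis hM : {ae leb, forall t : RT, 0 < t -> (\int[mu]_x (enorm (u t x) ^+ 3)%:E <= M%:E)%E}.
Hypothesis A0 : 0 <= A.
Hypothesis hA : {ae leb, forall t : RT, 0 < t -> rough theta A (comp (u t))}.

Local Notation v := (sect (vel u M)).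
Local Notation ok := (good u M theta A).

Lemma tpbound_refl (x : vec R) l : tpbound (reflT x l) = tpbound l.
Proof. by rewrite /tpbound /reflT big_map. Qed.

Lemma tpbound_dT1_refl (x : vec R) a l : tpbound (dT a (reflT x l)) = tpbound (dT a l).
Proof.
rewrite /tpbound /dT /reflT !big_map; apply: eq_bigr => t _ /=.
by rewrite waveN mulrN normrN.
Qed.

(** The Hoelder bound for distant times only requires the helicity to be
    bounded, which is already visible at a fixed scale. *)
Lemma hel_bounded N : exists K : R, forall t, `|hel (v t) N| <= K.
Proof.
pose k := KT (2 * N ^ 2) : seq (R * freq * R); pose B := VB M.
have hw t i x : `|tp (mT (v t) N i) x| <= tpbound k * B.
  have tv := vel_tame hu M0 t.
  rewrite tp_conv; last exact: (intg_u tv i).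
  rewrite -(tpbound_refl x k) (Rint_ext _ (g := fun y : V => v t i y * tp (reflT x k) y)).
    exact: (vel_tp_le hu M0 t i (reflT x k)).
  by move=> y; rewrite tp_refl mulrC.
have hd t a i x : `|tp (dT a (mT (v t) N i)) x| <= tpbound (dT a k) * B.
  have tv := vel_tame hu M0 t.
  rewrite dT_conv tp_conv; last exact: (intg_u tv i).
  rewrite -(tpbound_dT1_refl x a k) -normrN -RintN; last first.
    apply: (intg_bndl (measurable_tp_subr _ x) (fun y => tp_le _ (x - y))); exact: (intg_u tv i).
  rewrite (Rint_ext _ (g := fun y : V => v t i y * tp (dT a (reflT x k)) y)).
    exact: (vel_tp_le hu M0 t i (dT a (reflT x k))).
  by move=> y; rewrite dT_refl tp_scale tp_refl; ring.
pose c i := tpbound k * B * (tpbound (dT (i + 1) k) * B + tpbound (dT (i + 2%:R) k) * B).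
exists (\sum_i c i) => t; apply: (le_trans (ler_norm_sum _ _ _)); apply: ler_sum => i _.
rewrite -[leRHS](torus_integral_cst (c i)).
apply: Rint_norm_le; [exact: intg_tp2|exact: (@intg_cst _ _ _ mu)|] => x.
rewrite normrM tp_curlT.
exact: (ler_pM (normr_ge0 _) (normr_ge0 _) (hw t i x)
  (le_trans (ler_normB _ _) (lerD (hd t (i + 1) (i + 2%:R) x) (hd t (i + 2%:R) (i + 1) x)))).
Qed.

Lemma approx_good t n : ok t ->
  `|hel (v t) (2 ^ n) - helicity (u t)| <=
  48 * CK ^+ 2 * (4 * (1 + A)) / (1 - rate theta ^+ 4) *
    ((2 ^ n)%:R * ((2 ^ n)%:R `^ (theta * 2))^-1).
Proof.
move=> gt; have [_ _ rt _ _] := gt.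
by rewrite (good_vel gt) rate_scale; exact: hel_approx.
Qed.

(** For close times optimize the scale; for distant times use the first
    scale. *)
Lemma holder_good : exists2 C : R, 0 < C & forall s t, ok s -> ok t ->
  `|helicity (u t) - helicity (u s)| <= C * `|t - s| `^ ((2 * theta - 1) / (1 - theta)).
Proof.
pose K1 := 48 * CK ^+ 2 * (4 * (1 + A)) / (1 - rate theta ^+ 4).
pose K2 := 36 * CK * CR * A.
have [Kb hKb] := hel_bounded (2 ^ 0).
have /andP[r0 r1] := rate01 theta01.
have K10 : 0 <= K1.
  apply: mulr_ge0.
    exact: mulr_ge0 (mulr_ge0 (ler0n _ 48) (sqr_ge0 _)) (mulr_ge0 (ler0n _ 4) (addr_ge0 ler01 A0)).
  by rewrite invr_ge0 subr_ge0 exprn_ile1// ltW.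
have K20 : 0 <= K2.
  have c0 := @CK_ge0 R.
  have cr0 : 0 <= CR :> R by rewrite /CR addr_ge0 ?sqr_ge0// mulr_ge0.
  exact: mulr_ge0 (mulr_ge0 (mulr_ge0 (ler0n _ 36) c0) cr0) A0.
have Kb0 : 0 <= Kb by exact: le_trans (normr_ge0 _) (hKb 0).
pose C := 2 * K1 + 4 * K2 + 2 * Kb + 1.
have C0 : 0 < C.
  by rewrite /C ltr_pwDr// !addr_ge0// mulr_ge0.
exists C => //.
have g0 : 0 < (2 * theta - 1) / (1 - theta).
  by case/andP: theta01 => h1 h2; rewrite divr_gt0//; lra.
set g := (2 * theta - 1) / (1 - theta) in g0 *.
have main s t : ok s -> ok t -> s < t -> `|helicity (u t) - helicity (u s)| <= C * `|t - s| `^ g.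
  move=> gs gt st; have d0 : 0 < t - s by rewrite subr_gt0.
  rewrite (gtr0_norm d0).
  have [d1|d1] := leP (t - s) 1.
    have [|n] := @scale_optimum R theta (t - s) theta01; first by rewrite d0.
    rewrite -/g; set X : R := (2 ^ n)%:R => -[b1 b2].
    have a1 := approx_good n gt; have a2 := approx_good n gs.
    have N0 : (0 < 2 ^ n)%N by rewrite expn_gt0.
    have a3 := hel_time hu M0 hM hA N0 gs gt (ltW st).
    rewrite -/X -/K1 in a1 a2.
    have b1' := ler_wpM2l K10 b1.
    have b2' := ler_wpM2l K20 b2.
    have a4 : `|hel (v t) (2 ^ n) - hel (v s) (2 ^ n)| <= 2 * (K2 * (2 * (t - s) `^ g)).
      apply: (le_trans a3); apply: le_trans (ler_wpM2l (ler0n _ 2) b2').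
      by rewrite /flux_bound -/X -/K2 !mulrA.
    apply: (final_small (le_trans a1 b1') (le_trans a2 b1') a4 Kb0); exact: powR_ge0.
  have a1 := approx_good 0 gt; have a2 := approx_good 0 gs.
  rewrite -/K1 expn0 powR1 invr1 !mulr1 in a1 a2.
  have pg : 1 <= (t - s) `^ g.
    rewrite [leLHS](_ : 1 = 1 `^ g); last by rewrite powR1.
    by apply: powR_le => //; exact: ltW.
  exact: (final_large a1 a2 (hKb t) (hKb s) K20 pg).
move=> s t gs gt; have [st|ts|->] := ltgtP s t; first exact: main.
  by rewrite distrC [`|t - s|]distrC; exact: main.
by rewrite subrr normr0 mulr_ge0 ?powR_ge0// ltW.
Qed.

End Assembly.

Theorem theorem1p4 (R : realType) (theta : R) (u : R -> vec R -> vec R)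
  (htheta : 1 / 2 < theta < 1)
  (hu : euler_weak_solution u)
  (huW : Linfty_sobolev theta 3 u) :
  exists H : R -> R,
    [/\ forall t : R, 0 < t -> {for t, continuous H},
        {ae time_measure, forall t : R, H t = helicity (u t)} &
        exists2 C : R, 0 < C &
          forall t s : R, 0 < t -> 0 < s ->
            `|H t - H s| <= C * `|t - s| `^ ((2 * theta - 1) / (1 - theta))].
Proof.
have /andP[th1 th2] := htheta.
have th0 : 0 < theta < 1 by apply/andP; split => //; lra.
have [M M0 hMg] := linfty_bound huW.
have hM : {ae @lebesgue_measure R, forall t : measurableTypeR R, 0 < t ->
    (\int[tmu]_x (enorm (u t x) ^+ 3)%:E <= M%:E)%E}.
  by apply: ae_sub hMg => t h t0; have [] := h t0.
pose A := 27 * CD * M.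
have A0 : 0 <= A by exact: mulr_ge0 (mulr_ge0 (ler0n _ 27) (ltW (@CD_gt0 R))) M0.
have hA : {ae @lebesgue_measure R, forall t : measurableTypeR R, 0 < t ->
    rough theta A (comp (u t))}.
  apply: ae_sub (ae_and hMg (ae_steady hu M0 hM)) => t [h st] t0.
  have [hper _ _ _ _] := hu; have [_ hg] := h t0.
  apply: gagliardo_rough => //; first exact: hper.
  have := vel_tame hu M0 t; rewrite vel_steady// sect_uext//.
have [C C0 hC] := holder_good htheta hu M0 hM A0 hA.
have g0 : 0 < (2 * theta - 1) / (1 - theta) by apply: divr_gt0; lra.
have [H [HP [C' C'0 hH]]] := holder_extension g0 C0 (ae_good hu M0 hM hA) hC.
exists H; split.
- exact: holder_continuous g0 C'0 hH.
- by apply/ae_time; apply: ae_sub (ae_good hu M0 hM hA) => t h t0; exact: HP t t0 (h t0).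
- by exists C'.
Qed.
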